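(* For every real $\alpha\neq 0$ the integral operator $$A_\alpha f(v)=\frac1{2\pi}\int_{-\infty}^{+\infty}K_\alpha(-it,v)\,f(it)\,dt,\qquad \operatorname{Re}v>0,$$ $$K_\alpha(u,v)=\int_0^\infty \exp(-ux^\alpha-vx)\,dx ,$$ is an invertible operator in the space $\mathcal K$, and for all $h\in\mathbb C$ $$A_\alpha D_hA_\alpha^{-1}=D_{\alpha h}.$$ Moreover, the following identities of operators in $\mathcal K$ hold for all $\alpha,\beta>0$ and $a>0$: (i) $A_\alpha A_\beta=A_{\alpha\beta}$; (ii) $A_\alpha\, z\, A_\alpha^{-1}f(z)=\dfrac1\alpha D_{1-\alpha}\bigl(zf(z)\bigr)$ for all $f\in\mathcal K$, where $z$ on the left denotes the operator of multiplication by the independent variable; (iii) $A_\alpha^{-1}R_aA_\alpha=R_{a^\alpha}$, where $R_ag(z)=a^{-1}g(z/a)$.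
   Context: $\mathcal K$ is the space of functions $f$ holomorphic in the half-plane $\operatorname{Re}z>0$, smooth up to the line $\operatorname{Re}z=0$, and such that for each integer $k\ge 0$ and each $N>0$ there exists $M$ with $|f^{(k)}(z)|\le M(1+|z|)^{-N}$ for all $\operatorname{Re}z\ge0$. For $f\in\mathcal K$ and $h\in\mathbb C\setminus\{-1,-2,\dots\}$ the operator of fractional differentiation is $$D_hf(z)=\frac{\Gamma(h+1)}{2\pi}\int_{-\infty}^{+\infty}\frac{f(it)\,dt}{(-it+z)^{h+1}},\qquad \operatorname{Re}z>0,$$ where the branch of the power is the one that is positive (for real $h$) when $t=0$ and $z=x>0$, i.e. the principal branch. For $h=-m$ with $m$ a positive integer, $D_{-m}f(z)$ is the limit of $D_hf(z)$ as $h\to-m$. Functions given by formulas for $\operatorname{Re}z>0$ are extended to $\operatorname{Re}z=0$ by continuity. *)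

(* Defs.v *)
From HB Require Import structures.
From mathcomp Require Import all_boot all_order all_algebra complex.
From mathcomp Require Import all_classical all_reals all_analysis.

Set Implicit Arguments.
Unset Strict Implicit.
Unset Printing Implicit Defensive.

Import Order.TTheory GRing.Theory Num.Theory.
Import numFieldNormedType.Exports.

Local Open Scope classical_set_scope.
Local Open Scope ring_scope.
Local Open Scope complex_scope.

(* The regular module carries the normed topology of the field R[i]; with it,
   [derivable f z 1] is complex differentiability at z. *)
Notation C R := (R[i]^o).

Local Notation Re := (@complex.Re _).
Local Notation Im := (@complex.Im _).

Section ComplexFunctions.
Variable R : realType.
Implicit Types (w s : C R) (x : R).

Definition cexp w : C R :=
  (expR (Re w))%:C * (cos (Im w) +i* sin (Im w)).

(* Principal logarithm, only meaningful on the half-plane [0 < Re w], where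
   the principal argument is [atan (Im w / Re w)]. *)
Definition clog w : C R :=
  ln (Re `|w|) +i* atan (Im w / Re w).

(* Principal power w ^ s, for [0 < Re w]. *)
Definition cpow w s : C R := cexp (s * clog w).

Definition cintegral (A : set R) (f : R -> C R) : C R :=
  (\int[lebesgue_measure]_(x in A) Re (f x)) +i*
  (\int[lebesgue_measure]_(x in A) Im (f x)).

Definition Gamma_integral s : C R :=
  cintegral `]0, +oo[ (fun x => cpow x%:C (s - 1) * cexp (- x%:C)).

(* Gamma (s) = Gamma (s + n) / (s (s + 1) ... (s + n - 1)), where n is the
   least natural number such that [0 < Re s + n] (so n = 0 if [0 < Re s]). *)
Definition cGamma s : C R :=
  let n := Num.truncn (1 - Re s) in
  Gamma_integral (s + n%:R) / \prod_(k < n) (s + k%:R).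

End ComplexFunctions.

Section SpaceK.
Variable R : realType.
Implicit Types (f g : C R -> C R) (z v h u : C R).

Definition rhp : set (C R) := [set z | 0 < Re z].
Definition crhp : set (C R) := [set z | 0 <= Re z].

(* A function on the closed half-plane is represented by the total function
   that vanishes off it, so that equality of functions is plain equality. *)

(* Extension by continuity to [Re z = 0] of a function given for [0 < Re z];
   the values of g outside the open half-plane are ignored. *)
Definition bdext g : C R -> C R := fun z =>
  if 0 < Re z then g z
  else if Re z == 0 then lim (g w @[w --> within rhp (nbhs z)])
  else 0.

(* [bdext (derive1n k f)] is the k-th derivative f^(k) on the closed half-plane:
   the complex derivative inside, its continuous extension on the boundary.
   The second clause for k = 0 is holomorphy and already entails the others. *)
Definition spaceK : set (C R -> C R) := [set f |
  [/\ bdext f = f,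
      forall k z, rhp z -> derivable (derive1n k f) z 1,
      forall k, {within crhp, continuous (bdext (derive1n k f))} &
      forall k N : nat, exists M : R, forall z, crhp z ->
        `|bdext (derive1n k f) z| <= M%:C * (1 + `|z|) ^- N]].

Definition linear_on_K (T : (C R -> C R) -> (C R -> C R)) : Prop :=
  forall (c : C R) f g, spaceK f -> spaceK g ->
    T (fun z => c * f z + g z) = (fun z => c * T f z + T g z).

Definition operator_in_K (T : (C R -> C R) -> (C R -> C R)) : Prop :=
  set_fun spaceK spaceK T /\ linear_on_K T.

Definition invertible_in_K (T : (C R -> C R) -> (C R -> C R)) : Prop :=
  operator_in_K T /\ set_bij spaceK spaceK T.

Definition inverse_in_K (T : (C R -> C R) -> (C R -> C R)) :
    (C R -> C R) -> (C R -> C R) :=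
  'pinv_(id) spaceK T.

(* The defining formula of D_h f (z), for h not a negative integer. *)
Definition fracD_formula h f z : C R :=
  cGamma (h + 1) / (2 * pi)%:C *
  cintegral setT (fun t : R => f (t *i) / cpow (- t *i + z) (h + 1)).

Definition fracD_open h f z : C R :=
  if `[< exists m : nat, h = - m.+1%:R >]
  then lim (fracD_formula h' f z @[h' --> h^'])
  else fracD_formula h f z.

Definition fracD h f : C R -> C R := bdext (fracD_open h f).

Definition kernelA (alpha : R) u v : C R :=
  cintegral `]0, +oo[ (fun x : R => cexp (- u * (x `^ alpha)%:C - v * x%:C)).

Definition opA (alpha : R) f : C R -> C R :=
  bdext (fun v => (2 * pi)^-1%:C *
    cintegral setT (fun t : R => kernelA alpha (- t *i) v * f (t *i))).

Definition opAinv (alpha : R) : (C R -> C R) -> (C R -> C R) :=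
  inverse_in_K (opA alpha).

Definition mulz f : C R -> C R := fun z => z * f z.

Definition dilR (a : R) g : C R -> C R := fun z => a%:C^-1 * g (z / a%:C).

End SpaceK.

Arguments rhp {R}.
Arguments crhp {R}.
Arguments spaceK {R}.

(* Main.v *)
Require Import Defs.
From mathcomp Require Import all_boot all_order all_algebra complex.
From mathcomp Require Import all_classical all_reals all_analysis.
From mathcomp Require Import measurable_realfun ring lra.

Import Order.TTheory GRing.Theory Num.Theory.
Import numFieldNormedType.Exports.

Local Open Scope classical_set_scope.
Local Open Scope ring_scope.
Local Open Scope complex_scope.

Set Implicit Arguments.
Unset Strict Implicit.
Unset Printing Implicit Defensive.

(** The theorem becomes transparent on the other side of the Laplace transform
    [Lap phi z = int_0^oo phi(x) exp(-zx) dx].  Let S be the space of smooth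
    functions on the open half-line which, together with all their derivatives,
    are O(x^r) for every real r, positive or negative; thus they are flat both
    at 0 and at infinity (formally, [schwartz n phi] for all n).  The space K is exactly the set of transforms of
    functions of S, each f being the transform of a unique function, its inverse
    transform [invLap f x = (2 pi)^-1 int f(it) exp(itx) dt].  Under this
    correspondence
      - A_alpha is the substitution phi(x) |-> phi(x^alpha),
      - D_h is the multiplication phi(x) |-> x^h phi(x),
      - multiplication by z is the derivation d/dx,
      - R_a is the dilation phi(x) |-> phi(ax),
    (lemmas [opA_invLap], [fracD_invLap], [mulz_Lap], [dilR_Lap]).  All of them
    visibly preserve S: powers of x and the substitution of x^alpha only
    reshuffle the exponents r, also when alpha < 0.  What remains are the
    identities (x^alpha)^h = x^(alpha h), (x^alpha)^beta = x^(alpha beta),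
    (a x^(1/alpha))^alpha = a^alpha x and the chain rule for phi(x^(1/alpha)).

    The analysis lies in the correspondence itself.
      - [invLap] maps K to S.  On a vertical line a derivative in z is a
        derivative along the line, so shifting lines of integration (and
        integrating by parts on them) needs nothing but real calculus.  Shifting
        to the right shows [invLap f x = 0] for x <= 0, whence flatness at 0,
        because the derivatives of [invLap f] are [invLap (z^k f)];
        x [invLap f] = - [invLap f'] gives the decay at infinity.
      - [Lap (invLap f) = f] reduces by Fubini to Cauchy's integral formula for
        the half-plane.  The Cauchy kernel differs from the Poisson kernel by a
        function holomorphic in the half-plane, which contributes nothing, and
        the Poisson integral of f((1-l) z + l w), for w on the imaginary axis,
        does not depend on l in [0, 1].
      - [Lap] maps S to K by integration by parts (decay) and a second order
        Taylor estimate of the exponential (holomorphy), and it is injective by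
        the argument of Phragmen and Doetsch ([Lap_inj]).
      - The formula for D_h is, if Re h > -1, Fubini and Euler's integral
        int_0^oo x^h exp(-wx) dx = Gamma(h+1) w^-(h+1).  Integration by parts
        along the imaginary axis relates h to h + 1 and so reaches all other h
        except the negative integers, where [Lap (x^h phi)] is continuous in h. *)

(** * Real integrals and antiderivatives *)
Section RealCalculus.
Variable R : realType.
Local Notation mu := (@lebesgue_measure R).
Local Notation TR := (measurableTypeR R).
Implicit Types (f g : TR -> R) (F : R -> R) (A : set TR).

Definition rmeas A f := measurable_fun A f.

Lemma rmeasP A f : rmeas A f <-> measurable_fun A (EFin \o f).
Proof. by split=> /measurable_EFinP. Qed.

Definition rint A f := mu.-integrable A (EFin \o f).

Lemma rint_dom A f g : measurable A -> rmeas A f -> rint A g ->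
  (forall x, A x -> `|f x| <= g x) -> rint A f.
Proof.
move=> mA mf ig fg.
apply: (@le_integrable _ _ _ mu _ mA (EFin \o f) (EFin \o g)) => //.
  exact/rmeasP.
by move=> x Ax /=; rewrite lee_fin (le_trans (fg x Ax))// ler_norm.
Qed.

Lemma eq_rint A f g : measurable A -> (forall x, A x -> f x = g x) ->
  rint A f -> rint A g.
Proof.
move=> mA fg; apply: eq_integrable => // x /set_mem Ax /=; by rewrite fg.
Qed.

Lemma EFin_Rintegral A f : measurable A -> rint A f ->
  (\int[mu]_(x in A) (f x)%:E = (\int[mu]_(x in A) f x)%:E)%E.
Proof.
move=> mA i; have h := integrable_fin_num mA i.
by rewrite /Rintegral fineK.
Qed.

(** Primitives are evaluated on the segments [a n, b n], and the truncations of a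
    function to them converge pointwise on A, as dominated convergence and
    Fatou's lemma require. *)
Definition exhausts A (a b : nat -> R) :=
  [/\ forall n, a n < b n, forall n, `[a n, b n] `<=` A &
      forall x, A x -> \forall n \near \oo, x \in `[a n, b n]].

Lemma FTC_segment f F (a b : R) : a < b ->
  (forall x, x \in `[a, b] -> is_derive x 1 F (f x)) ->
  (forall x, x \in `[a, b] -> {for x, continuous f}) ->
  rint `[a, b] f /\ \int[mu]_(x in `[a, b]) f x = F b - F a.
Proof.
move=> ab dF cf.
have cw : {within `[a, b], continuous f}.
  by apply: continuous_in_subspaceT => x /set_mem; exact: cf.
have dF1 x : x \in `[a, b] -> derivable F x 1 by move=> /dF [].
have cF x : x \in `[a, b] -> {for x, continuous F}.
  by move=> /dF1 d; apply/differentiable_continuous/derivable1_diffP.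
split.
  by apply: continuous_compact_integrable => //; exact: segment_compact.
rewrite /Rintegral (@continuous_FTC2 _ f F)//.
- split.
  + by move=> x xab; apply: dF1; exact: subset_itv_oo_cc.
  + by apply/cvg_at_right_filter/cF; rewrite in_itv/= lexx ltW.
  + by apply/cvg_at_left_filter/cF; rewrite in_itv/= lexx ltW.
- move=> x /subset_itv_oo_cc/dF d; by rewrite derive1E derive_val.
Qed.

Lemma measurable_continuous_open A f : open A ->
  (forall x, A x -> {for x, continuous f}) -> rmeas A f.
Proof.
move=> oA cf; apply: open_continuous_measurable_fun => // x /set_mem; exact: cf.
Qed.

Lemma dom_cvg A (f_ : nat -> TR -> R) f g : measurable A ->
  (forall n, rmeas A (f_ n)) -> rint A g ->
  (forall n x, A x -> `|f_ n x| <= g x) ->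
  (forall x, A x -> f_ n x @[n --> \oo] --> f x) ->
  rmeas A f /\
  \int[mu]_(x in A) f_ n x @[n --> \oo] --> \int[mu]_(x in A) f x.
Proof.
move=> mA mf ig fg ff.
have mfl : rmeas A f.
  exact: (measurable_fun_cvg mf).
split => //.
have ifn n : rint A (f_ n) by apply: rint_dom ig _ => //; exact: fg.
have [] := @dominated_convergence _ _ _ mu _ mA (fun n => EFin \o f_ n)
  (EFin \o f) (EFin \o g).
- by move=> n; apply/rmeasP.
- exact/rmeasP.
- by apply: nearW => x Ax /=; apply: cvg_EFin; [exact: nearW|exact: ff].
- exact: ig.
- by apply: nearW => x n Ax /=; rewrite lee_fin fg.
move=> iF _ h; apply: fine_cvg.
by rewrite fineK; [exact: h|exact: integrable_fin_num].
Qed.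

Definition clip (a b : nat -> R) f n := f \_ `[a n, b n].

Lemma clip_cvg A (a b : nat -> R) f x : exhausts A a b -> A x ->
  clip a b f n x @[n --> \oo] --> f x.
Proof.
move=> [_ _ ex] Ax; apply: cvg_near_cst; move: (ex x Ax).
by apply: filterS => n xn; rewrite /clip patchE mem_set.
Qed.

Lemma clip_int A (a b : nat -> R) f n : exhausts A a b ->
  \int[mu]_(x in A) clip a b f n x = \int[mu]_(x in `[a n, b n]) f x.
Proof.
move=> [_ sub _]; rewrite -Rintegral_mkcondr; congr Rintegral.
by apply/setIidr; exact: sub.
Qed.

Lemma clip_meas A (a b : nat -> R) f n : measurable A -> rmeas A f ->
  rmeas A (clip a b f n).
Proof.
move=> mA mf; apply/measurable_restrict => //.
by apply: measurable_funS mf => //; exact: subIsetl.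
Qed.

(** The fundamental theorem of calculus on each segment, and dominated convergence
    for the truncations of f to the segments. *)
Lemma integral_exhaust A (a b : nat -> R) f F l : measurable A ->
  exhausts A a b ->
  (forall x, A x -> is_derive x 1 F (f x)) ->
  (forall x, A x -> {for x, continuous f}) ->
  rint A f -> F (b n) - F (a n) @[n --> \oo] --> l ->
  \int[mu]_(x in A) f x = l.
Proof.
move=> mA ex dF cf intf Fl.
have [ab sub _] := ex.
have mf : rmeas A f by apply/rmeasP; exact: measurable_int intf.
have [_ h] := @dom_cvg A (clip a b f) f (fun x => `|f x|) mA
  (fun n => clip_meas a b n mA mf) (integrable_norm intf)
  (fun n x Ax => ltac:(by rewrite /clip patchE; case: ifPn => // _; rewrite normr0))
  (fun x Ax => clip_cvg ex Ax).
apply: cvg_unique h _ => //.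
rewrite (_ : (fun n => _) = (fun n => F (b n) - F (a n)))//.
apply/funext => n; rewrite clip_int//.
by have [_ ->] := @FTC_segment f F _ _ (ab n)
  (fun x xab => dF x (sub n x xab)) (fun x xab => cf x (sub n x xab)).
Qed.

(** By Fatou's lemma for the truncations of f, bounded increments of a primitive
    make a nonnegative function integrable. *)
Lemma rint_exhaust A (a b : nat -> R) f F M : measurable A ->
  exhausts A a b ->
  (forall x, A x -> is_derive x 1 F (f x)) ->
  (forall x, A x -> {for x, continuous f}) ->
  rmeas A f ->
  (forall x, A x -> 0 <= f x) -> (forall n, F (b n) - F (a n) <= M) ->
  rint A f.
Proof.
move=> mA ex dF cf mf f0 FM.
have [ab sub _] := ex.
have c0 n x : A x -> 0 <= clip a b f n x.
  by move=> Ax; rewrite /clip patchE; case: ifPn => // _; exact: f0.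
apply/integrableP; split; first exact/rmeasP.
apply: (@le_lt_trans _ _ M%:E); last exact: ltry.
under eq_integral => x /set_mem Ax do rewrite /= ger0_norm ?f0//.
have := @fatou _ _ _ mu _ mA (fun n => EFin \o clip a b f n)
  (fun n => (rmeasP A (clip a b f n)).1 (clip_meas a b n mA mf))
  (fun n x Ax => ltac:(by rewrite /= lee_fin c0)).
have -> : (\int[mu]_(x in A) limn_einf ((fun n => EFin \o clip a b f n)^~ x)
    = \int[mu]_(x in A) (f x)%:E)%E.
  apply: eq_integral => x /set_mem Ax.
  have h : (EFin \o clip a b f n) x @[n --> \oo] --> (f x)%:E.
    by apply: cvg_EFin; [exact: nearW|exact: (clip_cvg ex Ax)].
  by have [-> _] := cvg_limn_einf_sup h.
move/le_trans; apply.
rewrite limn_einf_lim; apply: lime_le; first exact: is_cvg_einfs.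
apply: nearW => n.
apply: (@le_trans _ _ (\int[mu]_(x in A) (EFin \o clip a b f n) x)%E).
  by apply: ereal_inf_lbound; exists n => /=.
have [iab Fab] := @FTC_segment f F _ _ (ab n) (fun x xab => dF x (sub n x xab))
  (fun x xab => cf x (sub n x xab)).
have -> : (\int[mu]_(x in A) (EFin \o clip a b f n) x =
    \int[mu]_(x in `[a n, b n]) (f x)%:E)%E.
  transitivity (\int[mu]_(x in A) ((EFin \o f) \_ `[a n, b n]) x)%E.
    by apply: eq_integral => x _; rewrite /= /clip !patchE; case: ifP.
  rewrite -integral_mkcondr.
  by rewrite (setIidr (@sub n)).
have -> : (\int[mu]_(x in `[a n, b n]) (f x)%:E =
    (\int[mu]_(x in `[a n, b n]) f x)%:E)%E.
  exact: EFin_Rintegral.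
rewrite lee_fin. rewrite Fab. exact: FM.
Qed.

Lemma diff_under A (f df : R -> TR -> R) g (a u v : R) :
  measurable A -> a \in `]u, v[ ->
  (forall x, x \in `]u, v[ -> rint A (f x)) ->
  (forall x y, x \in `]u, v[ -> A y -> is_derive x 1 (f ^~ y) (df x y)) ->
  rint A g ->
  (forall x y, x \in `]u, v[ -> A y -> `|df x y| <= g y) ->
  is_derive a 1 (fun x => \int[mu]_(y in A) f x y) (\int[mu]_(y in A) df a y).
Proof.
move=> mA Ia intf dff ig dfg.
have d1E x y : x \in `]u, v[ -> A y -> partial1of2 f x y = df x y.
  by move=> Ix Ay; have d := dff x y Ix Ay; rewrite partial1of2E derive_val.
have H1 : forall x y, `]u, v[%classic x -> A y -> derivable (f ^~ y) x 1.
  by move=> x y Ix Ay; have [] := dff x y Ix Ay.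
have H2 : forall x y, `]u, v[%classic x -> A y ->
    `|partial1of2 f x y| <= `|g y|.
  move=> x y Ix Ay; rewrite d1E//.
  exact: le_trans (dfg x y Ix Ay) (ler_norm _).
have ig' : rint A (fun y => `|g y|) by exact: integrable_norm ig.
have H3 y : 0 <= `|g y| by [].
apply: DeriveDef.
  exact: (@derivable_under_integral R _ _ mu f A mA a u v Ia intf H1 _ H3 ig' H2).
rewrite -derive1E.
rewrite (@differentiation_under_integral R _ _ mu f A mA a u v Ia intf H1 _ H3 ig' H2).
by apply: eq_Rintegral => y /set_mem Ay; exact: d1E.
Qed.

Lemma deriv0_cst F (u v : R) : (forall x, x \in `]u, v[ -> is_derive x 1 F 0) ->
  forall x y, x \in `]u, v[ -> y \in `]u, v[ -> F x = F y.
Proof.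
move=> dF.
suff H x y : x <= y -> x \in `]u, v[ -> y \in `]u, v[ -> F x = F y.
  by move=> x y Ix Iy; case: (leP x y) => [/H|/ltW/H] -> .
move=> xy Ix Iy.
have sub z : z \in `[x, y] -> z \in `]u, v[.
  move: Ix Iy; rewrite !in_itv/= => /andP[ux xv] /andP[uy yv] /andP[xz zy].
  by rewrite (lt_le_trans ux)//= (le_lt_trans zy).
have dF' z : z \in `]x, y[ -> is_derive z 1 F 0.
  by move=> /subset_itv_oo_cc/sub; exact: dF.
have cF : {within `[x, y], continuous F}.
  by apply: derivable_within_continuous => z /sub Iz; have [] := dF z Iz.
have [c _ Fc] := @MVT_segment R F (fun=> 0) x y xy dF' cF.
by apply/esym/eqP; rewrite -subr_eq0 Fc mul0r.
Qed.

Lemma MVT_bound (F dF : R -> R) (x y M : R) : x <= y ->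
  (forall z, z \in `[x, y] -> is_derive z 1 F (dF z)) ->
  (forall z, z \in `[x, y] -> `|dF z| <= M) -> `|F y - F x| <= M * (y - x).
Proof.
move=> xy dFF dFM.
have dF' z : z \in `]x, y[ -> is_derive z 1 F (dF z).
  by move=> /subset_itv_oo_cc; exact: dFF.
have cF : {within `[x, y], continuous F}.
  by apply: derivable_within_continuous => z Iz; have [] := dFF z Iz.
have [c cxy ->] := @MVT_segment R F dF x y xy dF' cF.
by rewrite normrM [X in _ * X]ger0_norm ?subr_ge0// ler_wpM2r ?subr_ge0// dFM.
Qed.
End RealCalculus.

(** * Complex numbers and curves *)
Section ComplexNumbers.
Variable R : realType.
Local Notation CR := (R[i]^o).
Implicit Types (z w : CR) (x : R).
Local Notation Re := (@complex.Re R).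
Local Notation Im := (@complex.Im R).

(** The norm of R[i] takes its values in R[i]; this real-valued version combines
    with real inequalities. *)
Definition nrm z : R := ComplexField.Normc.normc z.

Lemma nrmE z : `|z| = (nrm z)%:C. Proof. by case: z. Qed.
Lemma nrm0 : nrm 0 = 0. Proof. exact: ComplexField.Normc.normc0. Qed.
Lemma nrmM z w : nrm (z * w) = nrm z * nrm w.
Proof. exact: ComplexField.Normc.normcM. Qed.
Lemma nrmV z : nrm z^-1 = (nrm z)^-1.
Proof. exact: ComplexField.Normc.normcV. Qed.
Lemma nrmD z w : nrm (z + w) <= nrm z + nrm w.
Proof. exact: le_normcD. Qed.
Lemma nrmN z : nrm (- z) = nrm z. Proof. exact: normcN. Qed.
Lemma nrmB z w : nrm (z - w) <= nrm z + nrm w.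
Proof. by rewrite -(nrmN w) nrmD. Qed.
Lemma nrmC z w : nrm (z - w) = nrm (w - z).
Proof. by rewrite -nrmN opprB. Qed.
Lemma nrm_ge0 z : 0 <= nrm z. Proof. by case: z => a b; exact: sqrtr_ge0. Qed.
Lemma nrm_Re z : `|Re z| <= nrm z.
Proof.
by case: z => a b; rewrite /nrm/= -sqrtr_sqr ler_wsqrtr// lerDl sqr_ge0.
Qed.
Lemma nrm_Im z : `|Im z| <= nrm z.
Proof.
by case: z => a b; rewrite /nrm/= -sqrtr_sqr ler_wsqrtr// lerDr sqr_ge0.
Qed.
Lemma nrm_real x : nrm x%:C = `|x|.
Proof. by rewrite /nrm/= expr0n addr0 sqrtr_sqr. Qed.
Lemma nrm_im x : nrm (0 +i* x) = `|x|.
Proof. by rewrite /nrm/= expr0n add0r sqrtr_sqr. Qed.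
Lemma nrm_i : nrm 'i = 1. Proof. by rewrite nrm_im normr1. Qed.
Lemma complexRI z : z = (Re z)%:C + 'i * (Im z)%:C.
Proof. exact: complexE. Qed.
Lemma nrm_le z : nrm z <= `|Re z| + `|Im z|.
Proof.
rewrite {1}(complexRI z) (le_trans (nrmD _ _))// nrmM nrm_i mul1r.
by rewrite !nrm_real.
Qed.
Lemma nrm_eq0 z : (nrm z == 0) = (z == 0).
Proof.
apply/eqP/eqP => [|->]; last exact: nrm0.
exact: ComplexField.Normc.eq0_normc.
Qed.
Lemma nrm_gt0 z : (0 < nrm z) = (z != 0).
Proof. by rewrite lt_def nrm_ge0 andbT nrm_eq0. Qed.
Lemma nrm_Re_gt0 z : 0 < Re z -> z != 0.
Proof. by apply: contraTneq => ->; rewrite ltxx. Qed.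
Lemma nrm_dist z w : `|nrm z - nrm w| <= nrm (z - w).
Proof.
have h a b : nrm a - nrm b <= nrm (a - b).
  by rewrite lerBlDr -{1}(subrK b a) nrmD.
by rewrite ler_norml lerNl opprB h nrmC h.
Qed.

Lemma ReD z w : Re (z + w) = Re z + Re w. Proof. by case: z; case: w. Qed.
Lemma ImD z w : Im (z + w) = Im z + Im w. Proof. by case: z; case: w. Qed.
Lemma ReN z : Re (- z) = - Re z. Proof. by case: z. Qed.
Lemma ImN z : Im (- z) = - Im z. Proof. by case: z. Qed.
Lemma ReM z w : Re (z * w) = Re z * Re w - Im z * Im w.
Proof. by case: z; case: w. Qed.
Lemma ImM z w : Im (z * w) = Re z * Im w + Im z * Re w.
Proof. by case: z; case: w. Qed.
Lemma ReZ x z : Re (x%:C * z) = x * Re z.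
Proof. by rewrite ReM/= mul0r subr0. Qed.
Lemma ImZ x z : Im (x%:C * z) = x * Im z.
Proof. by rewrite ImM/= mul0r addr0. Qed.
Lemma ReMi z : Re ('i * z) = - Im z.
Proof. by rewrite ReM/= mul0r mul1r sub0r. Qed.
Lemma ImMi z : Im ('i * z) = Re z.
Proof. by rewrite ImM/= mul0r mul1r add0r. Qed.
Lemma complex_ext z w : Re z = Re w -> Im z = Im w -> z = w.
Proof. by case: z => a b; case: w => c d /= -> ->. Qed.
Lemma sqr_iN : 'i * 'i = -1 :> CR.
Proof. by apply: complex_ext; rewrite /=; ring. Qed.
Lemma stari x : x *i = 'i * x%:C :> CR.
Proof. by apply: complex_ext; rewrite /=; ring. Qed.
Lemma cvg_nrmP {T : Type} (F : set_system T) {FF : Filter F} (f : T -> CR) (l : CR) :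
  f @ F --> l <-> forall e : R, 0 < e -> \forall x \near F, nrm (l - f x) < e.
Proof.
split=> [/cvgrPdist_lt h e e0|h].
  have e0' : 0 < e%:C :> CR by rewrite ltcR.
  by have := h _ e0'; apply: filterS => x; rewrite nrmE ltcR.
apply/cvgrPdist_lt => -[a b]; rewrite ltcE/= => /andP[/eqP-> a0].
by have := h _ a0; apply: filterS => x; rewrite nrmE ltcR.
Qed.

Lemma cvg_complexP {T : Type} (F : set_system T) {FF : Filter F} (f : T -> CR) (l : CR) :
  f @ F --> l <->
  (Re (f x) @[x --> F] --> Re l) /\ (Im (f x) @[x --> F] --> Im l).
Proof.
split=> [/cvg_nrmP h|[/cvgrPdist_lt h1 /cvgrPdist_lt h2]].
  split; apply/cvgrPdist_lt => e /h; apply: filterS => x; apply: le_lt_trans.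
    by rewrite -ReN -ReD nrm_Re.
  by rewrite -ImN -ImD nrm_Im.
apply/cvg_nrmP => e e0; have e20 : 0 < e / 2 by rewrite divr_gt0.
apply: filterS2 (h1 _ e20) (h2 _ e20) => x a b.
rewrite (le_lt_trans (nrm_le _))// ReD ReN ImD ImN (splitr e).
exact: ltrD.
Qed.

Lemma cvg_nrm {T : Type} (F : set_system T) {FF : Filter F} (f : T -> CR) (l : CR) :
  f @ F --> l -> nrm (f x) @[x --> F] --> nrm l.
Proof.
move=> /cvg_nrmP h; apply/cvgrPdist_lt => e /h; apply: filterS => x.
by apply: le_lt_trans; exact: nrm_dist.
Qed.
End ComplexNumbers.
Arguments nrm {R} z : simpl never.

Section ComplexDerivative.
Variable R : realType.
Local Notation CR := (R[i]^o).
Local Notation Re := (@complex.Re R).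
Local Notation Im := (@complex.Im R).
Implicit Types (u v : R -> CR) (x y : R) (a b c : CR).

(** Derivatives of curves are taken componentwise, so that every statement about
    them reduces to two statements of real calculus. *)
Definition is_cderive u x a :=
  is_derive x 1 (fun y => Re (u y)) (Re a) /\
  is_derive x 1 (fun y => Im (u y)) (Im a).

Lemma is_cderive_eq u x a b : is_cderive u x a -> a = b -> is_cderive u x b.
Proof. by move=> + <-. Qed.

Lemma is_cderive_near u v x a : (\near x, u x = v x) ->
  is_cderive u x a -> is_cderive v x a.
Proof.
move=> uv [h1 h2]; split.
  by apply: near_eq_is_derive h1; move: uv; apply: filterS => y ->.
by apply: near_eq_is_derive h2; move: uv; apply: filterS => y ->.
Qed.

Lemma is_cderive_cst a x : is_cderive (fun=> a) x 0.
Proof. by split; exact: is_derive_cst. Qed.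

Lemma is_cderive_real (f : R -> R) x d :
  is_derive x 1 f d -> is_cderive (fun y => (f y)%:C) x d%:C.
Proof. by move=> df; split => //=; exact: is_derive_cst. Qed.

Lemma is_cderive_id x : is_cderive (fun y => y%:C) x 1.
Proof. by apply: (@is_cderive_real id); exact: is_derive_id. Qed.

Lemma is_cderiveD u v x a b : is_cderive u x a -> is_cderive v x b ->
  is_cderive (fun y => u y + v y) x (a + b).
Proof.
move=> [u1 u2] [v1 v2]; split.
  rewrite (_ : (fun _ => _) = (fun y => Re (u y)) + (fun y => Re (v y))).
    by rewrite ReD; exact: is_deriveD.
  by apply/funext => y; rewrite ReD.
rewrite (_ : (fun _ => _) = (fun y => Im (u y)) + (fun y => Im (v y))).
  by rewrite ImD; exact: is_deriveD.
by apply/funext => y; rewrite ImD.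
Qed.

Lemma is_cderiveN u x a : is_cderive u x a -> is_cderive (fun y => - u y) x (- a).
Proof.
move=> [u1 u2]; split.
  rewrite (_ : (fun _ => _) = - (fun y => Re (u y))).
    by rewrite ReN; exact: is_deriveN.
  by apply/funext => y; rewrite ReN.
rewrite (_ : (fun _ => _) = - (fun y => Im (u y))).
  by rewrite ImN; exact: is_deriveN.
by apply/funext => y; rewrite ImN.
Qed.

Lemma is_cderiveB u v x a b : is_cderive u x a -> is_cderive v x b ->
  is_cderive (fun y => u y - v y) x (a - b).
Proof. by move=> du dv; apply: is_cderiveD => //; exact: is_cderiveN. Qed.

Lemma is_cderiveM u v x a b : is_cderive u x a -> is_cderive v x b ->
  is_cderive (fun y => u y * v y) x (a * v x + u x * b).
Proof.
move=> [u1 u2] [v1 v2]; split.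
  rewrite (_ : (fun _ => _) = (fun y => Re (u y)) * (fun y => Re (v y)) -
      (fun y => Im (u y)) * (fun y => Im (v y))); last first.
    by apply/funext => y; rewrite ReM.
  apply: is_derive_eq (is_deriveB (is_deriveM u1 v1) (is_deriveM u2 v2)) _.
  by rewrite ReD !ReM /GRing.scale/=; ring.
rewrite (_ : (fun _ => _) = (fun y => Re (u y)) * (fun y => Im (v y)) +
      (fun y => Im (u y)) * (fun y => Re (v y))); last first.
  by apply/funext => y; rewrite ImM.
apply: is_derive_eq (is_deriveD (is_deriveM u1 v2) (is_deriveM u2 v1)) _.
by rewrite ImD !ImM /GRing.scale/=; ring.
Qed.

Lemma is_cderiveZ c u x a : is_cderive u x a ->
  is_cderive (fun y => c * u y) x (c * a).
Proof.
move=> du; apply: is_cderive_eq (is_cderiveM (is_cderive_cst c x) du) _.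
by rewrite mul0r add0r.
Qed.

Lemma is_cderive_continuous u x a : is_cderive u x a -> {for x, continuous u}.
Proof.
move=> [[d1 _] [d2 _]]; apply/cvg_complexP; split.
  exact: differentiable_continuous (iffLR (derivable1_diffP _ _) d1).
exact: differentiable_continuous (iffLR (derivable1_diffP _ _) d2).
Qed.

Lemma is_cderive_comp u (f : R -> R) x a d :
  is_derive x 1 f d -> is_cderive u (f x) a ->
  is_cderive (fun y => u (f y)) x (d%:C * a).
Proof.
move=> df [u1 u2]; split.
  rewrite ReZ mulrC.
  by have := @is_derive1_comp R (fun y => Re (u y)) f x (Re a) d u1 df.
rewrite ImZ mulrC.
by have := @is_derive1_comp R (fun y => Im (u y)) f x (Im a) d u2 df.
Qed.

End ComplexDerivative.

(** * Exponential, logarithm and powers *)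
Section ElementaryFunctions.
Variable R : realType.
Local Notation CR := (R[i]^o).
Local Notation Re := (@complex.Re R).
Local Notation Im := (@complex.Im R).
Implicit Types (u v : R -> CR) (x y : R) (a b c z w s : CR).

Lemma Re_cexp w : Re (cexp w) = expR (Re w) * cos (Im w).
Proof. by rewrite /cexp ReZ. Qed.

Lemma Im_cexp w : Im (cexp w) = expR (Re w) * sin (Im w).
Proof. by rewrite /cexp ImZ. Qed.

Lemma cexpD z w : cexp (z + w) = cexp z * cexp w.
Proof.
apply: complex_ext.
  by rewrite ReM !Re_cexp !Im_cexp ReD ImD expRD cosD; ring.
by rewrite ImM !Re_cexp !Im_cexp ReD ImD expRD sinD; ring.
Qed.

Lemma cexp_real x : cexp (x%:C : CR) = (expR x)%:C.
Proof.
by apply: complex_ext; rewrite ?Re_cexp ?Im_cexp/= ?cos0 ?sin0 ?mulr1 ?mulr0.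
Qed.

Lemma cexp0 : cexp (0 : CR) = 1.
Proof. by rewrite (cexp_real 0) expR0. Qed.

Lemma nrm_cexp w : nrm (cexp w) = expR (Re w).
Proof.
rewrite /cexp nrmM nrm_real ger0_norm ?expR_ge0//.
by rewrite /nrm/= cos2Dsin2 sqrtr1 mulr1.
Qed.

Lemma cexp_neq0 w : cexp w != 0.
Proof. by rewrite -nrm_eq0 nrm_cexp gt_eqF// expR_gt0. Qed.

Lemma cexpN w : cexp (- w) = (cexp w)^-1.
Proof.
apply: (mulfI (cexp_neq0 w)).
by rewrite -cexpD subrr cexp0 mulfV// cexp_neq0.
Qed.

Lemma is_cderive_cexp u x a : is_cderive u x a ->
  is_cderive (fun y => cexp (u y)) x (a * cexp (u x)).
Proof.
move=> [u1 u2].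
have e1 := is_derive1_comp (is_derive_expR (Re (u x))) u1.
have c1 := is_derive1_comp (is_derive_cos (Im (u x))) u2.
have s1 := is_derive1_comp (is_derive_sin (Im (u x))) u2.
split.
  rewrite (_ : (fun _ => _) = (expR \o (fun y => Re (u y))) *
      (cos \o (fun y => Im (u y)))).
    apply: is_derive_eq (is_deriveM e1 c1) _.
    by rewrite ReM Re_cexp Im_cexp /GRing.scale/=; ring.
  by apply/funext => y; rewrite Re_cexp.
rewrite (_ : (fun _ => _) = (expR \o (fun y => Re (u y))) *
    (sin \o (fun y => Im (u y)))).
  apply: is_derive_eq (is_deriveM e1 s1) _.
  by rewrite ImM Re_cexp Im_cexp /GRing.scale/=; ring.
by apply/funext => y; rewrite Im_cexp.
Qed.

Lemma sqr_gt0C z : z != 0 -> 0 < Re z ^+ 2 + Im z ^+ 2.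
Proof.
move=> z0; rewrite lt_def addr_ge0 ?sqr_ge0// andbT.
rewrite paddr_eq0 ?sqr_ge0// !sqrf_eq0.
by apply: contra z0 => /andP[/eqP r0 /eqP i0]; apply/eqP/complex_ext.
Qed.

Lemma is_derive_sqrnorm u x a : is_cderive u x a ->
  is_derive x 1 (fun y => Re (u y) ^+ 2 + Im (u y) ^+ 2)
    (2 * (Re (u x) * Re a + Im (u x) * Im a)).
Proof.
move=> [u1 u2].
rewrite (_ : (fun _ => _) = (fun y => Re (u y)) * (fun y => Re (u y)) +
  (fun y => Im (u y)) * (fun y => Im (u y))); last first.
  by apply/funext => y; rewrite !expr2.
apply: is_derive_eq (is_deriveD (is_deriveM u1 u1) (is_deriveM u2 u2)) _.
by rewrite /GRing.scale/=; ring.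
Qed.

Lemma ReV z : Re z^-1 = Re z / (Re z ^+ 2 + Im z ^+ 2).
Proof. by case: z. Qed.

Lemma ImV z : Im z^-1 = - (Im z / (Re z ^+ 2 + Im z ^+ 2)).
Proof. by case: z. Qed.

Lemma is_cderiveV u x a : is_cderive u x a -> u x != 0 ->
  is_cderive (fun y => (u y)^-1) x (- (a / u x ^+ 2)).
Proof.
move=> du u0; have [u1 u2] := du; have N0 := sqr_gt0C u0.
pose N y := Re (u y) ^+ 2 + Im (u y) ^+ 2.
have N' : is_derive x 1 N _ := is_derive_sqrnorm du.
have V' := @is_deriveV R N x _ _ (lt0r_neq0 N0) N'.
have E : - (a / u x ^+ 2) = - (a * ((u x)^-1 * (u x)^-1)).
  by rewrite expr2 invfM.
split.
  rewrite (_ : (fun _ => _) = (fun y => Re (u y)) *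
     (fun y => (Re (u y) ^+ 2 + Im (u y) ^+ 2)^-1)).
    apply: is_derive_eq (is_deriveM u1 V') _.
    rewrite E ReN !ReM ImM ReV ImV /GRing.scale/= ?/N.
    by field; rewrite gt_eqF.
  by apply/funext => y; rewrite ReV.
rewrite (_ : (fun _ => _) = - ((fun y => Im (u y)) *
   (fun y => (Re (u y) ^+ 2 + Im (u y) ^+ 2)^-1))).
  apply: is_derive_eq (is_deriveN (is_deriveM u2 V')) _.
  rewrite E ImN !ImM ReM ReV ImV /GRing.scale/= ?/N.
  by field; rewrite gt_eqF.
by apply/funext => y; rewrite ImV.
Qed.

Lemma Re_clog z : Re (clog z) = ln (nrm z).
Proof. by rewrite /clog nrmE. Qed.

Lemma clog_real x : 0 < x -> clog (x%:C : CR) = (ln x)%:C.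
Proof.
move=> x0; apply: complex_ext; last by rewrite /= mul0r atan0.
by rewrite Re_clog nrm_real gtr0_norm.
Qed.

Lemma cexp_clog z : 0 < Re z -> cexp (clog z) = z.
Proof.
move=> x0; have z0 : z != 0 by exact: nrm_Re_gt0.
have n0 : 0 < nrm z by rewrite nrm_gt0.
have E : Num.sqrt (1 + (Im z / Re z) ^+ 2) = nrm z / Re z.
  rewrite -[RHS]ger0_norm ?divr_ge0// ?nrm_ge0 ?ltW// -sqrtr_sqr; congr Num.sqrt.
  rewrite [in RHS]exprMn {1}/nrm; case: z x0 {z0 n0} => p q /= p0.
  by rewrite sqr_sqrtr ?addr_ge0 ?sqr_ge0//; field; rewrite gt_eqF.
have c : cos (atan (Im z / Re z)) = Re z / nrm z.
  by rewrite cos_atan E invf_div.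
apply: complex_ext.
  rewrite Re_cexp Re_clog lnK ?posrE// c mulrCA mulfV ?mulr1//.
  by rewrite gt_eqF.
rewrite Im_cexp Re_clog lnK ?posrE//.
have -> : sin (atan (Im z / Re z)) = Im z / nrm z.
  have := atanK (Im z / Re z); rewrite /tan c => h.
  have c0 : Re z / nrm z != 0 by rewrite gt_eqF// divr_gt0.
  rewrite -[LHS](divfK c0) h; field.
  by rewrite !gt_eqF.
by rewrite mulrCA mulfV ?mulr1// gt_eqF.
Qed.

(** In the right half-plane the argument is atan (Im / Re), so that both
    components of the logarithm are differentiated by the real chain rule. *)
Lemma is_cderive_clog u x a : is_cderive u x a -> 0 < Re (u x) ->
  is_cderive (fun y => clog (u y)) x (a / u x).
Proof.
move=> du r0; have u0 : u x != 0 by exact: nrm_Re_gt0.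
have [u1 u2] := du; have N0 := sqr_gt0C u0.
pose N y := Re (u y) ^+ 2 + Im (u y) ^+ 2.
have N' : is_derive x 1 N _ := is_derive_sqrnorm du.
have s' := @is_derive1_comp R Num.sqrt N x _ _ (is_derive1_sqrt N0) N'.
have n0 : 0 < Num.sqrt (Re (u x) ^+ 2 + Im (u x) ^+ 2) by rewrite sqrtr_gt0.
have l' := @is_derive1_comp R (@ln R) (Num.sqrt \o N) x _ _ (is_derive1_ln n0) s'.
have V' := @is_deriveV R (fun y => Re (u y)) x _ _ (lt0r_neq0 r0) u1.
have q' := is_deriveM u2 V'.
have t' := @is_derive1_comp R (@atan R) _ x _ _ (is_derive1_atan _) q'.
split.
  rewrite (_ : (fun _ => _) = @ln R \o (Num.sqrt \o
    (fun y => Re (u y) ^+ 2 + Im (u y) ^+ 2))); last first.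
    by apply/funext => y; rewrite Re_clog /nrm /=; case: (u y).
  apply: is_derive_eq l' _ => /=.
  have q2 := sqr_sqrtr (ltW N0); move: n0 q2.
  set q := Num.sqrt _ => n0 q2.
  transitivity ((Re (u x) * Re a + Im (u x) * Im a) / q ^+ 2).
    by field; rewrite lt0r_neq0.
  by rewrite q2 ReM ReV ImV; field; rewrite lt0r_neq0.
rewrite (_ : (fun _ => _) = @atan R \o
    ((fun y => Im (u y)) * (fun y => (Re (u y))^-1))) //.
apply: is_derive_eq t' _ => /=.
rewrite ImM ReV ImV /GRing.scale/= ?/N.
have -> : ((fun y => Im (u y)) * (fun y => (Re (u y))^-1)) x = Im (u x) / Re (u x).
  by [].
have N1 : 1 + (Im (u x) / Re (u x)) ^+ 2 != 0.
  by rewrite lt0r_neq0// ltr_pwDl// sqr_ge0.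
field.
apply/andP; split; [exact: lt0r_neq0 N0 | exact: lt0r_neq0 r0].
Qed.

Lemma is_cderive_cpow u x a s : is_cderive u x a -> 0 < Re (u x) ->
  is_cderive (fun y => cpow (u y) s) x (s * (a / u x) * cpow (u x) s).
Proof.
move=> du r0; apply: (is_cderive_cexp (u := fun y => s * clog (u y))).
exact/is_cderiveZ/is_cderive_clog.
Qed.

Lemma cpowD z s t : cpow z (s + t) = cpow z s * cpow z t.
Proof. by rewrite /cpow mulrDl cexpD. Qed.

Lemma cpow1 z : 0 < Re z -> cpow z 1 = z.
Proof. by move=> z0; rewrite /cpow mul1r cexp_clog. Qed.

Lemma cpow0 z : cpow z 0 = 1.
Proof. by rewrite /cpow mul0r cexp0. Qed.

Lemma cpow_neq0 z s : cpow z s != 0.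
Proof. exact: cexp_neq0. Qed.

Lemma nrm_cpow_real x s : 0 < x -> nrm (cpow x%:C s) = x `^ Re s.
Proof.
move=> x0; rewrite nrm_cexp clog_real// mulrC ReZ /powR gt_eqF//.
by rewrite mulrC.
Qed.

Lemma cpow_real x (r : R) : 0 < x -> cpow (x%:C : CR) r%:C = (x `^ r)%:C.
Proof.
by move=> x0; rewrite /cpow clog_real// -rmorphM cexp_real /powR gt_eqF.
Qed.

Lemma is_cderive_cpow_real x s : 0 < x ->
  is_cderive (fun y => cpow y%:C s) x (s * cpow x%:C (s - 1)).
Proof.
move=> x0; apply: is_cderive_eq (is_cderive_cpow s (is_cderive_id x) _) _ => //.
have x0' : 0 < Re (x%:C : CR) by [].
have E : cpow x%:C s = cpow x%:C (s - 1) * x%:C.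
  by rewrite -[in LHS](subrK 1 s) (cpowD _ (s - 1) 1) (cpow1 x0').
have xn0 : (x%:C : CR) != 0 by exact: nrm_Re_gt0.
rewrite E mul1r -(mulrA s); congr (s * _).
by rewrite mulrCA mulVf ?mulr1.
Qed.
End ElementaryFunctions.

(** * Integrals of complex functions *)
Section ComplexIntegral.
Variable R : realType.
Local Notation mu := (@lebesgue_measure R).
Local Notation TR := (measurableTypeR R).
Local Notation CR := (R[i]^o).
Local Notation Re := (@complex.Re R).
Local Notation Im := (@complex.Im R).
Implicit Types (A : set TR) (f g : TR -> CR) (p q : TR -> R) (a b c : CR).

Definition cint A f := rint A (fun x => Re (f x)) /\ rint A (fun x => Im (f x)).
Definition cmeas A f := rmeas A (fun x => Re (f x)) /\ rmeas A (fun x => Im (f x)).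

Lemma rint_meas A p : rint A p -> rmeas A p.
Proof. by move=> i; apply/rmeasP; exact: measurable_int i. Qed.

Lemma rintD A p q : measurable A -> rint A p -> rint A q ->
  rint A (fun x => p x + q x).
Proof.
move=> mA ip iq; have := integrableD mA ip iq; apply: eq_integrable => //.
Qed.

Lemma rintZ A p (k : R) : measurable A -> rint A p -> rint A (fun x => k * p x).
Proof.
move=> mA ip; have := integrableZl mA k ip; apply: eq_integrable => //.
Qed.

Lemma rintB A p q : measurable A -> rint A p -> rint A q ->
  rint A (fun x => p x - q x).
Proof.
move=> mA ip iq; have := integrableB mA ip iq; apply: eq_integrable => //.
Qed.

Lemma rint_norm A p : rint A p -> rint A (fun x => `|p x|).
Proof. exact: integrable_norm. Qed.

Lemma rmeasD A p q : rmeas A p -> rmeas A q -> rmeas A (fun x => p x + q x).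
Proof. exact: measurable_funD. Qed.
Lemma rmeasB A p q : rmeas A p -> rmeas A q -> rmeas A (fun x => p x - q x).
Proof. exact: measurable_funB. Qed.
Lemma rmeasM A p q : rmeas A p -> rmeas A q -> rmeas A (fun x => p x * q x).
Proof. exact: measurable_funM. Qed.
Lemma rmeas_cst A (k : R) : rmeas A (fun=> k).
Proof. exact: measurable_cst. Qed.
Lemma rmeas_comp A p (q : R -> R) : continuous q -> rmeas A p ->
  rmeas A (fun x => q (p x)).
Proof.
move=> cq mp; apply: (@measurableT_comp _ _ _ _ _ _ q) => //.
exact: continuous_measurable_fun.
Qed.

Lemma cmeas_cst A a : cmeas A (fun=> a).
Proof. by split; exact: rmeas_cst. Qed.

Lemma cmeas_real A p : rmeas A p -> cmeas A (fun x => (p x)%:C).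
Proof. by move=> mp; split => //=; exact: rmeas_cst. Qed.

Lemma cmeasM A f g : cmeas A f -> cmeas A g -> cmeas A (fun x => f x * g x).
Proof.
move=> [f1 f2] [g1 g2]; split.
  by under eq_fun do rewrite ReM; apply: rmeasB; apply: rmeasM.
by under eq_fun do rewrite ImM; apply: rmeasD; apply: rmeasM.
Qed.

Lemma cmeas_cexp A f : cmeas A f -> cmeas A (fun x => cexp (f x)).
Proof.
move=> [f1 f2]; split.
  under eq_fun do rewrite Re_cexp; apply: rmeasM; apply: rmeas_comp => //.
    exact: continuous_expR.
  exact: continuous_cos.
under eq_fun do rewrite Im_cexp; apply: rmeasM; apply: rmeas_comp => //.
  exact: continuous_expR.
exact: continuous_sin.
Qed.

Lemma cmeas_continuous A f : open A ->
  (forall x, A x -> {for x, continuous f}) -> cmeas A f.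
Proof.
move=> oA cf; split; apply: measurable_continuous_open => // x /cf.
  by move/cvg_complexP => [].
by move/cvg_complexP => [].
Qed.

Lemma rmeas_nrm A f : cmeas A f -> rmeas A (fun x => nrm (f x)).
Proof.
move=> [f1 f2].
rewrite (_ : (fun _ => _) =
  (fun x => Num.sqrt (Re (f x) * Re (f x) + Im (f x) * Im (f x)))).
  apply: rmeas_comp; first exact: sqrt_continuous.
  by apply: rmeasD; apply: rmeasM.
by apply/funext => x; rewrite /nrm; case: (f x) => u v /=; rewrite !expr2.
Qed.

Lemma cint_meas A f : cint A f -> cmeas A f.
Proof. by move=> [/rint_meas f1 /rint_meas f2]. Qed.

Lemma cint_dom A f p : measurable A -> cmeas A f -> rint A p ->
  (forall x, A x -> nrm (f x) <= p x) -> cint A f.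
Proof.
move=> mA [f1 f2] ip fp; split.
  by apply: rint_dom ip _ => // x Ax; exact: le_trans (nrm_Re _) (fp x Ax).
by apply: rint_dom ip _ => // x Ax; exact: le_trans (nrm_Im _) (fp x Ax).
Qed.

Lemma cint_nrm A f : measurable A -> cint A f -> rint A (fun x => nrm (f x)).
Proof.
move=> mA fi; have [f1 f2] := fi.
apply: (rint_dom mA _ (rintD mA (rint_norm f1) (rint_norm f2))).
  by apply: rmeas_nrm; exact: cint_meas.
by move=> x Ax; rewrite ger0_norm ?nrm_ge0// nrm_le.
Qed.

Lemma eq_cint A f g : measurable A -> (forall x, A x -> f x = g x) ->
  cint A f -> cint A g.
Proof.
move=> mA fg [f1 f2]; split.
  by apply: (@eq_rint R A (fun x => Re (f x))) => // x Ax; rewrite fg.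
by apply: (@eq_rint R A (fun x => Im (f x))) => // x Ax; rewrite fg.
Qed.

Lemma eq_cintegral A f g : (forall x, A x -> f x = g x) ->
  cintegral A f = cintegral A g.
Proof.
move=> fg; rewrite /cintegral; congr (_ +i* _).
  by apply: eq_Rintegral => x /set_mem/fg ->.
by apply: eq_Rintegral => x /set_mem/fg ->.
Qed.

Lemma cintD A f g : measurable A -> cint A f -> cint A g ->
  cint A (fun x => f x + g x).
Proof.
move=> mA [f1 f2] [g1 g2]; split.
  by under eq_fun do rewrite ReD; exact: rintD.
by under eq_fun do rewrite ImD; exact: rintD.
Qed.

Lemma cintZ A c f : measurable A -> cint A f -> cint A (fun x => c * f x).
Proof.
move=> mA [f1 f2]; split.
  by under eq_fun do rewrite ReM; apply: rintB => //; exact: rintZ.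
by under eq_fun do rewrite ImM; apply: rintD => //; exact: rintZ.
Qed.

Lemma cintB A f g : measurable A -> cint A f -> cint A g ->
  cint A (fun x => f x - g x).
Proof.
move=> mA fi gi; apply: eq_cint (cintD mA fi (cintZ (-1) mA gi)) => // x _.
by rewrite mulN1r.
Qed.

Lemma cintegralD A f g : measurable A -> cint A f -> cint A g ->
  cintegral A (fun x => f x + g x) = cintegral A f + cintegral A g.
Proof.
move=> mA [f1 f2] [g1 g2]; apply: complex_ext; rewrite ?ReD ?ImD /cintegral/=.
  by rewrite -RintegralD//; apply: eq_Rintegral => x _; rewrite ReD.
by rewrite -RintegralD//; apply: eq_Rintegral => x _; rewrite ImD.
Qed.

Lemma cintegralZ A c f : measurable A -> cint A f ->
  cintegral A (fun x => c * f x) = c * cintegral A f.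
Proof.
move=> mA [f1 f2]; apply: complex_ext; rewrite ?ReM ?ImM /cintegral/=.
  rewrite -!RintegralZl// -RintegralB//; [|exact: rintZ..].
  by apply: eq_Rintegral => x _; rewrite ReM.
rewrite -!RintegralZl// -RintegralD//; [|exact: rintZ..].
by apply: eq_Rintegral => x _; rewrite ImM.
Qed.

Lemma cintegralB A f g : measurable A -> cint A f -> cint A g ->
  cintegral A (fun x => f x - g x) = cintegral A f - cintegral A g.
Proof.
move=> mA fi gi; rewrite -[in RHS]mulN1r -cintegralZ// -cintegralD//.
  by apply: eq_cintegral => x _; rewrite mulN1r.
exact: cintZ.
Qed.

(** Bounding the two components separately costs the factor 2; only the
    order of magnitude of integrals is used. *)
Lemma nrm_cintegral A f p : measurable A -> cint A f -> rint A p ->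
  (forall x, A x -> nrm (f x) <= p x) ->
  nrm (cintegral A f) <= 2 * \int[mu]_(x in A) p x.
Proof.
move=> mA [f1 f2] ip fp; rewrite (le_trans (nrm_le _))// mulr_natl mulr2n lerD//.
  apply: (le_trans (le_normr_Rintegral mA f1)).
  apply: le_Rintegral => //; first exact: rint_norm.
  by move=> x Ax; exact: le_trans (nrm_Re _) (fp x Ax).
apply: (le_trans (le_normr_Rintegral mA f2)).
apply: le_Rintegral => //; first exact: rint_norm.
by move=> x Ax; exact: le_trans (nrm_Im _) (fp x Ax).
Qed.

Lemma cdiff_under A (f df : R -> TR -> CR) p (x u v : R) :
  measurable A -> x \in `]u, v[ ->
  (forall x, x \in `]u, v[ -> cint A (f x)) ->
  (forall x y, x \in `]u, v[ -> A y -> is_cderive (f ^~ y) x (df x y)) ->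
  rint A p ->
  (forall x y, x \in `]u, v[ -> A y -> nrm (df x y) <= p y) ->
  is_cderive (fun x => cintegral A (f x)) x (cintegral A (df x)).
Proof.
move=> mA Ix fi dff ip dfp; split.
  apply: (@diff_under R A (fun x y => Re (f x y)) (fun x y => Re (df x y)) p x u v) => //.
  - by move=> z /fi [].
  - by move=> z y Iz Ay; have [] := dff z y Iz Ay.
  - by move=> z y Iz Ay; exact: le_trans (nrm_Re _) (dfp z y Iz Ay).
apply: (@diff_under R A (fun x y => Im (f x y)) (fun x y => Im (df x y)) p x u v) => //.
- by move=> z /fi [].
- by move=> z y Iz Ay; have [] := dff z y Iz Ay.
- by move=> z y Iz Ay; exact: le_trans (nrm_Im _) (dfp z y Iz Ay).
Qed.

Lemma cdom_cvg A (f_ : nat -> TR -> CR) f p : measurable A ->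
  (forall n, cmeas A (f_ n)) -> rint A p ->
  (forall n x, A x -> nrm (f_ n x) <= p x) ->
  (forall x, A x -> f_ n x @[n --> \oo] --> f x) ->
  cmeas A f /\ cintegral A (f_ n) @[n --> \oo] --> cintegral A f.
Proof.
move=> mA mf ip fp ff.
have [|n x Ax|x Ax|m1 h1] := @dom_cvg R A (fun n x => Re (f_ n x)) (fun x => Re (f x)) p mA _ ip.
- by move=> n; have [] := mf n.
- exact: le_trans (nrm_Re _) (fp n x Ax).
- by have /cvg_complexP[] := ff x Ax.
have [|n x Ax|x Ax|m2 h2] := @dom_cvg R A (fun n x => Im (f_ n x)) (fun x => Im (f x)) p mA _ ip.
- by move=> n; have [] := mf n.
- exact: le_trans (nrm_Im _) (fp n x Ax).
- by have /cvg_complexP[] := ff x Ax.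
by split; [split | exact/cvg_complexP].
Qed.

Lemma cintegral_exhaust A (a b : nat -> R) f (F : R -> CR) l : measurable A ->
  exhausts A a b ->
  (forall x, A x -> is_cderive F x (f x)) ->
  (forall x, A x -> {for x, continuous f}) ->
  cint A f -> F (b n) - F (a n) @[n --> \oo] --> l ->
  cintegral A f = l.
Proof.
move=> mA ex dF cf [f1 f2] /cvg_complexP[l1 l2]; apply: complex_ext => /=.
  apply: (@integral_exhaust R A a b _ (fun x => Re (F x))) => //.
  - by move=> x /dF [].
  - by move=> x /cf /cvg_complexP[].
  - by move: l1; under eq_fun do rewrite ReD ReN.
apply: (@integral_exhaust R A a b _ (fun x => Im (F x))) => //.
- by move=> x /dF [].
- by move=> x /cf /cvg_complexP[].
- by move: l2; under eq_fun do rewrite ImD ImN.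
Qed.

Lemma cderiv0_cst (F : R -> CR) (u v : R) :
  (forall x, x \in `]u, v[ -> is_cderive F x 0) ->
  forall x y, x \in `]u, v[ -> y \in `]u, v[ -> F x = F y.
Proof.
move=> dF x y Ix Iy; apply: complex_ext.
  by apply: (@deriv0_cst R (fun x => Re (F x)) u v) => // z /dF [].
by apply: (@deriv0_cst R (fun x => Im (F x)) u v) => // z /dF [].
Qed.

(** As for integrals, the factor 2 comes from treating the components
    separately. *)
Lemma cMVT_bound (F dF : R -> CR) (x y M : R) : x <= y ->
  (forall z, z \in `[x, y] -> is_cderive F z (dF z)) ->
  (forall z, z \in `[x, y] -> nrm (dF z) <= M) ->
  nrm (F y - F x) <= 2 * M * (y - x).
Proof.
move=> xy dFF dFM; rewrite (le_trans (nrm_le _))// -mulrA mulr_natl mulr2n.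
rewrite ReD ReN ImD ImN lerD//.
  apply: (@MVT_bound R (fun x => Re (F x)) (fun x => Re (dF x))) => //.
    by move=> z /dFF [].
  by move=> z /dFM; exact: le_trans (nrm_Re _).
apply: (@MVT_bound R (fun x => Im (F x)) (fun x => Im (dF x))) => //.
  by move=> z /dFF [].
by move=> z /dFM; exact: le_trans (nrm_Im _).
Qed.

End ComplexIntegral.

(** * Comparison functions *)
Section IntegrableFunctions.
Variable R : realType.
Local Notation TR := (measurableTypeR R).

Lemma is_derive_affine (a b x : R) : is_derive x 1 (fun y : R => a + b * y) b.
Proof.
have h := is_deriveD (is_derive_cst a x 1) (is_deriveZ b (is_derive_id x 1)).
apply: is_derive_eq h _.
by rewrite add0r /GRing.scale/= mulr1.
Qed.

Lemma is_derive_1D (x : R) : is_derive x 1 (fun y : R => 1 + y) 1.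
Proof.
by have := is_derive_affine 1 1 x; under eq_fun do rewrite mul1r.
Qed.

Lemma near_nat_ge (x : R) : \forall n \near \oo, x <= n.+1%:R.
Proof.
exists (Num.truncn `|x|) => // n /= xn.
rewrite (le_trans (ler_norm x))// ltW// (lt_le_trans (truncnS_gt _))//.
by rewrite ler_nat.
Qed.

Lemma exhausts_T : exhausts [set: TR] (fun n => - n.+1%:R) (fun n => n.+1%:R).
Proof.
split => // [n|x _].
  by rewrite (@lt_trans _ _ 0)// oppr_lt0.
apply: filterS2 (near_nat_ge x) (near_nat_ge (- x)) => n xn Nxn.
by rewrite in_itv/= xn andbT lerNl.
Qed.

Lemma exhausts_oy (a : R) :
  exhausts (`]a, +oo[ : set TR) (fun n => a + n.+2%:R^-1) (fun n => a + n.+2%:R).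
Proof.
split => [n|n x|x].
- by rewrite ltrD2l (@lt_trans _ _ 1)// ?invf_lt1 ?ltr1n.
- rewrite /= !in_itv/= andbT => /andP[+ _]; apply: lt_le_trans.
  by rewrite ltrDl.
rewrite /= in_itv/= andbT => ax.
have xa0 : 0 < x - a by rewrite subr_gt0.
apply: filterS2 (near_nat_ge (x - a)) (near_nat_ge (x - a)^-1) => n h1 h2.
have n0 : 0 < n.+2%:R :> R by [].
have h3 : n.+1%:R <= n.+2%:R :> R by rewrite ler_nat.
have h4 : n.+2%:R^-1 <= x - a.
  by rewrite -(invrK (x - a)) lef_pV2 ?posrE ?invr_gt0// (le_trans h2).
rewrite in_itv/=; apply/andP; split; first by rewrite -lerBrDl.
by rewrite -lerBlDl (le_trans h1).
Qed.

Lemma rint_cauchy : rint [set: TR] (fun t => (1 + t ^+ 2)^-1).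
Proof.
apply: (@rint_exhaust R _ _ _ _ (@atan R) pi measurableT exhausts_T) => //.
- by move=> x _; exact: continuous_oneDsqrV.
- by apply: measurable_continuous_open openT _ => x _; exact: continuous_oneDsqrV.
- by move=> x _; rewrite invr_ge0 addr_ge0// sqr_ge0.
- move=> n; rewrite atanN opprK; have := atan_ltpi2 (n.+1%:R : R); lra.
Qed.

(** The primitive (x / (1 + x))^(r+1) / (r+1) is bounded.  This function dominates
    those of Euler's integral, and for r = 0 the flat ones. *)
Lemma rint_beta (r : R) : -1 < r ->
  rint (`]0, +oo[ : set TR) (fun x => x `^ r * (1 + x) `^ (- (r + 2))).
Proof.
move=> r1; have r0 : 0 < r + 1 by lra.
have dp (x : R) : 0 < x -> is_derive x 1
    (fun y : R => (y / (1 + y)) `^ (r + 1) / (r + 1))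
    (x `^ r * (1 + x) `^ (- (r + 2))).
  move=> x0; have x1 : 0 < 1 + x by lra.
  have q0 : 0 < x / (1 + x) by rewrite divr_gt0.
  have d1 := is_derive_1D x.
  have dV := @is_deriveV R (fun y => 1 + y) x _ _ (lt0r_neq0 x1) d1.
  have dq := is_deriveM (is_derive_id x 1) dV.
  have dP := @is_derive1_comp R (@powR R ^~ (r + 1)) _ x _ _
    (is_derive1_powR (r + 1) q0) dq.
  have dR := is_deriveM dP (is_derive_cst (r + 1)^-1 x 1).
  apply: is_derive_eq dR _ => /=.
  rewrite /GRing.scale/= mulr0 add0r addrK.
  have -> : (x * (1 + x)^-1) `^ r = x `^ r * (1 + x) `^ (- r).
    by rewrite powRM ?ltW ?invr_gt0// -powR_inv1 ?ltW// -powRrM mulN1r.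
  have -> : (1 + x) `^ (- (r + 2)) = (1 + x) `^ (- r) * (1 + x) ^- 2.
    rewrite opprD powRD; last by rewrite (lt0r_neq0 x1) implybT.
    by rewrite powR_invn// ltW.
  by field; rewrite !lt0r_neq0.
have dc (x : R) : 0 < x ->
    {for x, continuous (fun x : R => x `^ r * (1 + x) `^ (- (r + 2)))}.
  move=> x0; have x1 : 0 < 1 + x by lra.
  have d1 := is_derive_1D x.
  have e1 := is_derive1_powR r x0.
  have e2 := @is_derive1_comp R (@powR R ^~ (- (r + 2))) _ x _ _ (is_derive1_powR _ x1) d1.
  have [d _] := is_deriveM e1 e2.
  exact: (differentiable_continuous (iffLR (derivable1_diffP _ _) d)).
apply: (@rint_exhaust R _ _ _ _ (fun y : R => (y / (1 + y)) `^ (r + 1) / (r + 1))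
   (r + 1)^-1 (measurable_itv _) (exhausts_oy 0)) => //.
- by move=> x /=; rewrite in_itv/= andbT => x0; exact: dp.
- by move=> x /=; rewrite in_itv/= andbT => x0; exact: dc.
- apply: measurable_continuous_open; first exact: interval_open.
  by move=> x /=; rewrite in_itv/= andbT => x0; exact: dc.
- by move=> x _; rewrite mulr_ge0// powR_ge0.
- move=> n; rewrite !add0r.
  have h : ((n.+2%:R / (1 + n.+2%:R)) `^ (r + 1) : R) <= 1.
    have e1 : (1 : R) `^ (r + 1) = 1 by rewrite powR1.
    have n1 : 0 < 1 + n.+2%:R :> R by rewrite addr_gt0.
    rewrite -[leRHS]e1; apply: (ge0_ler_powR (ltW r0)).
    - by rewrite nnegrE divr_ge0// ltW.
    - by rewrite nnegrE.
    - by rewrite ler_pdivrMr// mul1r lerDr.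
  rewrite lerBlDr -[leLHS]addr0 lerD//.
    by rewrite ler_pdivrMr// mulVf// lt0r_neq0.
  by rewrite divr_ge0 ?powR_ge0// ltW.
Qed.

(** This is ln y <= y - 1 at y = (p / q) (1 + x). *)
Lemma powR_le_expR (p q x : R) : 0 < p -> 0 < q -> 0 <= x ->
  (1 + x) `^ q <= expR (p - q - q * ln (p / q)) * expR (p * x).
Proof.
move=> p0 q0 x0; have x1 : 0 < 1 + x by lra.
have e0 : 0 < p / q by rewrite divr_gt0.
rewrite /powR gt_eqF// -expRD ler_expR.
have h : ln (p / q) + ln (1 + x) <= p / q * (1 + x) - 1.
  rewrite -lnM ?posrE//; set y := p / q * (1 + x).
  have y0 : 0 < y by rewrite mulr_gt0.
  by have := expR_ge1Dx (ln y); rewrite lnK ?posrE//; lra.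
have := ler_wpM2l (ltW q0) h.
rewrite mulrDr mulrBr mulr1 mulrA (mulrC q (p / q)) divfK ?lt0r_neq0//.
lra.
Qed.

Lemma rint_gamma (r p : R) : -1 < r -> 0 < p ->
  rint (`]0, +oo[ : set TR) (fun x => x `^ r * expR (- (p * x))).
Proof.
move=> r1 p0; have q0 : 0 < r + 2 by lra.
set C := expR (p - (r + 2) - (r + 2) * ln (p / (r + 2))).
apply: (rint_dom (measurable_itv _) _ (rintZ C (measurable_itv _) (rint_beta r1))).
  apply: rmeasM.
    exact: measurable_funTS (measurable_powR _).
  have -> : (fun x : TR => expR (- (p * x))) = (fun x : TR => expR ((- p) * x)).
    by apply/funext => x; rewrite mulNr.
  apply: (rmeas_comp (@continuous_expR R)).
  by apply: rmeasM; [exact: rmeas_cst|exact: measurable_id].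
move=> x /=; rewrite in_itv/= andbT => x0.
rewrite ger0_norm ?mulr_ge0 ?powR_ge0 ?expR_ge0// mulrCA ler_wpM2l ?powR_ge0//.
have x1 : 0 < 1 + x by lra.
rewrite powRN -[leRHS]mulrC ler_pdivlMl ?powR_gt0// expRN ler_pdivrMr ?expR_gt0//.
exact: powR_le_expR (ltW x0).
Qed.

End IntegrableFunctions.

(** * Exchange of integrals *)
Section FubiniComplex.
Variable R : realType.
Local Notation mu := (@lebesgue_measure R).
Local Notation TR := (measurableTypeR R).
Local Notation CR := (R[i]^o).
Local Notation Re := (@complex.Re R).
Local Notation Im := (@complex.Im R).

Lemma rfubini (f : TR * TR -> R) (p q : TR -> R) :
  measurable_fun setT f -> rint setT p -> rint setT q ->
  (forall t x, `|f (t, x)| <= p t * q x) ->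
  \int[mu]_t \int[mu]_x f (t, x) = \int[mu]_x \int[mu]_t f (t, x).
Proof.
move=> mf ip iq fpq.
have m1 t : rmeas setT (fun x => f (t, x)) by exact: measurable_fun_pair2.
have m2 x : rmeas setT (fun t => f (t, x)) by exact: measurable_fun_pair1.
have i1 t : rint setT (fun x => f (t, x)).
  by apply: rint_dom (rintZ (p t) measurableT iq) _.
have i2 x : rint setT (fun t => f (t, x)).
  apply: rint_dom (rintZ (q x) measurableT ip) _ => // t _.
  by rewrite mulrC.
have mF : measurable_fun setT (EFin \o f) by exact/measurable_EFinP.
have imf : (mu \x mu)%E.-integrable setT (EFin \o f).
  apply/integrable12ltyP => //.
  apply: (@le_lt_trans _ _ (\int[mu]_t ((\int[mu]_x q x) * p t)%:E)%E).
    apply: ge0_le_integral => //=.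
    - by move=> t _; apply: integral_ge0.
    - by apply: (measurable_fun_fubini_tonelli_F (abse \o (EFin \o f))) => //=; exact: measurableT_comp.
    - by apply/rmeasP; apply: rmeasM; [exact: rmeas_cst|exact: rint_meas].
    - move=> t _.
      rewrite mulrC -RintegralZl// -EFin_Rintegral//; last exact: rintZ.
      apply: ge0_le_integral => //=.
      + by apply/measurable_EFinP; apply: measurableT_comp => //; exact: m1.
      + by apply/measurable_EFinP; apply: rint_meas; exact: rintZ.
      + by move=> x _; rewrite lee_fin.
  rewrite EFin_Rintegral ?ltry//; exact: rintZ.
rewrite /Rintegral; congr fine.
transitivity (\int[mu]_t \int[mu]_x (EFin \o f) (t, x))%E.
  by apply: eq_integral => t _; rewrite -EFin_Rintegral//; exact: i1.
rewrite (Fubini imf).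
by apply: eq_integral => x _; rewrite -[RHS]EFin_Rintegral//; exact: i2.
Qed.

Lemma cfubini (f : TR * TR -> CR) (p q : TR -> R) :
  measurable_fun setT (fun z => Re (f z)) ->
  measurable_fun setT (fun z => Im (f z)) ->
  rint setT p -> rint setT q ->
  (forall t x, nrm (f (t, x)) <= p t * q x) ->
  cintegral setT (fun t : TR => cintegral setT (fun x : TR => f (t, x))) =
  cintegral setT (fun x : TR => cintegral setT (fun t : TR => f (t, x))).
Proof.
move=> m1 m2 ip iq fpq; rewrite /cintegral; congr (_ +i* _) => /=.
  apply: (@rfubini (fun z => Re (f z)) p q) => // t x.
  exact: le_trans (nrm_Re _) (fpq t x).
apply: (@rfubini (fun z => Im (f z)) p q) => // t x.
exact: le_trans (nrm_Im _) (fpq t x).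
Qed.

Lemma cintegral_mkcond (A : set TR) (f : TR -> CR) :
  cintegral A f = cintegral setT (f \_ A).
Proof.
rewrite /cintegral Rintegral_mkcond [X in _ +i* X]Rintegral_mkcond.
congr (_ +i* _); apply: eq_Rintegral => x _.
  by rewrite !patchE; case: ifP.
by rewrite !patchE; case: ifP.
Qed.

Lemma cmeas_mkcond (A : set TR) (f : TR -> CR) : measurable A ->
  cmeas A f -> cmeas setT (f \_ A).
Proof.
move=> mA [f1 f2]; split.
  rewrite (_ : (fun _ => _) = (fun x => Re (f x)) \_ A).
    exact/(measurable_restrictT _ mA).
  by apply/funext => x; rewrite !patchE; case: ifP.
rewrite (_ : (fun _ => _) = (fun x => Im (f x)) \_ A).
  exact/(measurable_restrictT _ mA).
by apply/funext => x; rewrite !patchE; case: ifP.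
Qed.

Definition cis (x : R) : CR := cexp ('i * x%:C).

Lemma nrm_cis x : nrm (cis x) = 1.
Proof. by rewrite nrm_cexp ReMi /= oppr0 expR0. Qed.

Lemma Re_cis x : Re (cis x) = cos x.
Proof. by rewrite Re_cexp ReMi ImMi /= oppr0 expR0 mul1r. Qed.

Lemma Im_cis x : Im (cis x) = sin x.
Proof. by rewrite Im_cexp ReMi ImMi /= oppr0 expR0 mul1r. Qed.

Lemma cmeas_cis (A : set TR) (p : TR -> R) : rmeas A p -> cmeas A (fun x => cis (p x)).
Proof.
move=> mp; apply: cmeas_cexp; apply: cmeasM; first exact: cmeas_cst.
exact: cmeas_real.
Qed.

(** The oscillating factor has modulus 1, so the double integral converges
    absolutely.  The phase m will be the identity, a dilation or a power. *)
Lemma fubini_cis (F g : TR -> CR) (A : set TR) (m : TR -> R) : measurable A ->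
  cint setT F -> cint A g -> rmeas A m ->
  cintegral setT (fun t : TR =>
    F t * cintegral A (fun x : TR => g x * cis (t * m x))) =
  cintegral A (fun x : TR => g x * cintegral setT (fun t : TR => F t * cis (t * m x))).
Proof.
move=> mA iF ig mm.
have [F1 F2] := cint_meas iF.
pose g0 := g \_ A; pose m0 := m \_ A.
have [g1 g2] := cmeas_mkcond mA (cint_meas ig).
have mm0 : measurable_fun setT m0 by exact/(measurable_restrictT _ mA).
pose f (z : TR * TR) := F z.1 * (g0 z.2 * cis (z.1 * m0 z.2)).
have mc : measurable_fun setT (fun z : TR * TR => z.1 * m0 z.2).
  by apply: measurable_funM; [exact: measurable_fst | exact: measurableT_comp mm0 measurable_snd].
have c1 : measurable_fun setT (fun z : TR * TR => Re (cis (z.1 * m0 z.2))).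
  under eq_fun do rewrite Re_cis.
  by apply: (@measurableT_comp _ _ _ _ _ _ (@cos R)) => //; apply: continuous_measurable_fun; exact: continuous_cos.
have c2 : measurable_fun setT (fun z : TR * TR => Im (cis (z.1 * m0 z.2))).
  under eq_fun do rewrite Im_cis.
  by apply: (@measurableT_comp _ _ _ _ _ _ (@sin R)) => //; apply: continuous_measurable_fun; exact: continuous_sin.
have F1' : measurable_fun setT (fun z : TR * TR => Re (F z.1)) := measurableT_comp F1 measurable_fst.
have F2' : measurable_fun setT (fun z : TR * TR => Im (F z.1)) := measurableT_comp F2 measurable_fst.
have g1' : measurable_fun setT (fun z : TR * TR => Re (g0 z.2)) := measurableT_comp g1 measurable_snd.
have g2' : measurable_fun setT (fun z : TR * TR => Im (g0 z.2)) := measurableT_comp g2 measurable_snd.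
have f1 : measurable_fun setT (fun z => Re (f z)).
  under eq_fun do rewrite !(ReM, ImM).
  by apply: measurable_funB; apply: measurable_funM => //;
    [apply: measurable_funB|apply: measurable_funD]; apply: measurable_funM.
have f2 : measurable_fun setT (fun z => Im (f z)).
  under eq_fun do rewrite !(ReM, ImM).
  by apply: measurable_funD; apply: measurable_funM => //;
    [apply: measurable_funD|apply: measurable_funB]; apply: measurable_funM.
have ip := cint_nrm measurableT iF.
have iq : rint setT (fun x => nrm (g0 x)).
  have h := cint_nrm mA ig.
  have := (integrable_mkcond _ mA).1 h; apply: eq_integrable => // x _ /=.
  by rewrite /g0 !patchE; case: ifP => _ //; rewrite -[RHS]/((nrm (0 : CR))%:E) nrm0.
have fpq t x : nrm (f (t, x)) <= nrm (F t) * nrm (g0 x).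
  by rewrite /f 2!nrmM nrm_cis mulr1.
have ig0 : cint setT g0.
  split.
    have := (integrable_mkcond _ mA).1 ig.1; apply: eq_integrable => // x _ /=.
    by rewrite /g0 !patchE; case: ifP.
  have := (integrable_mkcond _ mA).1 ig.2; apply: eq_integrable => // x _ /=.
  by rewrite /g0 !patchE; case: ifP.
have icis (h : TR -> CR) (k : TR -> R) : cint setT h -> rmeas setT k -> cint setT (fun x => h x * cis (k x)).
  move=> ih mk; apply: (cint_dom measurableT _ (cint_nrm measurableT ih)).
    by apply: cmeasM; [exact: cint_meas|exact: cmeas_cis].
  by move=> x _; rewrite nrmM nrm_cis mulr1.
transitivity (cintegral setT (fun t : TR => cintegral setT (fun x : TR => f (t, x)))).
  apply: eq_cintegral => t _.
  rewrite /f /= cintegralZ//; last first.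
    by apply: icis => //; apply: rmeasM => //; exact: rmeas_cst.
  congr (_ * _); rewrite cintegral_mkcond; apply: eq_cintegral => x _.
  by rewrite /g0 /m0 !patchE; case: ifP => //; rewrite mul0r.
rewrite (cfubini f1 f2 ip iq fpq) [RHS]cintegral_mkcond.
apply: eq_cintegral => x _; rewrite patchE /f /=.
under (eq_cintegral (A := setT)) => t _ do rewrite mulrCA.
rewrite cintegralZ//; last first.
  by apply: icis => //; apply: rmeasM; [exact: measurable_id|exact: rmeas_cst].
by rewrite /g0 /m0 !patchE; case: ifP => //; rewrite mul0r.
Qed.

End FubiniComplex.

(** * Shifting lines of integration *)
Section Holomorphic.
Variable R : realType.
Local Notation TR := (measurableTypeR R).
Local Notation CR := (R[i]^o).
Local Notation Re := (@complex.Re R).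
Local Notation Im := (@complex.Im R).
Implicit Types (f g : CR -> CR) (z w a b : CR) (s t x : R).

Definition pt s t : CR := s%:C + t%:C * 'i.

Lemma Re_pt s t : Re (pt s t) = s.
Proof. by rewrite ReD ReM /=; ring. Qed.
Lemma Im_pt s t : Im (pt s t) = t.
Proof. by rewrite ImD ImM /=; ring. Qed.
Lemma pt0 t : pt 0 t = t *i.
Proof. by apply: complex_ext; rewrite ?Re_pt ?Im_pt. Qed.

(** Holomorphy in the right half-plane is used through its restrictions to real
    lines a + s b only: there f is a differentiable curve with velocity b f'. *)
Definition holo f f' := forall a b s, 0 < Re (a + s%:C * b) ->
  is_cderive (fun y => f (a + y%:C * b)) s (b * f' (a + s%:C * b)).

Lemma holo_eq f f' g' : holo f f' -> (forall z, 0 < Re z -> f' z = g' z) ->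
  holo f g'.
Proof. by move=> h e a b s s0; rewrite -e//; exact: h. Qed.

Lemma holo_cst a : holo (fun=> a) (fun=> 0).
Proof. by move=> b c s _; rewrite mulr0; exact: is_cderive_cst. Qed.

Lemma is_cderive_affine a b s : is_cderive (fun y => a + y%:C * b) s b.
Proof.
apply: is_cderive_eq (is_cderiveD (is_cderive_cst a s)
  (is_cderiveM (is_cderive_id s) (is_cderive_cst b s))) _.
by rewrite add0r mulr0 addr0 mul1r.
Qed.

Lemma holo_id : holo id (fun=> 1).
Proof. by move=> a b s _; rewrite mulr1; exact: is_cderive_affine. Qed.

Lemma holoD f f' g g' : holo f f' -> holo g g' ->
  holo (fun z => f z + g z) (fun z => f' z + g' z).
Proof. by move=> hf hg a b s s0; rewrite mulrDr; apply: is_cderiveD; [exact: hf|exact: hg]. Qed.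

Lemma holoM f f' g g' : holo f f' -> holo g g' ->
  holo (fun z => f z * g z) (fun z => f' z * g z + f z * g' z).
Proof.
move=> hf hg a b s s0; apply: is_cderive_eq (is_cderiveM (hf a b s s0) (hg a b s s0)) _.
by ring.
Qed.

Lemma holoV f f' : holo f f' -> (forall z, 0 < Re z -> f z != 0) ->
  holo (fun z => (f z)^-1) (fun z => - (f' z / f z ^+ 2)).
Proof.
move=> hf f0 a b s s0; apply: is_cderive_eq (is_cderiveV (hf a b s s0) (f0 _ s0)) _.
by rewrite mulrN mulrA.
Qed.

Lemma holo_cexp a : holo (fun z => cexp (a * z)) (fun z => a * cexp (a * z)).
Proof.
move=> c b s _; have h := is_cderive_cexp (is_cderiveZ a (is_cderive_affine c b s)).
by apply: is_cderive_eq h _; ring.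
Qed.

Lemma holo_affine f f' (c d : CR) : (forall z, 0 < Re z -> 0 < Re (c + d * z)) ->
  holo f f' -> holo (fun z => f (c + d * z)) (fun z => d * f' (c + d * z)).
Proof.
move=> cd hf a b s s0.
have E y : c + d * (a + y%:C * b) = (c + d * a) + y%:C * (d * b) by ring.
under eq_fun do rewrite E.
rewrite E; apply: is_cderive_eq (hf _ _ _ _) _; last by ring.
by rewrite -E; exact: cd.
Qed.

Lemma holo_line f f' s t : holo f f' -> 0 < s ->
  is_cderive (fun t => f (pt s t)) t ('i * f' (pt s t)).
Proof. by move=> hf s0; apply: hf; rewrite -/(pt s t) Re_pt. Qed.

Lemma holo_row f f' s t : holo f f' -> 0 < s ->
  is_cderive (fun s => f (pt s t)) s (f' (pt s t)).
Proof.
move=> hf s0.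
have E y : pt y t = t%:C * 'i + y%:C * 1 by rewrite /pt mulr1 addrC.
under eq_fun do rewrite E.
rewrite E -[f' _]mul1r; apply: hf; rewrite -E Re_pt //.
Qed.

Lemma holo_cont f f' s t : holo f f' -> 0 < s ->
  {for t, continuous (fun t => f (pt s t))}.
Proof. by move=> hf s0; exact: is_cderive_continuous (holo_line t hf s0). Qed.

Section Shift.
Variables (g g' g'' : CR -> CR) (M u : R).
Hypothesis hg : holo g g'.
Hypothesis hg' : holo g' g''.
Hypothesis gM : forall s t, 0 < s -> s < u -> nrm (g (pt s t)) <= M * (1 + t ^+ 2)^-1.
Hypothesis g'M : forall s t, 0 < s -> s < u -> nrm (g' (pt s t)) <= M * (1 + t ^+ 2)^-1.

Let dom := rintZ M measurableT (rint_cauchy R).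

Lemma shift_int h h' s : holo h h' -> 0 < s -> s < u ->
  (forall s t, 0 < s -> s < u -> nrm (h (pt s t)) <= M * (1 + t ^+ 2)^-1) ->
  cint setT (fun t : TR => h (pt s t)).
Proof.
move=> hh s0 su hM; apply: cint_dom measurableT _ dom _ => [|t _]; last exact: hM.
by apply: cmeas_continuous openT _ => t _; exact: holo_cont hh s0.
Qed.

(** The boundary term of an integration by parts over the real line. *)
Lemma cauchy_cvg0 (h : R -> CR) : (forall t, nrm (h t) <= M * (1 + t ^+ 2)^-1) ->
  h n.+1%:R - h (- n.+1%:R) @[n --> \oo] --> 0.
Proof.
move=> hM.
have M0 : 0 <= M.
  by have := le_trans (nrm_ge0 _) (hM 0); rewrite expr0n addr0 invr1 mulr1.
apply/cvg_nrmP => e e0.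
apply: filterS (near_nat_ge (2 * M / e + 1)) => n hn.
rewrite sub0r nrmN (le_lt_trans (nrmB _ _))//.
have n0 : 0 < (n.+1%:R : R) by [].
have n1 : 1 <= (n.+1%:R : R) by rewrite ler1n.
set N := n.+1%:R in hn n0 n1 *.
have q : (1 + N ^+ 2)^-1 <= N^-1 by rewrite lef_pV2 ?posrE//; nra.
have h1 : nrm (h N) <= M / N := le_trans (hM _) (ler_wpM2l M0 q).
have h2 : nrm (h (- N)) <= M / N.
  by apply: le_trans (hM _) _; rewrite sqrrN ler_wpM2l.
apply: le_lt_trans (lerD h1 h2) _.
have -> : M / N + M / N = 2 * M / N by rewrite -mulrDl -mulr2n mulr_natl.
rewrite ltr_pdivrMr// (mulrC e) -ltr_pdivrMr//; lra.
Qed.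

(** Since d/dt g(s + it) = i g'(s + it), the integral of g' along a vertical line
    is a boundary term at infinity. *)
Lemma shift_deriv0 s : 0 < s -> s < u ->
  cintegral setT (fun t : TR => g' (pt s t)) = 0.
Proof.
move=> s0 su.
apply: (@cintegral_exhaust R setT _ _ _ (fun t => - 'i * g (pt s t)) 0 measurableT (exhausts_T R)).
- move=> t _; apply: is_cderive_eq (is_cderiveZ (- 'i) (holo_line t hg s0)) _.
  by rewrite mulrA mulNr sqr_iN opprK mul1r.
- by move=> t _; exact: holo_cont hg' s0.
- exact: shift_int hg' s0 su g'M.
- apply: (@cauchy_cvg0 (fun t => - 'i * g (pt s t))) => t.
  by rewrite nrmM nrmN nrm_i mul1r; exact: gM.
Qed.

(** The derivative in s of the integral is the integral of g', which vanishes: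
    this replaces Cauchy's theorem on rectangles. *)
Lemma shift_const s1 s2 : 0 < s1 -> s1 < u -> 0 < s2 -> s2 < u ->
  cintegral setT (fun t : TR => g (pt s1 t)) =
  cintegral setT (fun t : TR => g (pt s2 t)).
Proof.
move=> s10 s1u s20 s2u.
apply: (@cderiv0_cst R (fun s => cintegral setT (fun t : TR => g (pt s t))) 0 u);
  rewrite ?in_itv/= ?s10 ?s20//.
move=> s sI; have /andP[s0 su] : 0 < s < u by move: sI; rewrite in_itv.
rewrite -(shift_deriv0 s0 su).
apply: (@cdiff_under R setT (fun s t => g (pt s t)) (fun s t => g' (pt s t)) _ s 0 u measurableT sI _ _ dom).
- by move=> x; rewrite in_itv/= => /andP[x0 xu]; exact: shift_int hg x0 xu gM.
- by move=> x y; rewrite in_itv/= => /andP[x0 xu] _; exact: holo_row hg x0.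
- by move=> x y; rewrite in_itv/= => /andP[x0 xu] _; exact: g'M.
Qed.

Lemma shift_bdry s : 0 < s -> s < u ->
  (forall t, g (pt n.+1%:R^-1 t) @[n --> \oo] --> g (pt 0 t)) ->
  cintegral setT (fun t : TR => g (pt 0 t)) =
  cintegral setT (fun t : TR => g (pt s t)).
Proof.
move=> s0 su gb.
have [N /= _ Nu] : \forall n \near \oo, (n.+1%:R^-1 : R) < u.
  apply: filterS (near_nat_ge (u^-1 + 1)) => n h.
  by rewrite -[ltRHS]invrK ltf_pV2 ?posrE ?invr_gt0//; lra.
have k0 k : 0 < ((k + N)%N.+1%:R^-1 : R) by rewrite invr_gt0.
have ku k : ((k + N)%N.+1%:R^-1 : R) < u.
  exact: (Nu (k + N)%N (leq_addl _ _)).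
have [_ h] := @cdom_cvg R setT (fun n t => g (pt (n + N)%N.+1%:R^-1 t))
  (fun t => g (pt 0 t)) _ measurableT
  (fun n => cint_meas (shift_int hg (k0 n) (ku n) gM)) dom
  (fun n t _ => gM t (k0 n) (ku n))
  (fun t _ => ltac:(have := gb t; rewrite -(cvg_shiftn N); exact)).
apply: cvg_unique h _ => //.
rewrite (_ : (fun n => _) = (fun=> cintegral setT (fun t : TR => g (pt s t)))).
  exact: cvg_cst.
apply/funext => n; exact: shift_const.
Qed.

End Shift.

(** The integral does not depend on s and is at most of order 1 / (1 + s). *)
Lemma shift_zero (g g' g'' : CR -> CR) (M : R) :
  holo g g' -> holo g' g'' ->
  (forall s t, 0 < s -> nrm (g (pt s t)) <= M * (1 + s)^-1 * (1 + t ^+ 2)^-1) ->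
  (forall s t, 0 < s -> nrm (g' (pt s t)) <= M * (1 + t ^+ 2)^-1) ->
  forall s, 0 < s -> cintegral setT (fun t : TR => g (pt s t)) = 0.
Proof.
move=> hg hg' gM g'M s s0.
have M0 : 0 <= M.
  have := le_trans (nrm_ge0 _) (gM 1 0 ltr01); rewrite expr0n addr0 invr1 mulr1.
  by rewrite pmulr_lge0// invr_gt0.
have gM' x t : 0 < x -> nrm (g (pt x t)) <= M * (1 + t ^+ 2)^-1.
  move=> x0; apply: le_trans (gM x t x0) _; rewrite ler_wpM2r//.
    by rewrite invr_ge0 addr_ge0// sqr_ge0.
  by rewrite ler_piMr// invf_le1; lra.
have I0 := Rintegral_ge0 (lebesgue_measure (R := R)) (D := setT)
  (fun (t : TR) _ => ltac:(by rewrite invr_ge0 addr_ge0// sqr_ge0) : 0 <= (1 + t ^+ 2)^-1).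
set I := Rintegral _ _ _ in I0.
have bnd x : 0 < x -> nrm (cintegral setT (fun t : TR => g (pt x t))) <=
    2 * (M * (1 + x)^-1 * I).
  move=> x0; rewrite -RintegralZl//; last exact: rint_cauchy.
  apply: nrm_cintegral => //.
  - apply: (@shift_int M (x + 1) g g' x) => //; first by rewrite ltrDl.
    by move=> y t y0 _; exact: gM'.
  - exact: rintZ (rint_cauchy R).
  - by move=> t _; exact: gM.
apply/eqP; rewrite -nrm_eq0; apply/eqP/le_anti; rewrite nrm_ge0 andbT.
apply/ler_addgt0Pr => e e0; rewrite add0r.
(* The bound at the abscissa y is 2 M I / (1 + y), which is at most e. *)
pose y := s + 2 * M * I / e.
have y0 : 0 < y by rewrite ltr_pwDl// !mulr_ge0// invr_ge0 ltW.
rewrite (@shift_const g g' g'' M (y + s + 1) hg hg' _ _ s y) //; try lra.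
- apply: (le_trans (bnd y y0)).
  have y1 : 0 < 1 + y by lra.
  rewrite [leLHS](_ : _ = 2 * M * I / (1 + y)); last by ring.
  rewrite ler_pdivrMr// mulrDr.
  have : e * y = e * s + 2 * M * I by rewrite /y; field; rewrite gt_eqF.
  by move=> ->; have := mulr_gt0 e0 s0; lra.
- by move=> x t x0 _; exact: gM'.
- by move=> x t x0 _; exact: g'M.
Qed.

End Holomorphic.

(** * The inverse Laplace transform *)
Section HardyClass.
Variable R : realType.
Local Notation mu := (@lebesgue_measure R).
Local Notation TR := (measurableTypeR R).
Local Notation CR := (R[i]^o).
Local Notation Re := (@complex.Re R).
Local Notation Im := (@complex.Im R).
Implicit Types (f g : CR -> CR) (z w a b : CR) (s t x : R).

Definition rapid f := forall N : nat, exists M : R, forall z, 0 < Re z ->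
  nrm (f z) <= M * (1 + nrm z) ^- N.

(** Continuity up to the boundary along horizontal sequences is the form in which
    dominated convergence takes it. *)
Definition bcont f := forall t : R, f (pt n.+1%:R^-1 t) @[n --> \oo] --> f (pt 0 t).

(** A version of K of finite order of differentiability, suited to induction:
    the elements of K belong to all these classes. *)
Fixpoint hardy n f := rapid f /\ bcont f /\
  if n is m.+1 then exists f', holo f f' /\ hardy m f' else True.

Lemma hardy_rapid n f : hardy n f -> rapid f. Proof. by case: n => [|n] []. Qed.
Lemma hardy_bcont n f : hardy n f -> bcont f. Proof. by case: n => [|n] [_ []]. Qed.

Lemma hardy_mono n f : hardy n.+1 f -> hardy n f.
Proof.
elim: n f => [|n IH] f /= [rf [bf [f' [hf Hf']]]]; split=> //; split => //.
by exists f'; split => //; exact: IH.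
Qed.

Lemma one_nrm_gt0 z : 0 < 1 + nrm z. Proof. by rewrite ltr_pwDl// nrm_ge0. Qed.

Lemma rapid_ge0 f N : rapid f -> exists2 M : R, 0 <= M & forall z, 0 < Re z ->
  nrm (f z) <= M * (1 + nrm z) ^- N.
Proof.
move=> /(_ N) [M h]; exists M => //.
have := le_trans (nrm_ge0 _) (h 1 ltr01).
by rewrite pmulr_lge0// invr_gt0 exprn_gt0// one_nrm_gt0.
Qed.

Lemma rapidD f g : rapid f -> rapid g -> rapid (fun z => f z + g z).
Proof.
move=> rf rg N; have [M h] := rf N; have [M' h'] := rg N; exists (M + M') => z z0.
by rewrite mulrDl (le_trans (nrmD _ _))// lerD ?h ?h'.
Qed.

Lemma rapid_mulz f : rapid f -> rapid (fun z => z * f z).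
Proof.
move=> rf N; have [M M0 h] := rapid_ge0 N.+1 rf; exists M => z z0.
rewrite nrmM (le_trans (ler_wpM2l (nrm_ge0 _) (h z z0)))//.
rewrite mulrCA ler_wpM2l// exprSr invfM mulrA ler_pdivrMr ?one_nrm_gt0//.
by rewrite mulrC ler_wpM2l ?invr_ge0 ?exprn_ge0 ?addr_ge0 ?nrm_ge0// lerDr.
Qed.

Lemma bcontD f g : bcont f -> bcont g -> bcont (fun z => f z + g z).
Proof. by move=> bf bg t; apply: cvgD; [exact: bf|exact: bg]. Qed.

Lemma cvg_pt0 t : (pt n.+1%:R^-1 t : CR) @[n --> \oo] --> pt 0 t.
Proof.
apply/cvg_complexP; split.
  by under eq_fun do rewrite Re_pt; rewrite Re_pt; exact: cvg_harmonic.
by under eq_fun do rewrite Im_pt; rewrite Im_pt; exact: cvg_cst.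
Qed.

Lemma bcontM f g : bcont f -> bcont g -> bcont (fun z => f z * g z).
Proof. by move=> bf bg t; apply: cvgM; [exact: bf|exact: bg]. Qed.

Lemma bcont_id : bcont id. Proof. by move=> t; exact: cvg_pt0. Qed.

Lemma hardyD n f g : hardy n f -> hardy n g -> hardy n (fun z => f z + g z).
Proof.
elim: n f g => [|n IH] f g /= [rf [bf Hf]] [rg [bg Hg]];
  (split; [exact: rapidD|split; [exact: bcontD|]]) => //.
have [[f' [hf Hf']] [g' [hg Hg']]] := (Hf, Hg).
exists (fun z => f' z + g' z); split; [exact: holoD|exact: IH].
Qed.

Lemma hardy_mulz n f : hardy n f -> hardy n (fun z => z * f z).
Proof.
elim: n f => [|n IH] f.
  move=> [rf [bf _]]; split; first exact: rapid_mulz.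
  by split; first exact: bcontM bcont_id bf.
move=> Hf; have [rf [bf [f' [hf Hf']]]] := Hf.
split; first exact: rapid_mulz.
split; first exact: bcontM bcont_id bf.
exists (fun z => 1 * f z + z * f' z); split; first exact: holoM (@holo_id R) hf.
apply: hardyD; last exact: IH.
rewrite (_ : (fun _ => _) = f); first exact: hardy_mono Hf.
by apply/funext => z; rewrite mul1r.
Qed.

Lemma weight2 z : (1 + nrm z) ^- 2 <= (1 + Im z ^+ 2)^-1.
Proof.
rewrite lef_pV2 ?posrE ?exprn_gt0 ?one_nrm_gt0//; last first.
  by rewrite ltr_pwDl// sqr_ge0.
have := nrm_Im z; have := nrm_ge0 z.
rewrite -[Im z ^+ 2](real_normK (num_real _)); have := normr_ge0 (Im z); nra.
Qed.

(** Three powers of 1 + |z| pay for integrability along vertical lines and for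
    decay of the integral as the line moves to infinity. *)
Lemma weight3 z : 0 < Re z ->
  (1 + nrm z) ^- 3 <= (1 + Re z)^-1 * (1 + Im z ^+ 2)^-1.
Proof.
move=> z0; rewrite exprS invfM ler_pM ?invr_ge0 ?exprn_ge0 ?weight2//.
- exact: ltW (one_nrm_gt0 _).
- exact: ltW (one_nrm_gt0 _).
rewrite lef_pV2 ?posrE ?one_nrm_gt0//; last by rewrite addr_gt0.
by rewrite lerD2l (le_trans (ler_norm _))// nrm_Re.
Qed.

Lemma rapid_line f : rapid f -> exists2 M : R, 0 <= M &
  forall s t, 0 < s -> nrm (f (pt s t)) <= M * (1 + t ^+ 2)^-1.
Proof.
move=> /(rapid_ge0 2)[M M0 h]; exists M => // s t s0.
have z0 : 0 < Re (pt s t) by rewrite Re_pt.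
by rewrite (le_trans (h _ z0))// ler_wpM2l// -{2}(Im_pt s t) weight2.
Qed.

Lemma rapid_shift f : rapid f -> exists2 M : R, 0 <= M &
  forall s t, 0 < s -> nrm (f (pt s t)) <= M * (1 + s)^-1 * (1 + t ^+ 2)^-1.
Proof.
move=> /(rapid_ge0 3)[M M0 h]; exists M => // s t s0.
have z0 : 0 < Re (pt s t) by rewrite Re_pt.
rewrite (le_trans (h _ z0))// -mulrA ler_wpM2l//.
by rewrite -{2}(Re_pt s t) -{3}(Im_pt s t) weight3.
Qed.

Lemma bdry_line f : rapid f -> bcont f -> exists2 M : R, 0 <= M &
  forall t, nrm (f (pt 0 t)) <= M * (1 + t ^+ 2)^-1.
Proof.
move=> /rapid_line[M M0 h] bf; exists M => // t.
have c : nrm (f (pt n.+1%:R^-1 t)) @[n --> \oo] --> nrm (f (pt 0 t)).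
  exact: cvg_nrm (bf t).
rewrite -(cvg_lim _ c)//; apply: limr_le; first by apply/cvg_ex; eexists; exact: c.
by apply: nearW => n; apply: h; rewrite invr_gt0.
Qed.

Lemma bdry_meas n f : hardy n.+1 f -> cmeas setT (fun t : TR => f (pt 0 t)).
Proof.
move=> [rf [bf [f' [hf _]]]].
have m k : cmeas setT (fun t : TR => f (pt k.+1%:R^-1 t)).
  apply: cmeas_continuous openT _ => t _.
  by apply: (holo_cont hf); rewrite invr_gt0.
split.
  apply: (@measurable_fun_cvg _ _ _ _ (fun k t => Re (f (pt k.+1%:R^-1 t)))).
    by move=> k; have [] := m k.
  by move=> t _; have /cvg_complexP[] := bf t.
apply: (@measurable_fun_cvg _ _ _ _ (fun k t => Im (f (pt k.+1%:R^-1 t)))).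
  by move=> k; have [] := m k.
by move=> t _; have /cvg_complexP[] := bf t.
Qed.

Lemma bdry_cint n f : hardy n.+1 f -> cint setT (fun t : TR => f (pt 0 t)).
Proof.
move=> Hf; have [M M0 h] := bdry_line (hardy_rapid Hf) (hardy_bcont Hf).
apply: cint_dom measurableT (bdry_meas Hf) (rintZ M measurableT (rint_cauchy R)) _.
by move=> t _; exact: h.
Qed.

Definition invLap f x : CR :=
  (2 * pi)^-1%:C * cintegral setT (fun t : TR => f (pt 0 t) * cis (t * x)).

Lemma cis_pt0 t x : cis (t * x) = cexp (x%:C * pt 0 t) :> CR.
Proof.
congr cexp; apply: complex_ext.
  by rewrite ReMi ReZ Re_pt mulr0 /= oppr0.
by rewrite ImMi ImZ Im_pt /= mulrC.
Qed.

Lemma invLapE f x : invLap f x = (2 * pi)^-1%:C *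
  cintegral setT (fun t : TR => f (pt 0 t) * cexp (x%:C * pt 0 t)).
Proof. by congr (_ * _); apply: eq_cintegral => t _; rewrite cis_pt0. Qed.

Lemma nrm_cexp_pt x s t : nrm (cexp (x%:C * pt s t)) = expR (x * s).
Proof. by rewrite nrm_cexp ReZ Re_pt. Qed.

Lemma rapid_cexp f x s t (M : R) u :
  nrm (f (pt s t)) <= M * u ->
  nrm (f (pt s t) * cexp (x%:C * pt s t)) <= expR (x * s) * M * u.
Proof.
by move=> h; rewrite nrmM nrm_cexp_pt mulrC -mulrA ler_wpM2l ?expR_ge0.
Qed.

(* The integrand of [invLap f x], continued to the half-plane, is the function
   g(z) = f(z) exp(xz). *)
Section VerticalLines.
Variables (f f' f'' : CR -> CR) (x : R).
Hypotheses (rf : rapid f) (rf' : rapid f') (bf : bcont f).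
Hypotheses (hf : holo f f') (hf' : holo f' f'').

Let g z := f z * cexp (x%:C * z).
Let g' z := f' z * cexp (x%:C * z) + f z * (x%:C * cexp (x%:C * z)).

Let hg : holo g g'. Proof. by apply: holoM => //; exact: holo_cexp. Qed.

Let hg' : exists g'', holo g' g''.
Proof.
eexists; apply: holoD; first exact: holoM hf' (holo_cexp _).
exact: holoM hf (holoM (holo_cst x%:C) (holo_cexp _)).
Qed.

Let strip : exists2 M : R, 0 <= M & forall s t, 0 < s ->
  nrm (g (pt s t)) <= expR (x * s) * M * (1 + t ^+ 2)^-1 /\
  nrm (g' (pt s t)) <= expR (x * s) * M * (1 + t ^+ 2)^-1.
Proof.
have [M M0 h] := rapid_line rf; have [M' M'0 h'] := rapid_line rf'.
have x0 := normr_ge0 x.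
exists (M + M' + `|x| * M); first by rewrite !addr_ge0// mulr_ge0.
move=> s t s0; set u := (1 + t ^+ 2)^-1.
have u0 : 0 <= u by rewrite invr_ge0 addr_ge0// sqr_ge0.
have e0 := expR_ge0 (x * s).
have b := rapid_cexp x (h s t s0); have b' := rapid_cexp x (h' s t s0).
split.
  apply: (le_trans b); rewrite ler_wpM2r// ler_wpM2l// -addrA lerDl.
  by rewrite addr_ge0// mulr_ge0.
apply: (le_trans (nrmD _ _)).
rewrite [f _ * _]mulrCA [nrm (x%:C * _)]nrmM nrm_real.
apply: (le_trans (lerD b' (ler_wpM2l x0 b))).
rewrite -/u; have := mulr_ge0 (mulr_ge0 e0 M0) u0; lra.
Qed.

Let strip_u u : 0 < u -> exists2 M : R, 0 <= M & forall s t, 0 < s -> s < u ->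
  nrm (g (pt s t)) <= M * (1 + t ^+ 2)^-1 /\
  nrm (g' (pt s t)) <= M * (1 + t ^+ 2)^-1.
Proof.
move=> u0; have [M M0 h] := strip.
exists (expR (`|x| * u) * M); first by rewrite mulr_ge0// expR_ge0.
move=> s t s0 su; have [h1 h2] := h s t s0.
have w0 : 0 <= (1 + t ^+ 2)^-1 by rewrite invr_ge0 addr_ge0// sqr_ge0.
have e : expR (x * s) * M <= expR (`|x| * u) * M.
  rewrite ler_wpM2r// ler_expR (le_trans (ler_norm _))// normrM.
  by rewrite ler_wpM2l// gtr0_norm// ltW.
by split; [apply: (le_trans h1)|apply: (le_trans h2)]; rewrite ler_wpM2r.
Qed.

Let bg : bcont g.
Proof.
apply: (bcontM bf) => t.
have : (fun y : R => cexp (x%:C * pt y t)) n.+1%:R^-1 @[n --> \oo] --> cexp (x%:C * pt 0 t).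
  apply: (@cvg_comp _ _ _ (fun n : nat => (n.+1%:R^-1 : R)) (fun y : R => cexp (x%:C * pt y t)) _ (nbhs (0 : R))).
    exact: cvg_harmonic.
  have h : is_cderive (fun y => cexp (x%:C * pt y t)) 0 (x%:C * 1 * cexp (x%:C * pt 0 t)).
    apply: (is_cderive_cexp (u := fun y => x%:C * pt y t)); apply: is_cderiveZ.
    apply: is_cderive_eq (is_cderiveD (is_cderive_id 0) (is_cderive_cst (t%:C * 'i) 0)) _.
    by rewrite addr0.
  exact: is_cderive_continuous h.
by [].
Qed.

Lemma invLap_line s : 0 < s -> invLap f x = (2 * pi)^-1%:C *
  cintegral setT (fun t : TR => f (pt s t) * cexp (x%:C * pt s t)).
Proof.
move=> s0; rewrite invLapE; congr (_ * _).
have s1 : 0 < s + 1 by lra.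
have [M M0 h] := strip_u s1; have [g'' hg2] := hg'.
apply: (@shift_bdry R g g' g'' M (s + 1) hg hg2) => //.
- by move=> y t y0 yu; have [] := h y t y0 yu.
- by move=> y t y0 yu; have [] := h y t y0 yu.
- by rewrite ltrDl.
Qed.

Lemma line_cint s : 0 < s ->
  cint setT (fun t : TR => f (pt s t) * cexp (x%:C * pt s t)).
Proof.
move=> s0; have s1 : 0 < s + 1 by lra.
have [M M0 h] := strip_u s1.
apply: (@shift_int R M (s + 1) g g' s) => //; first by rewrite ltrDl.
by move=> y t y0 yu; have [] := h y t y0 yu.
Qed.

(** For x <= 0 the factor exp(xz) is bounded by 1 in the half-plane, so the line
    of integration can be pushed to infinity. *)
Lemma invLap_le0 : x <= 0 -> invLap f x = 0.
Proof.
move=> x0; have [M M0 h] := rapid_shift rf; have [M1 M10 h1] := strip.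
have [g'' hg2] := hg'.
rewrite (invLap_line ltr01) (_ : cintegral _ _ = 0) ?mulr0//.
have w0 (t : R) : 0 <= (1 + t ^+ 2)^-1 by rewrite invr_ge0 addr_ge0// sqr_ge0.
have e1 s : 0 < s -> expR (x * s) <= 1.
  by move=> s0; rewrite expR_le1; nra.
apply: (@shift_zero R g g' g'' (M + M1) hg hg2) => //.
- move=> s t s0.
  have v0 : 0 <= (1 + s)^-1 by rewrite invr_ge0; lra.
  rewrite nrmM nrm_cexp_pt.
  have := h s t s0; have := e1 s s0; have := expR_ge0 (x * s).
  have := nrm_ge0 (f (pt s t)); have := mulr_ge0 (mulr_ge0 M10 v0) (w0 t).
  nra.
- move=> s t s0; have [_ h2] := h1 s t s0; apply: (le_trans h2).
  rewrite ler_wpM2r// -[leRHS]mul1r ler_pM ?expR_ge0 ?e1//.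
  by rewrite lerDr.
Qed.

Lemma line_deriv0 s : 0 < s -> cintegral setT (fun t : TR => g' (pt s t)) = 0.
Proof.
move=> s0; have s1 : 0 < s + 1 by lra.
have [M M0 h] := strip_u s1; have [g'' hg2] := hg'.
apply: (@shift_deriv0 R g g' g'' M (s + 1) hg hg2) => //.
- by move=> y t y0 yu; have [] := h y t y0 yu.
- by move=> y t y0 yu; have [] := h y t y0 yu.
- by rewrite ltrDl.
Qed.
End VerticalLines.

(** The integral of the derivative f' exp(xz) + x f exp(xz) along the line
    Re z = 1 vanishes.  The line is taken inside the half-plane because f' is
    not known to be the derivative of f along the boundary. *)
Lemma invLap_mulx f f' f'' f3 x : rapid f -> rapid f' -> rapid f'' -> bcont f -> bcont f' ->
  holo f f' -> holo f' f'' -> holo f'' f3 ->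
  x%:C * invLap f x = - invLap f' x.
Proof.
move=> rf rf' rf'' bf bf' hf hf' hf''.
rewrite (invLap_line x rf rf' bf hf hf' ltr01) (invLap_line x rf' rf'' bf' hf' hf'' ltr01).
have h := line_deriv0 x rf rf' hf hf' ltr01.
have i1 := line_cint x rf rf' hf ltr01.
have i2 := line_cint x rf' rf'' hf' ltr01.
rewrite mulrCA -mulrN; congr (_ * _); apply/eqP; rewrite -addr_eq0 addrC; apply/eqP.
rewrite -h -cintegralZ// -cintegralD//; last exact: cintZ.
by apply: eq_cintegral => t _; congr (_ + _); exact: mulrCA.
Qed.

Lemma invLap_deriv n f x : hardy n.+1 f -> is_cderive (invLap f) x (invLap (fun z => z * f z) x).
Proof.
move=> Hf; have Hzf := hardy_mulz Hf.
have [M M0 h] := bdry_line (hardy_rapid Hzf) (hardy_bcont Hzf).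
have E : invLap f = (fun x => (2 * pi)^-1%:C *
  cintegral setT (fun t : TR => f (pt 0 t) * cis (t * x))) by [].
rewrite E; apply: is_cderiveZ.
have -> : cintegral setT (fun t : TR => pt 0 t * f (pt 0 t) * cis (t * x)) =
  cintegral setT (fun t : TR => 'i * t%:C * f (pt 0 t) * cis (t * x)).
  by apply: eq_cintegral => t _; rewrite pt0 stari.
have xI : x \in `](x - 1), (x + 1)[ by rewrite in_itv/=; apply/andP; split; lra.
apply: (@cdiff_under R setT (fun x t => f (pt 0 t) * cis (t * x))
  (fun x t => 'i * t%:C * f (pt 0 t) * cis (t * x)) _ x _ _ measurableT xI _ _
  (rintZ M measurableT (rint_cauchy R))).
- move=> y _; apply: (cint_dom measurableT _ (cint_nrm measurableT (bdry_cint Hf))).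
    apply: cmeasM; first exact: bdry_meas Hf.
    by apply: cmeas_cis; apply: rmeasM; [exact: measurable_id|exact: rmeas_cst].
  by move=> t _; rewrite nrmM nrm_cis mulr1.
- move=> y t _ _.
  have d : is_cderive (fun y => 'i * (t * y)%:C : CR) y ('i * t%:C).
    apply: is_cderiveZ; apply: is_cderive_real.
    by have := is_derive_affine 0 t y; under eq_fun do rewrite add0r.
  apply: is_cderive_eq (is_cderiveZ (f (pt 0 t)) (is_cderive_cexp d)) _.
  by rewrite /cis; ring.
- move=> y t _ _; rewrite nrmM nrm_cis mulr1 -stari -pt0; exact: h.
Qed.

Lemma invLap_bound f : rapid f -> bcont f -> (exists n, hardy n.+1 f) ->
  exists2 M : R, 0 <= M & forall x, nrm (invLap f x) <= M.
Proof.
move=> rf bf [n Hf]; have [M M0 h] := bdry_line rf bf.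
pose I := \int[mu]_(t in setT) (M * (1 + t ^+ 2)^-1).
have I0 : 0 <= I.
  by apply: Rintegral_ge0 => t _; rewrite mulr_ge0// invr_ge0 addr_ge0// sqr_ge0.
exists (nrm (2 * pi)^-1%:C * (2 * I)); first by rewrite mulr_ge0 ?nrm_ge0 ?mulr_ge0.
move=> x; rewrite nrmM ler_wpM2l ?nrm_ge0//.
have hb t : nrm (f (pt 0 t) * cis (t * x)) <= M * (1 + t ^+ 2)^-1.
  by rewrite nrmM nrm_cis mulr1.
apply: nrm_cintegral => //; last exact: rintZ (rint_cauchy R).
apply: cint_dom measurableT _ (rintZ M measurableT (rint_cauchy R)) _ => //.
apply: cmeasM; first exact: bdry_meas Hf.
by apply: cmeas_cis; apply: rmeasM; [exact: measurable_id|exact: rmeas_cst].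
Qed.

End HardyClass.

(** * Functions flat at both ends of the half-line *)
Section SchwartzHalfLine.
Variable R : realType.
Local Notation CR := (R[i]^o).
Local Notation Re := (@complex.Re R).
Implicit Types (f g : CR -> CR) (phi psi : R -> CR) (z w a b : CR) (s t x : R).

(** As r ranges over all reals, this is rapid decay at infinity together with
    vanishing to infinite order at 0. *)
Definition flat phi := forall r : R, exists M : R, forall x, 0 < x ->
  nrm (phi x) <= M * x `^ r.

Fixpoint schwartz n phi := flat phi /\
  if n is m.+1 then exists phi', (forall x, 0 < x -> is_cderive phi x (phi' x)) /\
    schwartz m phi' else True.

Lemma schwartz_flat n phi : schwartz n phi -> flat phi. Proof. by case: n => [|n] []. Qed.

Lemma flat_ge0 phi (r : R) : flat phi -> exists2 M : R, 0 <= M &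
  forall x, 0 < x -> nrm (phi x) <= M * x `^ r.
Proof.
move=> /(_ r)[M h]; exists M => //.
by have := le_trans (nrm_ge0 _) (h 1 ltr01); rewrite powR1 mulr1.
Qed.

Lemma flat_nat phi : (forall n : nat, exists M : R, forall x, 0 < x ->
    nrm (phi x) <= M * x ^+ n) ->
  (forall n : nat, exists M : R, forall x, 0 < x -> nrm (phi x) <= M * x ^- n) ->
  flat phi.
Proof.
move=> hp hn r; have [n rn] : exists n : nat, `|r| <= n%:R.
  by exists (Num.truncn `|r|).+1; rewrite ltW// truncnS_gt.
have [M hM] := hp n; have [M' hM'] := hn n.
have M0 : 0 <= M by have := le_trans (nrm_ge0 _) (hM 1 ltr01); rewrite expr1n mulr1.
have M'0 : 0 <= M' by have := le_trans (nrm_ge0 _) (hM' 1 ltr01); rewrite expr1n invr1 mulr1.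
have [rn1 rn2] : r <= n%:R /\ - n%:R <= r.
  by move: rn; rewrite ler_norml => /andP[].
exists (M + M') => x x0; rewrite mulrDl; have [x1|x1] := leP x 1.
  apply: le_trans (hM x x0) _; rewrite ler_wpDr ?mulr_ge0 ?powR_ge0//.
  rewrite ler_wpM2l// -(powR_mulrn n (ltW x0)).
  have x01 : 0 < x <= 1 by rewrite x0.
  exact: (ger_powR x01 rn1).
apply: le_trans (hM' x x0) _; rewrite ler_wpDl ?mulr_ge0 ?powR_ge0//.
rewrite ler_wpM2l// -(powR_invn n (ltW x0)).
exact: (ler_powR (ltW x1) rn2).
Qed.

(** Each application of x [invLap f] = - [invLap f'] gains one power of x. *)
Lemma invLap_decay m f : hardy m.+3 f -> exists M : R, forall x, 0 < x ->
  nrm (invLap f x) <= M * x ^- m.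
Proof.
elim: m f => [|m IH] f Hf.
  have [M _ h] := invLap_bound (hardy_rapid Hf) (hardy_bcont Hf) (ex_intro (fun n => hardy n.+1 f) 2%N Hf).
  by exists M => x _; rewrite invr1 mulr1.
have [rf [bf [f' [hf Hf']]]] := Hf; have [M h] := IH f' Hf'.
have [rf' [bf' [f'' [hf' Hf'']]]] := Hf'; have [rf'' [bf'' [f3 [hf'' _]]]] := Hf''.
exists M => x x0; have := invLap_mulx x rf rf' rf'' bf bf' hf hf' hf''.
move=> /(congr1 (@nrm R)); rewrite nrmM nrmN nrm_real gtr0_norm// => E.
have -> : nrm (invLap f x) = nrm (invLap f' x) / x.
  by rewrite -E mulrC mulKf// gt_eqF.
by rewrite exprSr invfM mulrA ler_pM2r ?invr_gt0// h.
Qed.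

(** [invLap f] vanishes at 0 and its derivative is [invLap (z f)], so the mean
    value inequality gains one power of x at each step. *)
Lemma invLap_at0 m f : hardy 3 f -> exists M : R, forall x, 0 < x ->
  nrm (invLap f x) <= M * x ^+ m.
Proof.
elim: m f => [|m IH] f Hf.
  have [M _ h] := invLap_bound (hardy_rapid Hf) (hardy_bcont Hf) (ex_intro (fun n => hardy n.+1 f) 2%N Hf).
  by exists M => x _; rewrite mulr1.
have Hz := hardy_mulz Hf; have [M h] := IH _ Hz.
have vanish g : hardy 3 g -> invLap g 0 = 0.
  move=> [rg [bg [g' [hg [rg' [bg' [g'' [hg' _]]]]]]]].
  exact: (invLap_le0 rg rg' bg hg hg').
have M0 : 0 <= M by have := le_trans (nrm_ge0 _) (h 1 ltr01); rewrite expr1n mulr1.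
exists (2 * M) => x x0.
rewrite -[invLap f x]subr0 -(vanish f Hf).
have := @cMVT_bound R (invLap f) (invLap (fun z => z * f z)) 0 x (M * x ^+ m) (ltW x0)
  (fun y _ => invLap_deriv y Hf).
rewrite subr0 exprSr !mulrA; apply => y; rewrite in_itv/= => /andP[+ yx].
rewrite le_eqVlt => /predU1P[<-|y0].
  by rewrite (vanish _ Hz) nrm0 mulr_ge0// exprn_ge0// ltW.
apply: le_trans (h y y0) _; rewrite ler_wpM2l//.
by rewrite lerXn2r ?nnegrE// ltW// (lt_le_trans y0).
Qed.

Lemma invLap_schwartz n f : (forall k, hardy k f) -> schwartz n (invLap f).
Proof.
elim: n f => [|n IH] f Hf /=; (split; first by
  apply: flat_nat => m; [exact: invLap_at0|exact: invLap_decay]) => //.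
exists (invLap (fun z => z * f z)); split; first by move=> x _; exact: invLap_deriv (Hf 1).
by apply: IH => k; exact: hardy_mulz.
Qed.

Lemma schwartz_mono n phi : schwartz n.+1 phi -> schwartz n phi.
Proof.
elim: n phi => [|n IH] phi /= [fp [p' [dp Sp']]]; split=> //.
by exists p'; split => //; exact: IH.
Qed.

Lemma flatD phi psi : flat phi -> flat psi -> flat (fun x => phi x + psi x).
Proof.
move=> hp hq r; have [M h] := hp r; have [M' h'] := hq r; exists (M + M') => x x0.
by rewrite mulrDl (le_trans (nrmD _ _))// lerD ?h ?h'.
Qed.

Lemma schwartzD n phi psi : schwartz n phi -> schwartz n psi -> schwartz n (fun x => phi x + psi x).
Proof.
elim: n phi psi => [|n IH] phi psi /= [fp Hp] [fq Hq];
  (split; first exact: flatD) => //.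
have [[p' [dp Sp]] [q' [dq Sq]]] := (Hp, Hq).
exists (fun x => p' x + q' x); split; last exact: IH.
by move=> x x0; apply: is_cderiveD; [exact: dp|exact: dq].
Qed.

Lemma flat_cpow a phi : flat phi -> flat (fun x => cpow x%:C a * phi x).
Proof.
move=> hp r; have [M h] := hp (r - Re a); exists M => x x0.
rewrite nrmM nrm_cpow_real//.
apply: le_trans (ler_wpM2l (powR_ge0 _ _) (h x x0)) _.
rewrite mulrCA -powRD; last by rewrite (gt_eqF x0) implybT.
by rewrite addrC subrK.
Qed.

Lemma flatZ a phi : flat phi -> flat (fun x => a * phi x).
Proof.
move=> hp r; have [M h] := hp r; exists (nrm a * M) => x x0.
by rewrite nrmM -mulrA ler_wpM2l ?nrm_ge0// h.
Qed.

Lemma schwartzZ n a phi : schwartz n phi -> schwartz n (fun x => a * phi x).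
Proof.
elim: n phi => [|n IH] phi /= [fp Hp]; (split; first exact: flatZ) => //.
have [p' [dp Sp]] := Hp; exists (fun x => a * p' x); split; last exact: IH.
by move=> x x0; apply: is_cderiveZ; exact: dp.
Qed.

Lemma eq_schwartz n phi psi : (forall x, 0 < x -> phi x = psi x) -> schwartz n phi -> schwartz n psi.
Proof.
move=> e; case: n => [|n] /= [fp Hp]; split => //.
- by move=> r; have [M h] := fp r; exists M => x x0; rewrite -e// h.
- by move=> r; have [M h] := fp r; exists M => x x0; rewrite -e// h.
have [p' [dp Sp]] := Hp; exists p'; split=> // x x0.
apply: is_cderive_near (dp x x0).
by near=> y; apply: e; near: y; exact: lt_nbhsr.
Unshelve. all: by end_near. Qed.

(** By uniqueness of derivatives, a single function serves all orders n. *)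
Lemma schwartz_deriv phi : (forall n, schwartz n phi) -> exists phi',
  (forall x, 0 < x -> is_cderive phi x (phi' x)) /\ forall n, schwartz n phi'.
Proof.
move=> Sp; have [_ [p' [dp _]]] := Sp 1%N; exists p'; split => // n.
have [_ [q' [dq Sq]]] := Sp n.+1.
apply: eq_schwartz Sq => x x0.
have [[_ r1] [_ i1]] := dp x x0; have [[_ r2] [_ i2]] := dq x x0.
by apply: complex_ext; rewrite -?r1 -?r2 -?i1 -?i2.
Qed.

(** Multiplication by a power of x shifts all exponents in the definition of
    flatness, and all of them are allowed. *)
Lemma schwartz_cpow n a phi : schwartz n phi -> schwartz n (fun x => cpow x%:C a * phi x).
Proof.
elim: n a phi => [|n IH] a phi Hp; have [fp Hp'] := Hp;
  (split; first exact: flat_cpow) => //.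
have [p' [dp Sp]] := Hp'.
exists (fun x => a * (cpow x%:C (a - 1) * phi x) + cpow x%:C a * p' x); split.
  move=> x x0; apply: is_cderive_eq (is_cderiveM (is_cderive_cpow_real a x0) (dp x x0)) _.
  by rewrite mulrA.
by apply: schwartzD; [apply: schwartzZ; apply: IH; exact: schwartz_mono | exact: IH].
Qed.

Lemma is_derive_powR (r : R) x : 0 < x -> is_derive x 1 (fun y => y `^ r) (r * x `^ (r - 1)).
Proof. by move=> x0; exact: is_derive1_powR. Qed.

(** The bound of exponent k for phi(x^r) is the bound of exponent k / r for phi;
    a negative r exchanges the roles of 0 and infinity. *)
Lemma flat_powR (r : R) phi : r != 0 -> flat phi -> flat (fun x => phi (x `^ r)).
Proof.
move=> r0 fp k; have [M h] := fp (k / r); exists M => x x0.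
apply: le_trans (h _ (powR_gt0 _ x0)) _.
by rewrite -powRrM mulrCA mulfV// mulr1.
Qed.

Lemma schwartz_powR n (r : R) phi : r != 0 -> schwartz n phi -> schwartz n (fun x => phi (x `^ r)).
Proof.
move=> r0; elim: n phi => [|n IH] phi Hp; have [fp Hp'] := Hp;
  (split; first exact: flat_powR) => //.
have [p' [dp Sp]] := Hp'.
exists (fun x => (r * x `^ (r - 1))%:C * p' (x `^ r)); split.
  move=> x x0; apply: is_cderive_comp; first exact: is_derive_powR.
  by apply: dp; exact: powR_gt0.
apply: (@eq_schwartz _ (fun x => r%:C * (cpow x%:C (r - 1)%:C * p' (x `^ r)))).
  by move=> x x0; rewrite cpow_real// mulrA -rmorphM.
exact/schwartzZ/schwartz_cpow/IH.
Qed.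

Lemma flat_dil (c : R) phi : 0 < c -> flat phi -> flat (fun x => phi (c * x)).
Proof.
move=> c0 fp k; have [M h] := fp k; exists (M * c `^ k) => x x0.
by rewrite -mulrA -(powRM k (ltW c0) (ltW x0)) h// mulr_gt0.
Qed.

Lemma schwartz_dil n (c : R) phi : 0 < c -> schwartz n phi ->
  schwartz n (fun x => phi (c * x)).
Proof.
move=> c0; elim: n phi => [|n IH] phi Hp; have [fp Hp'] := Hp;
  (split; first exact: flat_dil) => //.
have [p' [dp Sp]] := Hp'.
exists (fun x => c%:C * p' (c * x)); split; last exact/schwartzZ/IH.
move=> x x0; apply: is_cderive_comp.
  by have := is_derive_affine 0 c x; under eq_fun do rewrite add0r.
by apply: dp; rewrite mulr_gt0.
Qed.

End SchwartzHalfLine.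

(** * Cauchy's formula for the half-plane *)
Section CauchyFormula.
Variable R : realType.
Local Notation mu := (@lebesgue_measure R).
Local Notation Im := (@complex.Im R).
Local Notation TR := (measurableTypeR R).
Local Notation CR := (R[i]^o).
Local Notation Re := (@complex.Re R).
Implicit Types (f g : CR -> CR) (z w a b : CR) (s t x : R).

(** The line of integration goes from the boundary to infinity. *)
Lemma rapid_line_zero g g' g'' : rapid g -> rapid g' -> bcont g ->
  holo g g' -> holo g' g'' -> cintegral setT (fun t : TR => g (pt 0 t)) = 0.
Proof.
move=> rg rg' bg hg hg'.
have [M1 M10 h1] := rapid_shift rg; have [M2 M20 h2] := rapid_line rg'.
have [M3 M30 h3] := rapid_line rg.
have w0 (t : R) : 0 <= (1 + t ^+ 2)^-1 by rewrite invr_ge0 addr_ge0// sqr_ge0.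
have b1 s t : 0 < s -> s < 2 -> nrm (g (pt s t)) <= (M3 + M2) * (1 + t ^+ 2)^-1.
  by move=> s0 _; apply: (le_trans (h3 s t s0)); rewrite ler_wpM2r// lerDl.
have b2 s t : 0 < s -> s < 2 -> nrm (g' (pt s t)) <= (M3 + M2) * (1 + t ^+ 2)^-1.
  by move=> s0 _; apply: (le_trans (h2 s t s0)); rewrite ler_wpM2r// lerDr.
have l2 : 1 < 2 :> R by rewrite ltr1n.
rewrite (@shift_bdry R g g' g'' (M3 + M2) 2 hg hg' b1 b2 1 ltr01 l2 bg).
apply: (@shift_zero R g g' g'' (M1 + M2) hg hg') => //.
- move=> s t s0; apply: (le_trans (h1 s t s0)); rewrite ler_wpM2r// ler_wpM2r ?lerDl//.
  by rewrite invr_ge0; lra.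
- by move=> s t s0; apply: (le_trans (h2 s t s0)); rewrite ler_wpM2r// lerDr.
Qed.

Lemma rapid_bnd f (k : CR -> CR) (K : R) : rapid f ->
  (forall z, 0 < Re z -> nrm (k z) <= K) -> rapid (fun z => f z * k z).
Proof.
move=> rf hk N; have [M M0 h] := rapid_ge0 N rf; exists (M * K) => z z0.
rewrite nrmM mulrAC ler_pM ?nrm_ge0 ?h ?hk//.
Qed.

Section Kernel.
Variable c : CR.
Hypothesis c0 : 0 < Re c.
Definition cauchyk w : CR := (w + c)^-1.

Lemma Re_gt0_shift w : 0 <= Re w -> 0 < Re (w + c).
Proof. by move=> w0; rewrite ReD ltr_wpDl. Qed.

Lemma cauchyk_bnd w : 0 <= Re w -> nrm (cauchyk w) <= (Re c)^-1.
Proof.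
move=> w0; have h := Re_gt0_shift w0; rewrite /cauchyk nrmV lef_pV2 ?posrE//.
  by rewrite (le_trans _ (nrm_Re _))// gtr0_norm// ReD lerDr.
by rewrite nrm_gt0 nrm_Re_gt0.
Qed.

Lemma holo_cauchyk : holo cauchyk (fun w => - (cauchyk w * cauchyk w)).
Proof.
apply: (@holo_eq R _ (fun w => - ((1 + 0) / (w + c) ^+ 2))).
  apply: (@holoV R (fun w => w + c) (fun=> 1 + 0)).
    exact: holoD (@holo_id R) (holo_cst c).
  by move=> z z0; apply/nrm_Re_gt0/Re_gt0_shift/ltW.
by move=> z z0; rewrite addr0 mul1r expr2 invfM.
Qed.

Lemma holo_cauchyk2 : holo (fun w => - (cauchyk w * cauchyk w)) (fun w => 2 * (cauchyk w * cauchyk w * cauchyk w)).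
Proof.
move=> a b s s0; have hk := holo_cauchyk s0.
by apply: is_cderive_eq (is_cderiveN (is_cderiveM hk hk)) _; ring.
Qed.

Lemma cauchyk_cont t : {for t, continuous (fun t : R => cauchyk (pt 0 t))}.
Proof.
have E y : pt 0 y + c = (pt 0 0 + c) + y%:C * 'i by rewrite /pt rmorph0; ring.
have -> : (fun t => cauchyk (pt 0 t)) = (fun y => ((pt 0 0 + c) + y%:C * 'i)^-1).
  by apply/funext => y; rewrite /cauchyk E.
apply: is_cderive_continuous; apply: (is_cderiveV (is_cderive_affine _ _ _)).
by rewrite -E; apply/nrm_Re_gt0/Re_gt0_shift; rewrite Re_pt.
Qed.

Lemma bcont_cauchyk : bcont cauchyk.
Proof.
move=> t; apply: cvgV.
  by apply/nrm_Re_gt0/Re_gt0_shift; rewrite Re_pt.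
by apply: cvgD; [exact: cvg_pt0|exact: cvg_cst].
Qed.

(** The pole -c of the kernel lies in the left half-plane, so that the integrand
    is holomorphic in the right one. *)
Lemma line_zero_cauchyk f f' f'' : rapid f -> rapid f' -> bcont f ->
  holo f f' -> holo f' f'' ->
  cintegral setT (fun t : TR => f (pt 0 t) * cauchyk (pt 0 t)) = 0.
Proof.
move=> rf rf' bf hf hf'.
have kb z : 0 < Re z -> nrm (cauchyk z) <= (Re c)^-1 by move=> /ltW; exact: cauchyk_bnd.
have kb' z : 0 < Re z -> nrm (- (cauchyk z * cauchyk z)) <= (Re c)^-1 * (Re c)^-1.
  by move=> z0; rewrite nrmN nrmM ler_pM ?nrm_ge0 ?kb.
have h1 := holoM hf holo_cauchyk.
have [g'' h2] : exists g'', holo (fun z => f' z * cauchyk z + f z * - (cauchyk z * cauchyk z)) g''.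
  eexists; apply: holoD; first exact: holoM hf' holo_cauchyk.
  exact: holoM hf holo_cauchyk2.
apply: (@rapid_line_zero (fun z => f z * cauchyk z) _ _ _ _ _ h1 h2).
- exact: rapid_bnd rf kb.
- by apply: rapidD; [exact: rapid_bnd rf' kb|exact: rapid_bnd rf kb'].
- exact: bcontM bf bcont_cauchyk.
Qed.
End Kernel.

Lemma holo_lip f f' (M : R) a b : holo f f' ->
  (forall z, 0 < Re z -> nrm (f' z) <= M) -> 0 < Re a -> 0 < Re b ->
  nrm (f a - f b) <= 2 * (M * nrm (a - b)).
Proof.
move=> hf f'M a0 b0.
have seg y : y \in `[0, 1] -> 0 < Re (b + y%:C * (a - b)).
  rewrite in_itv/= ReD ReZ ReD ReN => /andP[y0 y1].
  have [y1'|y1'] := ltP y 1.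
    have := mulr_ge0 y0 (ltW a0); have : 0 < (1 - y) * Re b by rewrite mulr_gt0// subr_gt0.
    by lra.
  have -> : y = 1 by apply/le_anti; rewrite y1 y1'.
  by lra.
have := @cMVT_bound R (fun y => f (b + y%:C * (a - b)))
  (fun y => (a - b) * f' (b + y%:C * (a - b))) 0 1 (M * nrm (a - b)) ler01.
rewrite subr0 mulr1 rmorph1 rmorph0 mul1r mul0r addr0 addrCA subrr addr0.
apply.
  by move=> y yI; apply: hf; exact: seg.
by move=> y yI; rewrite nrmM [leLHS]mulrC ler_wpM2r ?nrm_ge0// f'M// seg.
Qed.

(** A bounded derivative makes f Lipschitz, so that its boundary values are
    limits along arbitrary sequences and not only along horizontal ones. *)
Lemma cvg_bdry f f' (M : R) (u : nat -> CR) t : holo f f' ->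
  (forall z, 0 < Re z -> nrm (f' z) <= M) -> bcont f ->
  (forall n, 0 < Re (u n)) -> u n @[n --> \oo] --> pt 0 t ->
  f (u n) @[n --> \oo] --> f (pt 0 t).
Proof.
move=> hf f'M bf u0 ut.
have M0 : 0 <= M by exact: le_trans (nrm_ge0 _) (f'M 1 ltr01).
have d : nrm (u n - pt n.+1%:R^-1 t) @[n --> \oo] --> (0 : R).
  rewrite -(nrm0 R) -(subrr (pt 0 t)).
  have b : u n - pt n.+1%:R^-1 t @[n --> \oo] --> pt 0 t - pt 0 t.
    exact: cvgB ut (@cvg_pt0 R t).
  exact: cvg_nrm b.
have e : (f (u n) - f (pt n.+1%:R^-1 t)) @[n --> \oo] --> (0 : CR).
  apply/cvg_nrmP => eps eps0.
  have M1 : 0 < 2 * (M + 1) by lra.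
  have /cvgrPdist_lt/(_ _ (divr_gt0 eps0 M1)) := d.
  apply: filterS => n; rewrite sub0r normrN ger0_norm ?nrm_ge0// ltr_pdivlMr// => h.
  rewrite sub0r nrmN; apply: le_lt_trans h.
  apply: le_trans (holo_lip hf f'M (u0 n) _) _; first by rewrite Re_pt invr_gt0.
  by have := nrm_ge0 (u n - pt n.+1%:R^-1 t); nra.
rewrite -[f (pt 0 t)]add0r.
have -> : (fun n => f (u n)) =
    (fun n => (f (u n) - f (pt n.+1%:R^-1 t)) + f (pt n.+1%:R^-1 t)).
  by apply/funext => n; rewrite subrK.
exact: cvgD e (bf t).
Qed.

(* Write z = p + iq, so that c = conj z.  On the imaginary axis
   1 / (z - it) = P(t) - 1 / (it + c), where P is the Poisson kernel (up to the
   factor 2 pi) and the last term is [cauchyk c].  The second term does not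
   contribute.  For the first, zeta moves it to z along a segment, and
   H(l) = int f(zeta l (it)) P(t) dt has H(0) = 2 pi f(z), while H(1) is the
   integral sought. *)
Section CauchyAtPoint.
Variables (f f' f'' f3 : CR -> CR) (z : CR).
Hypotheses (z0 : 0 < Re z) (rf : rapid f) (rf' : rapid f') (rf'' : rapid f'').
Hypotheses (bf : bcont f) (bf' : bcont f').
Hypotheses (hf : holo f f') (hf' : holo f' f'') (hf'' : holo f'' f3).
Hypothesis mf : cmeas setT (fun t : TR => f (pt 0 t)).

Let p := Re z.
Let q := Im z.
Let c : CR := pt p (- q).
Let zeta (l : R) w : CR := z + l%:C * (w - z).
Let P t : R := 2 * p / (p ^+ 2 + (t - q) ^+ 2).

Let c0 : 0 < Re c. Proof. by rewrite Re_pt. Qed.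

Let den_gt0 t : 0 < p ^+ 2 + (t - q) ^+ 2.
Proof. by rewrite ltr_pwDl ?exprn_gt0// sqr_ge0. Qed.

Let PE t : (P t)%:C = (2 * p)%:C / (z - pt 0 t) * cauchyk c (pt 0 t).
Proof.
rewrite /P /cauchyk -[RHS]mulrA -[X in _ = _ * X]invfM rmorphM fmorphV; congr (_ / _).
apply: complex_ext.
  by rewrite ReM !ReD !ImD !ReN !ImN !Re_pt !Im_pt /= /p /q; ring.
by rewrite ImM !ReD !ImD !ReN !ImN !Re_pt !Im_pt /= /p /q; ring.
Qed.

Let zpt t : z - pt 0 t != 0.
Proof. by apply: nrm_Re_gt0; rewrite ReD ReN Re_pt subr0. Qed.

Let cpt t : pt 0 t + c != 0.
Proof. by apply: nrm_Re_gt0; rewrite ReD Re_pt add0r. Qed.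

Let split_kernel t : (z - pt 0 t)^-1 = (P t)%:C - cauchyk c (pt 0 t).
Proof.
rewrite PE /cauchyk.
have -> : (2 * p)%:C = (z - pt 0 t) + (pt 0 t + c) :> CR.
  by apply: complex_ext; rewrite ?(ReD, ImD, ReN, ImN, Re_pt, Im_pt) /= /p /q; ring.
by field; rewrite zpt cpt.
Qed.

Let P_int : rint setT P /\ \int[mu]_(t in setT) P t = 2 * pi.
Proof.
have cP (t : R) : {for t, continuous P}.
  have d : is_derive t 1 (fun y : R => y - q) 1.
    have := is_derive_affine (- q) 1 t; under eq_fun do rewrite mul1r addrC; by [].
  have h1 := is_deriveM d d.
  have h2 : is_derive t 1 (fun y : R => p ^+ 2 + (y - q) * (y - q)) _ :=
    is_deriveD (is_derive_cst (p ^+ 2) t 1) h1.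
  have h3 : p ^+ 2 + (t - q) * (t - q) != 0 by rewrite -expr2 lt0r_neq0.
  have [h4 _] := is_deriveM (is_derive_cst (2 * p) t 1) (@is_deriveV R _ t _ _ h3 h2).
  have EP : P = cst (2 * p) * (fun y : R => (p ^+ 2 + (y - q) * (y - q))^-1).
    by apply/funext => y; rewrite /P [(y - q) ^+ 2]expr2.
  rewrite EP; exact: (differentiable_continuous (iffLR (derivable1_diffP _ _) h4)).
have dP (t : R) : is_derive t 1 (fun t => 2 * atan ((t - q) / p)) (P t).
  have d : is_derive t 1 (fun y : R => (y - q) / p) p^-1.
    have := is_derive_affine (- q / p) p^-1 t.
    by rewrite (_ : (fun _ => _) = (fun y => (y - q) / p))// ; apply/funext => y; ring.
  have h := @is_derive1_comp R (@atan R) _ t _ _ (is_derive1_atan _) d.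
  have h2 := is_deriveZ 2 h.
  apply: is_derive_eq h2 _; rewrite /GRing.scale/= /P.
  have D := den_gt0 t; have p0 : 0 < p by [].
  have D2 : 1 + ((t - q) / p) ^+ 2 = (p ^+ 2 + (t - q) ^+ 2) / p ^+ 2.
    by field; rewrite gt_eqF.
  by rewrite D2; field; rewrite !lt0r_neq0.
have iP : rint setT P.
  apply: (@rint_exhaust R _ _ _ _ (fun t : R => 2 * atan ((t - q) / p)) (2 * pi) measurableT (exhausts_T R)) => //.
  - by apply: measurable_continuous_open openT _ => t _; exact: cP.
  - by move=> t _; rewrite /P divr_ge0 ?mulr_ge0 ?ltW.
  - move=> n; have := atan_ltpi2 ((n.+1%:R - q) / p); have := atan_gtNpi2 ((- n.+1%:R - q) / p); lra.
split => //.
apply: (@integral_exhaust R _ _ _ P (fun t : R => 2 * atan ((t - q) / p)) _ measurableT (exhausts_T R)) => //.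
have lim1 (k : R) : atan ((n.+1%:R - k) / p) @[n --> \oo] --> pi / 2.
  apply: (@cvg_comp _ _ _ (fun n : nat => (n.+1%:R - k) / p) (@atan R) _ (+oo%R)); last exact: cvgy_atan.
  apply/cvgryPge => A.
  apply: filterS (near_nat_ge (A * p + k)) => n h.
  by rewrite ler_pdivlMr//; lra.
have -> : (fun n : nat => 2 * atan ((n.+1%:R - q) / p) - 2 * atan ((- n.+1%:R - q) / p)) =
   (fun n : nat => 2 * atan ((n.+1%:R - q) / p) + 2 * atan ((n.+1%:R - (- q)) / p)).
  apply/funext => n; rewrite -mulrN -atanN; congr (_ + 2 * atan _); ring.
have -> : 2 * pi = 2 * (pi / 2) + 2 * (pi / 2) :> R by field.
by apply: cvgD; apply: cvgMr; exact: lim1.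
Qed.

Let zetaRe l t : Re (zeta l (pt 0 t)) = (1 - l) * p.
Proof. rewrite ReD ReZ ReD ReN Re_pt -/p; ring. Qed.

Let f'bnd : exists2 M, 0 <= M & forall w, 0 < Re w -> nrm (f' w) <= M.
Proof.
have [M M0 h] := rapid_ge0 0 rf'; exists M => // w /h.
by rewrite expr0 invr1 mulr1.
Qed.

Let fbnd : exists2 M, 0 <= M & forall w, 0 < Re w -> nrm (f w) <= M.
Proof.
have [M M0 h] := rapid_ge0 0 rf; exists M => // w /h.
by rewrite expr0 invr1 mulr1.
Qed.

(** Decay of f in zeta l w is decay in w, uniformly for l >= d > 0. *)
Let zeta_weight d l w : 0 < d -> d <= l -> l <= 1 ->
  1 + nrm w <= (1 + (1 + nrm z) / d) * (1 + nrm (zeta l w)).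
Proof.
move=> d0 dl l1.
have l0 : 0 < l by exact: lt_le_trans dl.
have h : l * nrm w <= nrm (zeta l w) + nrm z.
  have e : l%:C * w = zeta l w - (1 - l)%:C * z.
    by rewrite /zeta rmorphB rmorph1; ring.
  have : nrm (l%:C * w) <= nrm (zeta l w) + nrm ((1 - l)%:C * z) by rewrite e nrmB.
  rewrite !nrmM !nrm_real gtr0_norm// ger0_norm ?subr_ge0//.
  by have := nrm_ge0 z; nra.
have w1 : nrm w <= (nrm (zeta l w) + nrm z) / d.
  rewrite ler_pdivlMr//; apply: le_trans h; rewrite mulrC ler_wpM2r ?nrm_ge0//.
rewrite mulrDl mul1r lerD ?lerDl ?nrm_ge0//; apply: (le_trans w1).
rewrite mulrAC ler_wpM2r ?invr_ge0 ?ltW//.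
by have := nrm_ge0 z; have := nrm_ge0 (zeta l w); nra.
Qed.

Let rapid_zeta g l : rapid g -> 0 < l -> l < 1 -> rapid (fun w => g (zeta l w)).
Proof.
move=> rg l0 l1 N; have [M M0 h] := rapid_ge0 N rg.
set K := 1 + (1 + nrm z) / l.
have K0 : 0 <= K by rewrite addr_ge0// divr_ge0 ?addr_ge0 ?nrm_ge0// ltW.
exists (M * K ^+ N) => w w0.
have zw : 0 < Re (zeta l w).
  have -> : Re (zeta l w) = (1 - l) * p + l * Re w.
    by rewrite ReD ReZ ReD ReN -/p; ring.
  by rewrite addr_gt0// mulr_gt0// subr_gt0.
apply: (le_trans (h _ zw)); rewrite -mulrA ler_wpM2l//.
have n1 := one_nrm_gt0 w; have n2 := one_nrm_gt0 (zeta l w).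
rewrite ler_pdivlMr ?exprn_gt0// mulrC ler_pdivrMr ?exprn_gt0// -exprMn.
rewrite lerXn2r ?nnegrE ?mulr_ge0 ?(ltW n1) ?(ltW n2)//.
by apply: zeta_weight => //; exact: ltW.
Qed.

Let holo_zeta g g' l : holo g g' -> 0 < l -> l < 1 ->
  holo (fun w => g (zeta l w)) (fun w => l%:C * g' (zeta l w)).
Proof.
move=> hg l0 l1.
have -> : zeta l = (fun w => (1 - l)%:C * z + l%:C * w).
  by apply/funext => w; rewrite /zeta rmorphB rmorph1; ring.
apply: holo_affine hg => w w0.
by rewrite ReD !ReZ addr_gt0// mulr_gt0// subr_gt0.
Qed.

Let bcont_zeta g g' l : holo g g' -> 0 < l -> l < 1 -> bcont (fun w => g (zeta l w)).
Proof.
move=> hg l0 l1 t.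
have hl : {for 0, continuous (fun y : R => g (zeta l (pt 0 t) + y%:C * l%:C))}.
  apply: is_cderive_continuous; apply: hg.
  by rewrite mul0r addr0 zetaRe mulr_gt0// subr_gt0.
have : (fun y : R => g (zeta l (pt 0 t) + y%:C * l%:C)) n.+1%:R^-1 @[n --> \oo] -->
   g (zeta l (pt 0 t) + 0%:C * l%:C).
  apply: (@cvg_comp _ _ _ (fun n : nat => (n.+1%:R^-1 : R))
    (fun y : R => g (zeta l (pt 0 t) + y%:C * l%:C)) _ (nbhs (0 : R))) => //.
  exact: cvg_harmonic.
rewrite mul0r addr0.
rewrite (_ : (fun _ => _) = (fun n : nat => g (zeta l (pt n.+1%:R^-1 t))))//.
by apply/funext => n; congr g; rewrite /zeta /pt rmorph0; ring.
Qed.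

Let zeta_cont g g' l t : holo g g' -> l < 1 ->
  {for t, continuous (fun t : R => g (zeta l (pt 0 t)))}.
Proof.
move=> hg l1.
have E y : zeta l (pt 0 y) = ((1 - l)%:C * z) + y%:C * (l%:C * 'i).
  by rewrite /zeta /pt rmorphB rmorph1 rmorph0; ring.
have -> : (fun t => g (zeta l (pt 0 t))) =
    (fun y => g ((1 - l)%:C * z + y%:C * (l%:C * 'i))).
  by apply/funext => y; rewrite E.
apply: is_cderive_continuous; apply: hg.
by rewrite -E zetaRe mulr_gt0// subr_gt0.
Qed.

Let H l := cintegral setT (fun t : TR => f (zeta l (pt 0 t)) * (P t)%:C).

Let H_meas l : 0 <= l -> l < 1 -> cmeas setT (fun t : TR => f (zeta l (pt 0 t)) * (P t)%:C).
Proof.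
move=> l0 l1; apply: cmeasM.
  by apply: cmeas_continuous openT _ => t _; exact: zeta_cont hf l1.
by apply: cmeas_real; exact: rint_meas P_int.1.
Qed.

Let P_ge0 t : 0 <= P t.
Proof. by rewrite /P divr_ge0 ?mulr_ge0 ?ltW. Qed.

Let H_bnd (M : R) l t : (forall w, 0 < Re w -> nrm (f w) <= M) -> 0 <= l -> l < 1 ->
  nrm (f (zeta l (pt 0 t)) * (P t)%:C) <= M * P t.
Proof.
move=> h l0 l1; rewrite nrmM nrm_real ger0_norm// ler_wpM2r// h//.
by rewrite zetaRe mulr_gt0// subr_gt0.
Qed.

Let H_cvg (u : nat -> R) l : (forall n, 0 <= u n) -> (forall n, u n < 1) ->
  (forall t : R, f (zeta (u n) (pt 0 t)) @[n --> \oo] --> f (zeta l (pt 0 t))) ->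
  H (u n) @[n --> \oo] --> H l.
Proof.
move=> u0 u1 fu; have [M M0 h] := fbnd.
have [] // := @cdom_cvg R setT (fun n t => f (zeta (u n) (pt 0 t)) * (P t)%:C)
  (fun t => f (zeta l (pt 0 t)) * (P t)%:C) (fun t => M * P t) measurableT.
- by move=> n; exact: H_meas.
- exact: rintZ P_int.1.
- by move=> n t _; exact: H_bnd.
- by move=> t _; apply: cvgM; [exact: fu|exact: cvg_cst].
Qed.

(** In H'(l) the factor it - z coming from the chain rule cancels against the
    factor z - it of the Poisson kernel, and what is left is the integral of
    f'(zeta l (it)) / (it + c), which vanishes by holomorphy. *)
Let H_deriv l : 0 < l -> l < 1 -> is_cderive H l 0.
Proof.
move=> l0 l1; have [M M0 h] := fbnd.
have [M' M'0 h'] := rapid_ge0 2 rf'.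
pose d := l / 2; have d0 : 0 < d by rewrite divr_gt0.
pose K := 1 + (1 + nrm z) / d.
have K0 : 0 <= K by rewrite addr_ge0// divr_ge0 ?addr_ge0 ?nrm_ge0// ltW.
have dE (t y : R) : (pt 0 t - z) * f' (zeta y (pt 0 t)) * (P t)%:C =
    (- 2 * p)%:C * (f' (zeta y (pt 0 t)) * cauchyk c (pt 0 t)).
  rewrite PE -[in LHS](opprB z) mulNr rmorphM rmorphN /= rmorphM /=.
  by field; exact: zpt.
have Z : cintegral setT (fun t : TR => (pt 0 t - z) * f' (zeta l (pt 0 t)) * (P t)%:C) = 0.
  under (eq_cintegral (A := setT)) => t _ do rewrite dE.
  have r1 := rapid_zeta rf' l0 l1.
  have r2 : rapid (fun w => l%:C * f'' (zeta l w)).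
    by under eq_fun do rewrite mulrC; apply: (@rapid_bnd _ (fun=> l%:C) (nrm l%:C) (rapid_zeta rf'' l0 l1)).
  have b1 := bcont_zeta hf' l0 l1.
  have h1 := holo_zeta hf' l0 l1.
  have h2 := holoM (holo_cst l%:C) (holo_zeta hf'' l0 l1).
  have lz := line_zero_cauchyk c0 r1 r2 b1 h1 h2.
  rewrite cintegralZ// ?lz ?mulr0//.
  have [M1 M10 hb] := bdry_line r1 b1.
  apply: (cint_dom measurableT _ (rintZ (M1 * (Re c)^-1) measurableT (rint_cauchy R))).
    by apply: cmeasM; apply: cmeas_continuous openT _ => t _;
      [exact: zeta_cont hf' l1 | exact: cauchyk_cont].
  move=> t _; rewrite nrmM mulrAC ler_pM ?nrm_ge0//.
  by apply: cauchyk_bnd => //; rewrite Re_pt.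
rewrite -Z.
have lI : l \in `]d, 1[ by rewrite in_itv/= l1 andbT /d; lra.
apply: (@cdiff_under R setT (fun l t => f (zeta l (pt 0 t)) * (P t)%:C)
  (fun l t => (pt 0 t - z) * f' (zeta l (pt 0 t)) * (P t)%:C)
  (fun t => 2 * p * (M' * K ^+ 2 * (Re c)^-1) * (1 + t ^+ 2)^-1) l d 1 measurableT lI).
- move=> y; rewrite in_itv/= => /andP[dy y1].
  have y0 : 0 <= y by rewrite ltW// (lt_trans d0).
  apply: (cint_dom measurableT (H_meas y0 y1) (rintZ M measurableT P_int.1)).
  by move=> t _; exact: H_bnd.
- move=> y t; rewrite in_itv/= => /andP[dy y1] _.
  apply: is_cderive_eq (is_cderiveM (hf _) (is_cderive_cst (P t)%:C y)) _.
    by rewrite -/(zeta y (pt 0 t)) zetaRe mulr_gt0// subr_gt0.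
  by rewrite mulr0 addr0.
- exact: rintZ (rint_cauchy R).
- move=> y t; rewrite in_itv/= => /andP[dy y1] _.
  have zy : 0 < Re (zeta y (pt 0 t)) by rewrite zetaRe mulr_gt0// subr_gt0.
  rewrite dE nrmM nrm_real mulNr normrN ger0_norm; last by rewrite mulr_ge0// ltW.
  rewrite -[leRHS]mulrA ler_wpM2l//; first by rewrite mulr_ge0// ltW.
  rewrite nrmM mulrAC ler_pM ?nrm_ge0//; last by apply: cauchyk_bnd => //; rewrite Re_pt.
  apply: (le_trans (h' _ zy)); rewrite -mulrA ler_wpM2l//.
  have w := zeta_weight (pt 0 t) d0 (ltW dy) (ltW y1); rewrite -/K in w.
  have v := weight2 (pt 0 t); rewrite Im_pt in v.
  apply: le_trans (ler_wpM2l (exprn_ge0 2 K0) v).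
  have n1 := one_nrm_gt0 (zeta y (pt 0 t)); have n2 := one_nrm_gt0 (pt 0 t).
  rewrite ler_pdivlMr ?exprn_gt0// mulrC ler_pdivrMr ?exprn_gt0// -exprMn.
  by rewrite lerXn2r ?nnegrE ?mulr_ge0 ?(ltW n1) ?(ltW n2).
Qed.

(** H is constant inside ]0, 1[, where the differentiation is justified, and
    continuous at both ends. *)
Let H01 : H 0 = H 1.
Proof.
have hv (n : nat) : 0 < (n.+2%:R^-1 : R) by rewrite invr_gt0.
have hv1 (n : nat) : (n.+2%:R^-1 : R) < 1 by rewrite invf_lt1// ltr1n.
have v0 : (n.+2%:R^-1 : R) @[n --> \oo] --> (0 : R).
  by have := @cvg_harmonic R; rewrite -cvg_shiftS.
have cst1 x y : 0 < x -> x < 1 -> 0 < y -> y < 1 -> H x = H y.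
  move=> x0 x1 y0 y1; apply: (@cderiv0_cst R H 0 1); rewrite ?in_itv/= ?x0 ?y0//.
  by move=> l; rewrite in_itv/= => /andP[]; exact: H_deriv.
have half0 : 0 < 2^-1 :> R by rewrite invr_gt0.
have half1 : 2^-1 < 1 :> R by rewrite invf_lt1// ltr1n.
transitivity (H 2^-1); last apply: esym.
- have a : H n.+2%:R^-1 @[n --> \oo] --> H 0.
    apply: (H_cvg (fun n => ltW (hv n)) hv1) => t.
    have hl : {for 0, continuous (fun y : R => f (z + y%:C * (pt 0 t - z)))}.
      by apply: is_cderive_continuous; apply: hf; rewrite mul0r addr0.
    exact: (@cvg_comp _ _ _ (fun n : nat => (n.+2%:R^-1 : R))
      (fun y : R => f (z + y%:C * (pt 0 t - z))) _ (nbhs (0 : R)) _ v0 hl).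
  apply: cvg_unique a _ => //.
  rewrite (_ : (fun _ => _) = (fun=> H 2^-1)); first exact: cvg_cst.
  by apply/funext => n; apply: cst1.
- have u0 (n : nat) : 0 < 1 - (n.+2%:R^-1 : R) by rewrite subr_gt0.
  have u1 (n : nat) : 1 - (n.+2%:R^-1 : R) < 1 by rewrite ltrBlDr ltrDl.
  have a : H (1 - n.+2%:R^-1) @[n --> \oo] --> H 1.
    apply: (H_cvg (fun n => ltW (u0 n)) u1) => t.
    have [M' M'0 h'] := f'bnd.
    have E1 : zeta 1 (pt 0 t) = pt 0 t by rewrite /zeta rmorph1; ring.
    rewrite E1; apply: (cvg_bdry hf h' bf).
      by move=> n; rewrite zetaRe mulr_gt0// opprB addrC subrK.
    rewrite -[X in _ --> X]E1 /zeta.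
    have w1 : (1 - n.+2%:R^-1 : R) @[n --> \oo] --> (1 : R).
      by rewrite -[X in _ --> X]subr0; exact: (cvgB (cvg_cst (1 : R)) v0).
    have hl := is_cderive_continuous (is_cderive_affine z (pt 0 t - z) 1).
    exact: (@cvg_comp _ _ _ (fun n : nat => (1 - n.+2%:R^-1 : R))
      (fun y : R => z + y%:C * (pt 0 t - z)) _ (nbhs (1 : R)) _ w1 hl).
  apply: cvg_unique a _ => //.
  rewrite (_ : (fun _ => _) = (fun=> H 2^-1)); first exact: cvg_cst.
  by apply/funext => n; apply: cst1.
Qed.

Lemma cauchy_formula :
  cintegral setT (fun t : TR => f (pt 0 t) / (z - pt 0 t)) = (2 * pi)%:C * f z.
Proof.
have [M M0 h] := bdry_line rf bf.
have dom := rintZ M measurableT (rint_cauchy R).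
have i0 : cint setT (fun t : TR => f (pt 0 t)).
  by apply: cint_dom measurableT mf dom _ => t _; exact: h.
have i1 : cint setT (fun t : TR => f (pt 0 t) * cauchyk c (pt 0 t)).
  apply: (cint_dom measurableT _ (rintZ (Re c)^-1 measurableT (cint_nrm measurableT i0))).
    by apply: cmeasM mf _; apply: cmeas_continuous openT _ => t _; exact: cauchyk_cont.
  move=> t _; rewrite nrmM mulrC ler_wpM2r ?nrm_ge0//.
  by apply: cauchyk_bnd => //; rewrite Re_pt.
have i2 : cint setT (fun t : TR => f (pt 0 t) * (P t)%:C).
  apply: (cint_dom measurableT _ (rintZ M measurableT P_int.1)).
    by apply: cmeasM mf _; apply: cmeas_real; exact: rint_meas P_int.1.
  move=> t _; rewrite nrmM nrm_real ger0_norm// ler_wpM2r//.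
  apply: (le_trans (h t)); rewrite ler_piMr// invf_le1 ?lerDl ?sqr_ge0//.
  by rewrite ltr_pwDl// sqr_ge0.
transitivity (cintegral setT (fun t : TR => f (pt 0 t) * (P t)%:C - f (pt 0 t) * cauchyk c (pt 0 t))).
  by apply: eq_cintegral => t _; rewrite split_kernel mulrBr.
rewrite cintegralB// (line_zero_cauchyk c0 rf rf' bf hf hf') subr0.
transitivity (H 1).
  by apply: eq_cintegral => t _; congr (f _ * _); rewrite /zeta rmorph1; ring.
rewrite -H01 /H.
transitivity (cintegral setT (fun t : TR => f z * (P t)%:C)).
  by apply: eq_cintegral => t _; congr (f _ * _); rewrite /zeta rmorph0; ring.
have iP : cint setT (fun t : TR => (P t)%:C : CR).
  split => /=; first exact: P_int.1.
  have := rintZ 0 measurableT P_int.1; apply: eq_rint => // x _; exact: mul0r.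
rewrite cintegralZ// mulrC; congr (_ * _).
apply: complex_ext => /=; first exact: P_int.2.
by rewrite /Rintegral integral0.
Qed.
End CauchyAtPoint.

End CauchyFormula.

(** * Euler's integral *)
Section GammaIntegral.
Variable R : realType.
Local Notation TR := (measurableTypeR R).
Local Notation CR := (R[i]^o).
Local Notation Re := (@complex.Re R).
Local Notation Rpos := (`]0, +oo[%classic : set TR).
Implicit Types (z w h a b : CR) (s t x : R).

Lemma RposP x : Rpos x -> 0 < x.
Proof. by rewrite /= in_itv/= andbT. Qed.

Lemma open_Rpos : open (`]0, +oo[%classic : set R).
Proof. exact: interval_open. Qed.

Lemma mRpos : measurable Rpos. Proof. exact: measurable_itv. Qed.

Lemma cmeas_Rpos (u : R -> CR) (du : R -> CR) :
  (forall x, 0 < x -> is_cderive u x (du x)) -> cmeas Rpos u.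
Proof.
move=> d; apply: cmeas_continuous open_Rpos _ => x /RposP x0.
exact: is_cderive_continuous (d x x0).
Qed.

Definition powexp h w x : CR := cpow x%:C h * cexp (- (w * x%:C)).

Lemma is_cderive_cexpx w x :
  is_cderive (fun x : R => cexp (- (w * x%:C))) x (- w * cexp (- (w * x%:C))).
Proof.
have d := is_cderiveN (is_cderiveZ w (is_cderive_id x)).
by apply: is_cderive_eq (is_cderive_cexp d) _; rewrite mulr1.
Qed.

Lemma is_cderive_powexp h w x : 0 < x ->
  is_cderive (powexp h w) x (h * powexp (h - 1) w x - w * powexp h w x).
Proof.
move=> x0; apply: is_cderive_eq
  (is_cderiveM (is_cderive_cpow_real h x0) (is_cderive_cexpx w x)) _.
by rewrite /powexp; ring.
Qed.

Lemma nrm_cexpx w x : nrm (cexp (- (w * x%:C))) = expR (- (Re w * x)).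
Proof. by rewrite nrm_cexp ReN mulrC ReZ mulrC. Qed.

Lemma nrm_powexp h w x : 0 < x ->
  nrm (powexp h w x) = x `^ Re h * expR (- (Re w * x)).
Proof. by move=> x0; rewrite nrmM nrm_cpow_real// nrm_cexpx. Qed.

Lemma cmeas_powexp h w : cmeas Rpos (powexp h w).
Proof. exact: cmeas_Rpos (@is_cderive_powexp h w). Qed.

Lemma cint_powexp h w : -1 < Re h -> 0 < Re w -> cint Rpos (powexp h w).
Proof.
move=> h1 w0; apply: (cint_dom mRpos (cmeas_powexp h w) (rint_gamma h1 w0)).
by move=> x /RposP x0; rewrite nrm_powexp.
Qed.

Definition Euler_integral h w : CR := cintegral Rpos (powexp h w).

Lemma cvg_inv_nat : (n.+2%:R^-1 : R) @[n --> \oo] --> (0 : R).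
Proof. by have := @cvg_harmonic R; rewrite -cvg_shiftS. Qed.

Lemma powexp_cvg0 h w : 0 < Re h -> 0 < Re w ->
  powexp h w (0 + n.+2%:R) - powexp h w (0 + n.+2%:R^-1) @[n --> \oo] --> (0 : CR).
Proof.
move=> h0 w0.
have A : powexp h w (0 + n.+2%:R^-1) @[n --> \oo] --> (0 : CR).
  have pw : (n.+2%:R^-1 : R) `^ Re h @[n --> \oo] --> (0 : R).
    have /cvg_at_rightP := powR_cvg0 h0; apply; split; last exact: cvg_inv_nat.
    by move=> n; rewrite invr_gt0.
  apply/cvg_nrmP => e e0; have /cvgrPdist_lt/(_ _ e0) := pw.
  apply: filterS => n; rewrite !sub0r normrN ger0_norm ?powR_ge0// nrmN add0r.
  apply: le_lt_trans; rewrite nrm_powexp ?invr_gt0//.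
  by rewrite ler_piMr ?powR_ge0// expR_le1 oppr_le0 mulr_ge0 ?invr_ge0// ltW.
have B : powexp h w (0 + n.+2%:R) @[n --> \oo] --> (0 : CR).
  have q0 : 0 < Re h + 1 by lra.
  have := fun x => @powR_le_expR R _ _ x w0 q0.
  set C := expR _ => hC; have C0 : 0 < C by exact: expR_gt0.
  apply/cvg_nrmP => e e0.
  apply: filterS (near_nat_ge (C / e + 1)) => n hn.
  rewrite sub0r nrmN add0r; set y : R := n.+2%:R.
  have y0 : 0 < y by [].
  have yn : C / e < y.
    have : n.+1%:R <= y by rewrite ler_nat.
    by lra.
  rewrite nrm_powexp// expRN ltr_pdivrMr ?expR_gt0//.
  have hy := hC y (ltW y0).
  have y1 : 0 < 1 + y by lra.
  have p1 : y `^ Re h <= (1 + y) `^ Re h.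
    by apply: ge0_ler_powR; rewrite ?nnegrE; lra.
  have p2 : (1 + y) `^ (Re h + 1) = (1 + y) `^ Re h * (1 + y).
    by rewrite powRD ?powRr1 ?ltW// (gt_eqF y1) implybT.
  have P0 : 0 < (1 + y) `^ Re h by exact: powR_gt0.
  rewrite p2 in hy.
  apply: (le_lt_trans p1).
  have ey : C < e * y by rewrite mulrC -ltr_pdivrMr.
  set E := expR _ in hy *.
  have h1 : (1 + y) `^ Re h * C < (1 + y) `^ Re h * (e * y) by rewrite ltr_pM2l.
  have h2 := ler_wpM2l (ltW e0) hy.
  have h3 := mulr_gt0 P0 e0.
  by rewrite -(ltr_pM2l C0); lra.
rewrite -[X in _ --> X](subrr 0).
exact: cvgB B A.
Qed.

Lemma Euler_integral_rec h w : -1 < Re h -> 0 < Re w -> w * Euler_integral (h + 1) w = (h + 1) * Euler_integral h w.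
Proof.
move=> h1 w0.
have h0 : 0 < Re (h + 1) by rewrite ReD /=; lra.
have i1 := cint_powexp h1 w0.
have i2 : cint Rpos (powexp (h + 1) w) by apply: cint_powexp => //; lra.
have D x : 0 < x -> is_cderive (powexp (h + 1) w) x
    ((h + 1) * powexp h w x - w * powexp (h + 1) w x).
  by move=> x0; have := is_cderive_powexp (h + 1) w x0; rewrite addrK.
have := @cintegral_exhaust R Rpos _ _ (fun x => (h + 1) * powexp h w x - w * powexp (h + 1) w x)
  (powexp (h + 1) w) 0 mRpos (exhausts_oy 0).
rewrite cintegralB//; [|exact: cintZ mRpos i1|exact: cintZ mRpos i2].
rewrite !cintegralZ// => H; apply/esym/eqP; rewrite -subr_eq0; apply/eqP; apply: H.
- by move=> x /RposP; exact: D.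
- move=> x /RposP x0.
  have c1 := is_cderiveZ (h + 1) (is_cderive_powexp h w x0).
  have c2 := is_cderiveZ w (is_cderive_powexp (h + 1) w x0).
  exact: is_cderive_continuous (is_cderiveB c1 c2).
- by apply: (cintB mRpos); exact: cintZ mRpos _.
- exact: powexp_cvg0.
Qed.

Lemma Euler_integral_deriv h w b s : -1 < Re h -> 0 < Re (w + s%:C * b) ->
  is_cderive (fun y => Euler_integral h (w + y%:C * b)) s (- b * Euler_integral (h + 1) (w + s%:C * b)).
Proof.
move=> h1 ws0; pose rho := Re (w + s%:C * b) / 2.
have rho0 : 0 < rho by rewrite divr_gt0.
(* Within distance d of s the real part stays above rho, half its value at s,
   so that a single exponential dominates. *)
pose d := rho / (1 + `|Re b|).
have d0 : 0 < d by rewrite divr_gt0// ltr_pwDl.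
have near_s y : y \in `](s - d), (s + d)[ -> rho < Re (w + y%:C * b).
  rewrite in_itv/= => /andP[y1 y2].
  have E : Re (w + y%:C * b) = Re (w + s%:C * b) + (y - s) * Re b.
    by rewrite !ReD !ReZ; ring.
  have y3 : `|y - s| < d by rewrite ltr_norml; apply/andP; split; lra.
  have : `|(y - s) * Re b| < rho.
    rewrite normrM; have := normr_ge0 (Re b) => b0.
    have b1 : 0 < 1 + `|Re b| by lra.
    have : d * (1 + `|Re b|) = rho by rewrite divfK// gt_eqF.
    by have := normr_ge0 (y - s); nra.
  rewrite ltr_norml => /andP[h2 _]; rewrite E.
  have : Re (w + s%:C * b) = 2 * rho by rewrite /rho; field.
  lra.
have sI : s \in `](s - d), (s + d)[ by rewrite in_itv/=; apply/andP; split; lra.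
have h2 : -1 < Re (h + 1) by rewrite ReD /=; lra.
rewrite -cintegralZ; [|exact: mRpos|exact: cint_powexp].
apply: (@cdiff_under R Rpos (fun y x => powexp h (w + y%:C * b) x)
  (fun y x => - b * powexp (h + 1) (w + y%:C * b) x)
  (fun x => nrm b * (x `^ Re (h + 1) * expR (- (rho * x)))) s (s - d) (s + d) mRpos sI).
- by move=> y /near_s yr; apply: cint_powexp => //; exact: lt_trans yr.
- move=> y x yI /RposP x0.
  have da := is_cderiveM (is_cderive_affine w b y) (is_cderive_cst x%:C y).
  have de := is_cderiveZ (cpow x%:C h) (is_cderive_cexp (is_cderiveN da)).
  apply: is_cderive_eq de _.
  have x0' : 0 < Re (x%:C : CR) by [].
  by rewrite /powexp cpowD (cpow1 x0'); ring.
- exact: rintZ mRpos (rint_gamma h2 rho0).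
- move=> y x /near_s yr /RposP x0.
  rewrite nrmM nrmN ler_wpM2l ?nrm_ge0// nrm_powexp// ler_wpM2l ?powR_ge0//.
  by rewrite ler_expR lerN2 ler_wpM2r ?ltW.
Qed.

Lemma Gamma_Euler_integral h : Gamma_integral (h + 1) = Euler_integral h 1.
Proof.
rewrite /Gamma_integral /Euler_integral; apply: eq_cintegral => x _.
by rewrite /powexp addrK mul1r.
Qed.

(** By the recurrence, w^(h+1) times the integral has zero derivative in w; it is
    compared with its value at w = 1 along a segment, slightly prolonged at both
    ends so that the end points are interior. *)
Lemma Euler_integralE h w : -1 < Re h -> 0 < Re w ->
  Euler_integral h w = Gamma_integral (h + 1) / cpow w (h + 1).
Proof.
move=> h1 w0.
pose path (s : R) : CR := 1 + s%:C * (w - 1).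
(* The path stays in the half-plane for -d < s < 1 + d: its real part is at least
   min(1, Re w) on [0, 1] and loses at most half of that outside. *)
pose d := Num.min 1 (Re w) / (2 * (1 + `|Re w - 1|)).
have m0 : 0 < Num.min 1 (Re w) by rewrite lt_min ltr01.
have n1 : 0 < 1 + `|Re w - 1| by rewrite ltr_pwDl.
have d0 : 0 < d by rewrite divr_gt0// mulr_gt0.
have dn : d * (1 + `|Re w - 1|) = Num.min 1 (Re w) / 2.
  by rewrite /d; field; rewrite gt_eqF.
have RP s : Re (path s) = 1 + s * (Re w - 1).
  by rewrite /path ReD ReZ ReD ReN.
have path0 s : s \in `](- d), (1 + d)[ -> 0 < Re (path s).
  rewrite in_itv/= RP => /andP[s1 s2].
  have m1 : Num.min 1 (Re w) <= 1 by rewrite ge_min lexx.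
  have m2 : Num.min 1 (Re w) <= Re w by rewrite ge_min lexx orbT.
  have := ler_norm (Re w - 1); have := lerNnormlW (lexx `|Re w - 1|) => a1 a2.
  have a3 := normr_ge0 (Re w - 1).
  have [sneg|s0] := ltP s 0; first by nra.
  have [s3|s3] := leP s 1; first by nra.
  by nra.
have E s : s \in `](- d), (1 + d)[ ->
    is_cderive (fun s => cpow (path s) (h + 1) * Euler_integral h (path s)) s 0.
  move=> sI; have p0 := path0 s sI.
  have c1 := is_cderive_cpow (h + 1) (is_cderive_affine 1 (w - 1) s) p0.
  have c2 := Euler_integral_deriv h1 p0.
  apply: is_cderive_eq (is_cderiveM c1 c2) _; rewrite -/(path s).
  have pn0 := nrm_Re_gt0 p0.
  have rec := Euler_integral_rec h1 p0.
  have -> : Euler_integral (h + 1) (path s) = (h + 1) * Euler_integral h (path s) / path s.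
    by rewrite -rec mulrAC mulfV// mul1r.
  by field.
have I0 : 0 \in `](- d), (1 + d)[ by rewrite in_itv/=; apply/andP; split; lra.
have I1 : 1 \in `](- d), (1 + d)[ by rewrite in_itv/=; apply/andP; split; lra.
have := cderiv0_cst E I0 I1.
have -> : path 0 = 1 by rewrite /path rmorph0 mul0r addr0.
have -> : path 1 = w by rewrite /path rmorph1 mul1r addrC subrK.
have -> : cpow (1 : CR) (h + 1) = 1.
  by rewrite /cpow (clog_real ltr01) ln1 rmorph0 mulr0 cexp0.
rewrite mul1r -Gamma_Euler_integral => ->.
by rewrite mulrAC mulfV ?mul1r// cpow_neq0.
Qed.

Lemma cGammaE h : -1 < Re h -> cGamma (h + 1) = Gamma_integral (h + 1).
Proof.
move=> h1; rewrite /cGamma.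
have -> : Num.truncn (1 - Re (h + 1)) = 0%N.
  by apply/eqP; rewrite -leqn0 truncn_le_nat ReD /=; lra.
by rewrite addr0 big_ord0 divr1.
Qed.

(** The least number of unit shifts that makes the real part positive drops by
    exactly one from z to z + 1. *)
Lemma cGamma_rec z : Re z <= 0 -> z != 0 -> cGamma (z + 1) = z * cGamma z.
Proof.
move=> z0 zn0; rewrite /cGamma.
have -> : 1 - Re (z + 1) = - Re z by rewrite ReD /=; ring.
have -> : Num.truncn (1 - Re z) = (Num.truncn (- Re z)).+1.
  have Nz0 : 0 <= - Re z by rewrite oppr_ge0.
  have /andP[m1 m2] := truncn_itv Nz0.
  by apply: truncn_def; rewrite -!natr1 in m2 *; apply/andP; split; lra.
set n := Num.truncn _.
have -> : \prod_(k < n.+1) (z + k%:R) = z * \prod_(k < n) (z + 1 + k%:R).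
  rewrite big_ord_recl /= addr0; congr (_ * _); apply: eq_bigr => k _.
  by rewrite /bump /= add1n -natr1 addrA addrAC.
have -> : z + n.+1%:R = z + 1 + n%:R by rewrite -natr1 addrA addrAC.
by rewrite invfM [in RHS]mulrCA mulVKf.
Qed.
End GammaIntegral.

(** * The Laplace transform *)
Section Laplace.
Variable R : realType.
Local Notation mu := (@lebesgue_measure R).
Local Notation TR := (measurableTypeR R).
Local Notation CR := (R[i]^o).
Local Notation Re := (@complex.Re R).
Local Notation Rpos := (`]0, +oo[%classic : set TR).
Local Notation mRp := (@mRpos R).
Implicit Types (z w h a b : CR) (s t x : R) (phi psi : R -> CR) (g : CR -> CR).

Definition Lap phi z : CR :=
  cintegral Rpos (fun x => phi x * cexp (- (z * x%:C))).

(** The transform on the closed half-plane, as an element of K: it vanishes off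
    that half-plane. *)
Definition Lap0 phi : CR -> CR := fun z => if 0 <= Re z then Lap phi z else 0.

Lemma eq_Lap phi psi z : (forall x, 0 < x -> phi x = psi x) -> Lap phi z = Lap psi z.
Proof. by move=> e; apply: eq_cintegral => x /RposP x0; rewrite e. Qed.

Lemma eq_Lap0 phi psi : (forall x, 0 < x -> phi x = psi x) -> Lap0 phi = Lap0 psi.
Proof. by move=> e; apply/funext => z; rewrite /Lap0 (eq_Lap _ e). Qed.

Lemma schwartz_meas n phi : schwartz n.+1 phi -> cmeas Rpos phi.
Proof. by move=> [_ [p' [dp _]]]; exact: cmeas_Rpos dp. Qed.

Lemma cexpx_meas z : cmeas Rpos (fun x => cexp (- (z * x%:C))).
Proof. exact: cmeas_Rpos (fun x _ => is_cderive_cexpx z x). Qed.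

Lemma nrm_cexpx_le1 z x : 0 <= Re z -> 0 < x -> nrm (cexp (- (z * x%:C))) <= 1.
Proof.
by move=> z0 x0; rewrite nrm_cexpx expR_le1 oppr_le0 mulr_ge0// ltW.
Qed.

(** The exponents 0 and -2 of flatness give a bound by C (1 + x)^-2. *)
Lemma flat_nrm_int phi : flat phi -> cmeas Rpos phi -> rint Rpos (fun x => nrm (phi x)).
Proof.
move=> fp mp; have [M M0 h] := flat_ge0 0 fp; have [M' M'0 h'] := flat_ge0 (-2) fp.
have b0 : -1 < 0 :> R by lra.
have ib := rintZ (4 * (M + M')) mRp (rint_beta b0).
apply: (rint_dom mRp (rmeas_nrm mp) ib) => x /RposP x0.
rewrite ger0_norm ?nrm_ge0// powRr0 mul1r add0r.
have x1 : 0 < 1 + x by lra.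
rewrite (powR_invn 2 (ltW x1)) ler_pdivlMr ?exprn_gt0//.
have := h x x0; rewrite powRr0 mulr1 => h1.
have := h' x x0; rewrite (powR_invn 2 (ltW x0)) ler_pdivlMr ?exprn_gt0// => h2.
have := nrm_ge0 (phi x) => n0.
have q : (1 + x) ^+ 2 <= 2 * (1 + x ^+ 2) by have := sqr_ge0 (1 - x); rewrite !expr2; lra.
have := ler_wpM2l n0 q.
by lra.
Qed.

Lemma schwartz_nrm_int n phi : schwartz n.+1 phi -> rint Rpos (fun x => nrm (phi x)).
Proof. by move=> Sp; apply: flat_nrm_int; [exact: schwartz_flat Sp|exact: schwartz_meas Sp]. Qed.

Lemma schwartz_cint n phi : schwartz n.+1 phi -> cint Rpos phi.
Proof.
by move=> Sp; apply: (cint_dom mRp (schwartz_meas Sp) (schwartz_nrm_int Sp)).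
Qed.

Lemma Lap_int n phi z : schwartz n.+1 phi -> 0 <= Re z ->
  cint Rpos (fun x => phi x * cexp (- (z * x%:C))).
Proof.
move=> Sp z0; apply: (cint_dom mRp _ (schwartz_nrm_int Sp)).
  by apply: cmeasM; [exact: schwartz_meas Sp|exact: cexpx_meas].
move=> x /RposP x0; rewrite nrmM ler_piMr ?nrm_ge0//; exact: nrm_cexpx_le1.
Qed.

Definition L1nrm phi := \int[mu]_(x in Rpos) nrm (phi x).

Lemma L1nrm_ge0 phi : 0 <= L1nrm phi.
Proof. by apply: Rintegral_ge0 => x _; exact: nrm_ge0. Qed.

Lemma Lap_bound n phi z : schwartz n.+1 phi -> 0 <= Re z -> nrm (Lap phi z) <= 2 * L1nrm phi.
Proof.
move=> Sp z0; apply: nrm_cintegral.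
- exact: mRp.
- exact: Lap_int Sp z0.
- exact: schwartz_nrm_int Sp.
- by move=> x /RposP x0; rewrite nrmM ler_piMr ?nrm_ge0//; exact: nrm_cexpx_le1.
Qed.

Lemma LapD n phi psi z : schwartz n.+1 phi -> schwartz n.+1 psi -> 0 <= Re z ->
  Lap (fun x => phi x + psi x) z = Lap phi z + Lap psi z.
Proof.
move=> Sp Sq z0; rewrite /Lap -(cintegralD mRp (Lap_int Sp z0) (Lap_int Sq z0)).
by apply: eq_cintegral => x _; rewrite mulrDl.
Qed.

Lemma LapZ n c phi z : schwartz n.+1 phi -> 0 <= Re z ->
  Lap (fun x => c * phi x) z = c * Lap phi z.
Proof.
move=> Sp z0; rewrite /Lap -(cintegralZ c mRp (Lap_int Sp z0)).
by apply: eq_cintegral => x _; rewrite mulrA.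
Qed.

Definition mulX phi : R -> CR := fun x => x%:C * phi x.

Lemma schwartz_mulX n phi : schwartz n phi -> schwartz n (mulX phi).
Proof.
move=> Sp; apply: eq_schwartz (schwartz_cpow 1 Sp) => x x0.
by rewrite cpow1.
Qed.

(** Mean value inequality on the segment from w to z, where the exponential is
    bounded by 1. *)
Lemma expseg_diff (z w : CR) x : 0 <= Re z -> 0 <= Re w -> 0 < x ->
  nrm (cexp (- (z * x%:C)) - cexp (- (w * x%:C))) <= 2 * (nrm (z - w) * x).
Proof.
move=> z0 w0 x0.
have seg y : y \in `[0, 1] -> 0 <= Re (w + y%:C * (z - w)).
  rewrite in_itv/= ReD ReZ ReD ReN => /andP[y0 y1].
  by have := mulr_ge0 y0 z0; have : 0 <= (1 - y) * Re w; [rewrite mulr_ge0// subr_ge0|lra].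
have := @cMVT_bound R (fun y => cexp (- ((w + y%:C * (z - w)) * x%:C)))
  (fun y => - ((z - w) * x%:C) * cexp (- ((w + y%:C * (z - w)) * x%:C))) 0 1 (nrm (z - w) * x) ler01.
rewrite subr0 mulr1 rmorph1 rmorph0 mul1r mul0r addr0 addrCA subrr addr0; apply.
  move=> y _; have da := is_cderiveM (is_cderive_affine w (z - w) y) (is_cderive_cst x%:C y).
  apply: is_cderive_eq (is_cderive_cexp (is_cderiveN da)) _.
  by rewrite mulr0 addr0.
move=> y yI; rewrite nrmM nrmN nrmM nrm_real gtr0_norm// ler_piMr//.
  by rewrite mulr_ge0 ?nrm_ge0// ltW.
by apply: nrm_cexpx_le1 => //; exact: seg.
Qed.

(** The mean value inequality again, for the difference between the exponential
    and its tangent; the derivative is bounded by the first order estimate. *)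
Lemma expseg_diff2 (z w : CR) x : 0 <= Re z -> 0 <= Re w -> 0 < x ->
  nrm (cexp (- (w * x%:C)) - cexp (- (z * x%:C)) + (w - z) * x%:C * cexp (- (z * x%:C)))
    <= 4 * (nrm (w - z) ^+ 2 * x ^+ 2).
Proof.
move=> z0 w0 x0; set k := (w - z) * x%:C.
have seg y : y \in `[0, 1] -> 0 <= Re (z + y%:C * (w - z)).
  rewrite in_itv/= ReD ReZ ReD ReN => /andP[y0 y1].
  by have := mulr_ge0 y0 w0; have : 0 <= (1 - y) * Re z; [rewrite mulr_ge0// subr_ge0|lra].
have nk : nrm k = nrm (w - z) * x by rewrite nrmM nrm_real gtr0_norm.
have := @cMVT_bound R
  (fun y => cexp (- ((z + y%:C * (w - z)) * x%:C)) + y%:C * (k * cexp (- (z * x%:C))))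
  (fun y => - k * cexp (- ((z + y%:C * (w - z)) * x%:C)) + k * cexp (- (z * x%:C)))
  0 1 (2 * (nrm k * nrm k)) ler01.
rewrite subr0 mulr1 rmorph1 rmorph0 !mul1r !mul0r !addr0 addrCA subrr addr0.
have -> : 4 * (nrm (w - z) ^+ 2 * x ^+ 2) = 2 * (2 * (nrm k * nrm k)).
  by rewrite nk; ring.
rewrite addrAC; apply.
  move=> y _; have da := is_cderiveM (is_cderive_affine z (w - z) y) (is_cderive_cst x%:C y).
  have de := is_cderive_cexp (is_cderiveN da).
  have dl := is_cderiveM (is_cderive_id y) (is_cderive_cst (k * cexp (- (z * x%:C))) y).
  apply: is_cderive_eq (is_cderiveD de dl) _.
  by rewrite !mulr0 !addr0 mul1r.
move=> y yI; rewrite addrC mulNr -mulrBr nrmM.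
have := expseg_diff z0 (seg y yI) x0.
have -> : z - (z + y%:C * (w - z)) = (- y)%:C * (w - z) by rewrite rmorphN /=; ring.
rewrite nrmM nrm_real normrN => h.
rewrite mulrCA ler_wpM2l ?nrm_ge0//.
apply: (le_trans h); rewrite nk ler_wpM2l// ler_wpM2r ?(ltW x0)//.
move: yI; rewrite in_itv/= => /andP[y0 y1].
by rewrite ger0_norm// ler_piMl ?nrm_ge0.
Qed.

Lemma Lap_lip n phi z w : schwartz n.+1 phi -> 0 <= Re z -> 0 <= Re w ->
  nrm (Lap phi z - Lap phi w) <= 4 * L1nrm (mulX phi) * nrm (z - w).
Proof.
move=> Sp z0 w0; rewrite /Lap -(cintegralB mRp (Lap_int Sp z0) (Lap_int Sp w0)).
have iX := schwartz_nrm_int (schwartz_mulX Sp).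
have -> : 4 * L1nrm (mulX phi) * nrm (z - w) =
    2 * \int[mu]_(x in Rpos) ((2 * nrm (z - w)) * nrm (mulX phi x)).
  by rewrite (RintegralZl _ mRp iX) /L1nrm; ring.
apply: nrm_cintegral.
- exact: mRp.
- exact: cintB mRp (Lap_int Sp z0) (Lap_int Sp w0).
- exact: rintZ mRp iX.
- move=> x /RposP x0; rewrite -mulrBr nrmM.
  apply: (le_trans (ler_wpM2l (nrm_ge0 _) (expseg_diff z0 w0 x0))).
  by rewrite /mulX nrmM nrm_real gtr0_norm// le_eqVlt; apply/orP; left; apply/eqP; ring.
Qed.

(** A quantitative form of: the derivative of [Lap phi] is - [Lap (x phi)].  It
    is uniform up to the boundary. *)
Lemma Lap_diff2 n phi z w : schwartz n.+1 phi -> 0 <= Re z -> 0 <= Re w ->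
  nrm (Lap phi w - Lap phi z + (w - z) * Lap (mulX phi) z)
    <= 8 * L1nrm (mulX (mulX phi)) * nrm (w - z) ^+ 2.
Proof.
move=> Sp z0 w0.
have SX := schwartz_mulX Sp; have SXX := schwartz_mulX SX; have iX := schwartz_nrm_int SXX.
have iw := Lap_int Sp w0; have iz := Lap_int Sp z0; have iXz := Lap_int SX z0.
rewrite /Lap -(cintegralB mRp iw iz) -(cintegralZ (w - z) mRp iXz).
rewrite -(cintegralD mRp (cintB mRp iw iz) (cintZ _ mRp iXz)).
have -> : 8 * L1nrm (mulX (mulX phi)) * nrm (w - z) ^+ 2 =
    2 * \int[mu]_(x in Rpos) ((4 * nrm (w - z) ^+ 2) * nrm (mulX (mulX phi) x)).
  by rewrite (RintegralZl _ mRp iX) /L1nrm; ring.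
apply: nrm_cintegral.
- exact: mRp.
- exact: cintD mRp (cintB mRp iw iz) (cintZ _ mRp iXz).
- exact: rintZ mRp iX.
- move=> x /RposP x0.
  rewrite [X in nrm X](_ : _ = phi x * (cexp (- (w * x%:C)) - cexp (- (z * x%:C)) + (w - z) * x%:C * cexp (- (z * x%:C)))); last by rewrite /mulX; ring.
  rewrite nrmM; apply: (le_trans (ler_wpM2l (nrm_ge0 _) (expseg_diff2 z0 w0 x0))).
  rewrite /mulX !nrmM nrm_real gtr0_norm// le_eqVlt; apply/orP; left; apply/eqP; ring.
Qed.

Lemma flat_cvg0 phi : flat phi ->
  phi (0 + n.+2%:R) - phi (0 + n.+2%:R^-1) @[n --> \oo] --> (0 : CR).
Proof.
move=> fp; rewrite -[X in _ --> X](subrr 0); apply: cvgB.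
  have [M M0 h] := flat_ge0 (-1) fp.
  apply/cvg_nrmP => e e0; apply: filterS (near_nat_ge (M / e + 1)) => n hn.
  rewrite sub0r nrmN add0r; set y : R := n.+2%:R; have y0 : 0 < y by [].
  have yn : M / e < y by have : n.+1%:R <= y; [rewrite ler_nat|lra].
  apply: le_lt_trans (h y y0) _; rewrite (powR_invn 1 (ltW y0)) expr1.
  by rewrite ltr_pdivrMr// mulrC -ltr_pdivrMr.
have [M M0 h] := flat_ge0 1 fp.
apply/cvg_nrmP => e e0; apply: filterS (near_nat_ge (M / e + 1)) => n hn.
rewrite sub0r nrmN add0r; set y : R := n.+2%:R; have y0 : 0 < y by [].
have yn : M / e < y by have : n.+1%:R <= y; [rewrite ler_nat|lra].
have yi : 0 < y^-1 by rewrite invr_gt0.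
apply: le_lt_trans (h _ yi) _; rewrite powRr1 ?ltW//.
by rewrite ltr_pdivrMr// mulrC -ltr_pdivrMr.
Qed.

Lemma flat_mul_bnd phi (k : R -> CR) : flat phi ->
  (forall x, 0 < x -> nrm (k x) <= 1) -> flat (fun x => phi x * k x).
Proof.
move=> fp hk r; have [M h] := fp r; exists M => x x0.
by rewrite nrmM (le_trans _ (h x x0))// ler_piMr ?nrm_ge0// hk.
Qed.

(** Flatness kills the boundary terms at 0 and at infinity. *)
Lemma Lap_parts n phi phi' z : schwartz n.+2 phi -> schwartz n.+2 phi' ->
  (forall x, 0 < x -> is_cderive phi x (phi' x)) -> 0 <= Re z ->
  Lap phi' z = z * Lap phi z.
Proof.
move=> Sp Sp' dp z0.
have iz := Lap_int Sp z0; have iz' := Lap_int Sp' z0.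
have D x : 0 < x -> is_cderive (fun x => phi x * cexp (- (z * x%:C))) x
   (phi' x * cexp (- (z * x%:C)) - z * (phi x * cexp (- (z * x%:C)))).
  move=> x0; apply: is_cderive_eq (is_cderiveM (dp x x0) (is_cderive_cexpx z x)) _.
  by ring.
have [_ [p'' [dp' _]]] := Sp'.
have H := @cintegral_exhaust R Rpos _ _ _ (fun x => phi x * cexp (- (z * x%:C))) 0
  mRp (exhausts_oy 0) (fun x hx => D x (RposP hx)).
apply/eqP; rewrite -subr_eq0; apply/eqP.
rewrite /Lap -(cintegralZ z mRp iz) -(cintegralB mRp iz' (cintZ z mRp iz)).
apply: H.
- move=> x /RposP x0.
  have c1 := is_cderiveM (dp' x x0) (is_cderive_cexpx z x).
  exact: is_cderive_continuous (is_cderiveB c1 (is_cderiveZ z (D x x0))).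
- exact: cintB mRp iz' (cintZ z mRp iz).
- apply: (@flat_cvg0 (fun x => phi x * cexp (- (z * x%:C)))).
  apply: flat_mul_bnd; first exact: schwartz_flat Sp.
  by move=> x x0; exact: nrm_cexpx_le1.
Qed.

(** Powers of z become derivatives of phi, whose transforms are bounded. *)
Lemma Lap_rapid N phi : (forall n, schwartz n phi) -> exists2 M : R, 0 <= M &
  forall z, 0 <= Re z -> nrm (Lap phi z) <= M * (1 + nrm z) ^- N.
Proof.
elim: N phi => [|N IH] phi Sp.
  exists (2 * L1nrm phi); first by rewrite mulr_ge0 ?L1nrm_ge0.
  by move=> z z0; rewrite expr0 invr1 mulr1; exact: Lap_bound (Sp 1) z0.
have [phi' [dp Sp']] := schwartz_deriv Sp.
have [M M0 h] := IH phi Sp; have [M' M'0 h'] := IH phi' Sp'.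
exists (M + M'); first exact: addr_ge0.
move=> z z0; have n1 := one_nrm_gt0 z.
rewrite exprSr invfM mulrA ler_pdivlMr//.
rewrite mulrDr mulr1 mulrDl; apply: lerD; first exact: h.
rewrite mulrC -nrmM -(Lap_parts (Sp 2) (Sp' 2) dp z0).
exact: h'.
Qed.

End Laplace.

(** * The space K as the image of the Laplace transform *)
Section SpaceKChar.
Variable R : realType.
Local Notation TR := (measurableTypeR R).
Local Notation CR := (R[i]^o).
Local Notation Re := (@complex.Re R).
Local Notation Im := (@complex.Im R).
Local Notation Rpos := (`]0, +oo[%classic : set TR).
Local Notation mRp := (@mRpos R).
Implicit Types (z w h a b : CR) (phi psi : R -> CR) (f g : CR -> CR).

Lemma near_nrm z (e : R) : 0 < e -> \forall w \near z, nrm (z - w) < e.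
Proof.
move=> e0; have h : (id : CR -> CR) w @[w --> z] --> z by exact: cvg_id.
by move/cvg_nrmP : h => /(_ e e0).
Qed.

Lemma near_rhp z : rhp z -> \forall w \near z, rhp w.
Proof.
move=> z0; have := @near_nrm z _ z0; apply: filterS => w; rewrite /rhp/= => h.
have := le_lt_trans (nrm_Re (z - w)) h; rewrite ReD ReN ltr_norml => /andP[_].
lra.
Qed.

Lemma cvg_shift_right z : (z + (n.+1%:R^-1)%:C) @[n --> \oo] --> z.
Proof.
rewrite -[X in _ --> X]addr0; apply: cvgD; first exact: cvg_cst.
apply/cvg_complexP; split => /=; last exact: cvg_cst.
exact: cvg_harmonic.
Qed.

Lemma within_rhp_proper z : Re z = 0 -> ProperFilter (within rhp (nbhs z)).
Proof.
move=> z0; apply: Build_ProperFilter_ex => P wP.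
have [N _ h] := @cvg_shift_right z _ wP.
by exists (z + (N.+1%:R^-1)%:C); apply: (h N) => //=; rewrite /rhp/= ReD z0 add0r /= invr_gt0.
Qed.

(** [Lap phi] is Lipschitz on the closed half-plane, so its boundary values are
    given by the same integral.  Every operator defined by extension from the
    open half-plane is computed by this lemma. *)
Lemma bdext_Lap phi g : schwartz 2 phi -> (forall z, rhp z -> g z = Lap phi z) ->
  bdext g = Lap0 phi.
Proof.
move=> Sp gL; apply/funext => z; rewrite /bdext /Lap0.
have [z0|z0] := ltP 0 (Re z); first by rewrite ltW// gL.
have [z1|z1] := eqVneq (Re z) 0; last by rewrite leNgt lt_neqAle z0 z1.
rewrite z1 lexx; have PF := within_rhp_proper z1.
apply: cvg_lim => //; apply/cvg_nrmP => e e0.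
set C := 4 * L1nrm (mulX phi); have C0 : 0 <= C by rewrite mulr_ge0 ?L1nrm_ge0.
have d0 : 0 < e / (C + 1) by rewrite divr_gt0// ltr_wpDl.
rewrite near_withinE; apply: filterS (@near_nrm z _ d0) => w zw w0.
have z2 : 0 <= Re z by rewrite z1.
rewrite gL//; apply: le_lt_trans (Lap_lip Sp z2 (ltW w0)) _.
rewrite ltr_pdivlMr ?ltr_wpDl// in zw; rewrite -/C.
by have := nrm_ge0 (z - w); lra.
Qed.

Definition dLap phi : R -> CR := fun x => - (x%:C * phi x).

Lemma schwartz_dLap n phi : schwartz n phi -> schwartz n (dLap phi).
Proof.
move=> Sp; apply: eq_schwartz (schwartzZ (-1) (schwartz_mulX Sp)) => x _.
by rewrite mulN1r.
Qed.

Lemma is_derive_Lap phi g z : schwartz 3 phi -> (forall z, rhp z -> g z = Lap phi z) ->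
  rhp z -> is_derive z 1 g (Lap (dLap phi) z).
Proof.
move=> Sp gL z0.
have LE : Lap (dLap phi) z = - Lap (mulX phi) z.
  rewrite -mulN1r -(LapZ (-1) (schwartz_mulX Sp) (ltW z0)).
  by apply: eq_Lap => x _; rewrite mulN1r.
have lim : h^-1 *: ((g \o shift z) (h *: 1) - g z) @[h --> (0 : R[i]^o)^'] --> Lap (dLap phi) z.
  apply/cvg_nrmP => e e0.
  set C := 8 * L1nrm (mulX (mulX phi)); have C0 : 0 <= C by rewrite mulr_ge0 ?L1nrm_ge0.
  have d0 : 0 < Num.min (Re z) (e / (C + 1)) by rewrite lt_min z0 divr_gt0// ltr_wpDl.
  rewrite near_withinE; apply: filterS (@near_nrm 0 _ d0) => h; rewrite sub0r nrmN lt_min => /andP[h1 h2] hn0.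
  rewrite /shift /= /GRing.scale /= mulr1.
  have w0 : rhp (h + z).
    rewrite /rhp /= ReD; have := le_lt_trans (nrm_Re h) h1.
    by rewrite ltr_norml => /andP[]; lra.
  rewrite !gL// LE.
  have := Lap_diff2 Sp (ltW z0) (ltW w0); rewrite addrK -/C.
  set L1 := Lap phi (h + z); set L := Lap phi z; set LX := Lap (mulX phi) z => hb.
  have hp : 0 < nrm h by rewrite nrm_gt0.
  have -> : - LX - h^-1 * (L1 - L) = - (h^-1 * (L1 - L + h * LX)).
    by field.
  rewrite nrmN nrmM nrmV mulrC ltr_pdivrMr//.
  apply: (le_lt_trans hb); rewrite expr2 mulrA ltr_pM2r//.
  by rewrite ltr_pdivlMr ?ltr_wpDl// in h2; lra.
apply: DeriveDef; first by apply/cvg_ex; eexists; exact: lim.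
exact: cvg_lim lim.
Qed.

Lemma schwartz_iter_dLap k phi : (forall n, schwartz n phi) -> forall n, schwartz n (iter k dLap phi).
Proof. by move=> Sp; elim: k => [|k IHk] n //=; exact: schwartz_dLap. Qed.

Lemma derive1n_Lap k phi g : (forall n, schwartz n phi) ->
  (forall z, rhp z -> g z = Lap phi z) ->
  forall z, rhp z -> derive1n k g z = Lap (iter k dLap phi) z.
Proof.
move=> Sp gL; elim: k => [|k IH] z z0 /=; first exact: gL.
have [_ <-] := is_derive_Lap (schwartz_iter_dLap k Sp 3) IH z0.
by rewrite -derive1E.
Qed.

Lemma weightE (M : R) z N :
  M%:C * (1 + (nrm z)%:C) ^- N = (M * (1 + nrm z) ^- N)%:C :> R[i].
Proof. by rewrite rmorphM fmorphV rmorphXn rmorphD rmorph1. Qed.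

Lemma Lap0_spaceK phi : (forall n, schwartz n phi) -> spaceK (Lap0 phi).
Proof.
move=> Sp.
have L0 z : rhp z -> Lap0 phi z = Lap phi z by move=> /ltW z0; rewrite /Lap0 z0.
have bk k : bdext (derive1n k (Lap0 phi)) = Lap0 (iter k dLap phi).
  apply: bdext_Lap; first exact: schwartz_iter_dLap.
  by move=> z z0; exact: derive1n_Lap.
split.
- exact: (bk 0).
- move=> k z z0.
  by have [] := is_derive_Lap (schwartz_iter_dLap k Sp 3) (derive1n_Lap k Sp L0) z0.
- move=> k; rewrite bk; apply/subspace_continuousP => z z0.
  have Sk := schwartz_iter_dLap k Sp.
  apply/cvg_nrmP => e e0.
  set C := 4 * L1nrm (mulX (iter k dLap phi)); have C0 : 0 <= C by rewrite mulr_ge0 ?L1nrm_ge0.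
  have d0 : 0 < e / (C + 1) by rewrite divr_gt0// ltr_wpDl.
  rewrite near_withinE; apply: filterS (@near_nrm z _ d0) => w zw w0.
  rewrite /from_subspace /Lap0 z0 w0; apply: le_lt_trans (Lap_lip (Sk 2) z0 w0) _.
  rewrite ltr_pdivlMr ?ltr_wpDl// in zw; rewrite -/C.
  by have := nrm_ge0 (z - w); lra.
- move=> k N; rewrite bk; have [M M0 h] := Lap_rapid N (schwartz_iter_dLap k Sp).
  exists M => z z0; rewrite /Lap0 z0 !nrmE weightE lecR.
  exact: h.
Qed.

(** The difference quotient along the line is b times the complex difference
    quotient with increment y b, unless b = 0. *)
Lemma is_derive_line g l a b (s : R) : is_derive (a + s%:C * b) 1 g l ->
  is_cderive (fun y : R => g (a + y%:C * b)) s (b * l).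
Proof.
move=> dg; have [b0|b0] := eqVneq b 0.
  rewrite b0 mul0r (_ : (fun _ => _) = (fun=> g a)); first exact: is_cderive_cst.
  by apply/funext => y; rewrite mulr0 addr0.
set z := a + s%:C * b in dg *.
have [dg1 dg2] := dg.
have lim : h^-1 *: ((g \o shift z) (h *: 1) - g z) @[h --> (0 : R[i]^o)^'] --> l.
  by rewrite -dg2; exact: dg1.
have limR : (h^-1)%:C * (g (a + (h + s)%:C * b) - g z) @[h --> (0 : R)^'] --> b * l.
  apply/cvg_nrmP => e e0.
  have e1 : 0 < e / nrm b by rewrite divr_gt0// nrm_gt0.
  have /cvg_nrmP/(_ _ e1) := lim.
  move=> /nbhs_ballP [d /= d0 hd].
  have dE : d = (Re d)%:C by apply: complex_ext => //=; rewrite ger0_Im// ltW.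
  have rd0 : 0 < Re d by rewrite dE ltcR in d0.
  have r0 : 0 < Re d / nrm b by rewrite divr_gt0// nrm_gt0.
  exists (Re d / nrm b) => //= y; rewrite /ball_ /= sub0r normrN => yd yn0.
  have yb0 : y%:C * b != 0 by rewrite mulf_neq0// -nrm_eq0 nrm_real normr_eq0.
  have B : ball (0 : CR) d (y%:C * b).
    rewrite -ball_normE /ball_ /= sub0r normrN nrmE dE ltcR nrmM nrm_real.
    by rewrite -ltr_pdivlMr// nrm_gt0.
  have := hd _ B yb0.
  rewrite /shift /= /GRing.scale /= mulr1 => h.
  have -> : a + (y + s)%:C * b = y%:C * b + z by rewrite /z rmorphD; ring.
  have yn0' : y%:C != 0 :> CR by rewrite -nrm_eq0 nrm_real normr_eq0.
  rewrite fmorphV.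
  have -> : b * l - (y%:C)^-1 * (g (y%:C * b + z) - g z) =
      b * (l - (y%:C * b)^-1 * (g (y%:C * b + z) - g z)).
    by field; rewrite b0 yn0'.
  by rewrite nrmM mulrC -ltr_pdivlMr// nrm_gt0.
have /cvg_complexP[l1 l2] := limR.
split; apply: DeriveDef.
- apply/cvg_ex; exists (Re (b * l)); move: l1; apply: cvg_trans.
  apply: near_eq_cvg; near=> h.
  by rewrite /shift /= /GRing.scale /= mulr1 ReZ ReD ReN.
- apply: cvg_lim => //; move: l1; apply: cvg_trans.
  apply: near_eq_cvg; near=> h.
  by rewrite /shift /= /GRing.scale /= mulr1 ReZ ReD ReN.
- apply/cvg_ex; exists (Im (b * l)); move: l2; apply: cvg_trans.
  apply: near_eq_cvg; near=> h.
  by rewrite /shift /= /GRing.scale /= mulr1 ImZ ImD ImN.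
- apply: cvg_lim => //; move: l2; apply: cvg_trans.
  apply: near_eq_cvg; near=> h.
  by rewrite /shift /= /GRing.scale /= mulr1 ImZ ImD ImN.
Unshelve. all: by end_near. Qed.

Lemma bdext_rhp g z : rhp z -> bdext g z = g z.
Proof. by move=> z0; rewrite /bdext z0. Qed.

Lemma spaceK_hardy f : spaceK f -> forall n, hardy n f.
Proof.
move=> [fE fd fc fr] n.
have bcK k : bcont (bdext (derive1n k f)).
  move=> t; have cr (s : R) : 0 <= s -> crhp (pt s t).
    by rewrite /crhp /mkset Re_pt.
  have /subspace_continuousP/(_ (pt 0 t) (cr 0 (lexx 0))) := fc k => c.
  move=> P /c h; have [N _ hN] := @cvg_pt0 R t _ h.
  exists N => // m Nm; apply: (hN m Nm).
  by apply: cr; rewrite invr_ge0.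
have rK k : rapid (bdext (derive1n k f)).
  move=> N; have [M h] := fr k N; exists M => z z0.
  by have := h z (ltW z0); rewrite !nrmE weightE lecR.
suff H : forall k, hardy n (bdext (derive1n k f)) by have := H 0%N; rewrite /= fE.
elim: n => [|n IH] k; (split; [exact: rK|split; [exact: bcK|]]) => //.
exists (bdext (derive1n k.+1 f)); split; last exact: IH.
move=> a b s s0.
have d := derivableP (fd k _ s0).
rewrite -derive1E -derive1nS in d.
rewrite bdext_rhp//; apply: is_cderive_near (is_derive_line d).
have ca := is_cderive_continuous (is_cderive_affine a b s).
have ns : \forall y \near s, rhp (a + y%:C * b) := ca _ (near_rhp s0).
by apply: filterS ns => y y0; rewrite bdext_rhp.
Qed.

Lemma int_exp w : 0 < Re w ->
  cint Rpos (fun x => cexp (- (w * x%:C))) /\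
  cintegral Rpos (fun x => cexp (- (w * x%:C))) = w^-1.
Proof.
move=> w0; have r0 : -1 < 0 :> R by lra.
have i : cint Rpos (fun x => cexp (- (w * x%:C))).
  apply: (cint_dom mRp (cexpx_meas w) (rint_gamma r0 w0)) => x _.
  by rewrite nrm_cexpx powRr0 mul1r.
split => //.
have wn0 := nrm_Re_gt0 w0.
have D (x : R) : is_cderive (fun x : R => - w^-1 * cexp (- (w * x%:C))) x (cexp (- (w * x%:C))).
  apply: is_cderive_eq (is_cderiveZ (- w^-1) (is_cderive_cexpx w x)) _.
  by rewrite mulrA mulrNN mulVf// mul1r.
apply: (@cintegral_exhaust R Rpos _ _ _ (fun x : R => - w^-1 * cexp (- (w * x%:C))) w^-1
  mRp (exhausts_oy 0) (fun x _ => D x) _ i).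
  by move=> x _; exact: is_cderive_continuous (is_cderive_cexpx w x).
rewrite -[X in _ --> X]add0r -[X in _ --> 0 + X]opprK; apply: cvgB.
  apply/cvg_nrmP => e e0.
  have q0 : 0 < 1 :> R by [].
  have := fun x => @powR_le_expR R _ _ x w0 q0.
  set C := expR _ => hC; have C0 : 0 < C by exact: expR_gt0.
  apply: filterS (near_nat_ge (nrm w^-1 * C / e + 1)) => n hn.
  rewrite sub0r nrmN add0r nrmM nrmN nrm_cexpx; set y : R := n.+2%:R.
  have y0 : 0 < y by [].
  have yn : nrm w^-1 * C / e < y by have : n.+1%:R <= y; [rewrite ler_nat|lra].
  rewrite expRN ltr_pdivrMr ?expR_gt0//.
  have := hC y (ltW y0); rewrite powRr1; last by lra.
  rewrite ltr_pdivrMr// in yn => h.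
  rewrite -(ltr_pM2r C0).
  by have := ler_wpM2l (ltW e0) h; lra.
rewrite -[X in _ --> X]mulr1 -(cexp0 R); apply: cvgM; first exact: cvg_cst.
have c := is_cderive_continuous (is_cderive_cexpx w 0).
have := @cvg_comp _ _ _ (fun n : nat => (0 + n.+2%:R^-1 : R))
  (fun x : R => cexp (- (w * x%:C))) _ (nbhs (0 : R)) _ _ c.
rewrite rmorph0 mulr0 oppr0; apply.
under eq_fun do rewrite add0r; exact: cvg_inv_nat.
Qed.

Lemma cis_cexpx w (t x : R) :
  cexp (- (w * x%:C)) * cis (t * x) = cexp (- ((w - pt 0 t) * x%:C)) :> CR.
Proof.
rewrite cis_pt0 -cexpD; congr cexp; ring.
Qed.

Lemma twopi_neq0 : (2 * pi)%:C != 0 :> CR.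
Proof. by rewrite -nrm_eq0 nrm_real normr_eq0 mulf_neq0// gt_eqF// pi_gt0. Qed.

(** Fubini in full generality: with the identity as m this is the inversion
    formula, with m x = x^alpha the operator A_alpha, and with m x = ax the
    dilation R_a. *)
Lemma Lap_invLap_comp f (m : TR -> R) z : (forall n, hardy n f) -> rhp z ->
  rmeas Rpos m -> schwartz 1 (fun x => invLap f (m x)) ->
  cintegral setT (fun t : TR => f (pt 0 t) *
    cintegral Rpos (fun x : TR => cexp (- (z * x%:C)) * cis (t * m x))) =
  (2 * pi)%:C * Lap (fun x => invLap f (m x)) z.
Proof.
move=> Hf z0 mm Sm; rewrite (fubini_cis mRp (bdry_cint (Hf 1%N)) (int_exp z0).1 mm).
rewrite /Lap -(cintegralZ _ mRp (Lap_int Sm (ltW z0))); apply: eq_cintegral => x _.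
by rewrite /invLap fmorphV -[_^-1 * _ * _]mulrA (mulVKf twopi_neq0) mulrC.
Qed.

Lemma cauchy_hardy f z : (forall n, hardy n f) -> rhp z ->
  cintegral setT (fun t : TR => f (pt 0 t) / (z - pt 0 t)) = (2 * pi)%:C * f z.
Proof.
move=> Hf z0.
have [r0 [b0 [f' [h0 [r1 [b1 [f'' [h1 [r2 [b2 [f3 [h2 _]]]]]]]]]]]] := Hf 3%N.
exact: (cauchy_formula z0 r0 r1 r2 b0 h0 h1 h2 (cint_meas (bdry_cint (Hf 1%N)))).
Qed.

(** The inner integral of exp(-zx) exp(itx) is the Cauchy kernel 1 / (z - it). *)
Lemma Lap_invLap g z : (forall n, hardy n g) -> rhp z -> Lap (invLap g) z = g z.
Proof.
move=> Hg z0; apply: (mulfI twopi_neq0).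
rewrite -(Lap_invLap_comp Hg z0 (@measurable_id _ TR Rpos) (invLap_schwartz 1 Hg)).
rewrite -(cauchy_hardy Hg z0); apply: eq_cintegral => t _; congr (_ * _).
under (eq_cintegral (A := Rpos)) => x _ do rewrite cis_cexpx.
by apply: (int_exp _).2; rewrite ReD ReN Re_pt subr0.
Qed.

Lemma spaceK_Lap0 f : spaceK f -> f = Lap0 (invLap f).
Proof.
move=> Kf; have HKf := spaceK_hardy Kf; have [fE _ _ _] := Kf.
rewrite -{1}fE; apply: bdext_Lap; first exact: invLap_schwartz.
by move=> z z0; rewrite Lap_invLap.
Qed.

End SpaceKChar.

(** * Injectivity of the Laplace transform *)
Section LaplaceInjective.
Variable R : realType.
Local Notation Re := (@complex.Re R).
Local Notation TR := (measurableTypeR R).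
Local Notation CR := (R[i]^o).
Local Notation Rpos := (`]0, +oo[%classic : set TR).
Local Notation mRp := (@mRpos R).
Implicit Types (z w : CR) (phi psi : R -> CR).

Lemma lim_of_cst (v : nat -> CR) (l a : CR) :
  v n @[n --> \oo] --> l -> (forall n, v n = a) -> l = a.
Proof.
move=> vl va; have E : v = (fun=> a) by apply/funext.
rewrite E in vl; exact: (cvg_unique (@norm_hausdorff _ _) vl (cvg_cst a)).
Qed.

Lemma exp_series_cvg (u : R) : series (exp_coeff u) n @[n --> \oo] --> expR u.
Proof. exact: is_cvg_series_exp_coeff. Qed.

Lemma exp_series_bound (u : R) K : 0 <= u -> `|series (exp_coeff (- u)) K| <= expR u.
Proof.
move=> u0; apply: (@le_trans _ _ (series (exp_coeff u) K)).
  rewrite /series /=; apply: (le_trans (ler_norm_sum _ _ _)).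
  apply: ler_sum => k _; rewrite /exp_coeff /= normrM normrX normrN.
  by rewrite (ger0_norm u0) [X in _ * X]ger0_norm ?invr_ge0 ?ler0n.
have nd : nondecreasing_seq (series (exp_coeff u)).
  apply/nondecreasing_seqP => n; rewrite -[leRHS]/(series (exp_coeff u) n.+1).
  rewrite /series /= big_nat_recr//= lerDl /exp_coeff /=.
  by rewrite mulr_ge0 ?exprn_ge0// invr_ge0 ler0n.
rewrite -(cvg_lim _ (@exp_series_cvg u))//.
by apply: nondecreasing_cvgn_le nd _ K; exact: is_cvg_series_exp_coeff.
Qed.

(* Let the transform of chi vanish, hence also that of chi' on the nonnegative
   reals.  With N = n + 1, u_n(y) = N exp(N (x - y)) and the exponential series,
   exp(-u_n(y)) is a sum of multiples of the exponentials exp(-k N y), so that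
   int chi' exp(-u_n) = 0 for every n.  As n grows, exp(-u_n) tends to the
   indicator of y > x; the factor N makes the limit 0 also at y = x.  Hence
   the integral of chi' from x to infinity, which is - chi(x), vanishes. *)
Section Doetsch.
Variables (chi chi' : R -> CR) (x : R).
Hypotheses (x0 : 0 < x) (Sc : forall n, schwartz n chi) (Sc' : forall n, schwartz n chi').
Hypothesis dc : forall y, 0 < y -> is_cderive chi y (chi' y).
Hypothesis L0 : forall z, rhp z -> Lap chi z = 0.

Let u (n : nat) (y : R) : R := n.+1%:R * expR (n.+1%:R * (x - y)).

Let u_ge0 n y : 0 <= u n y. Proof. by rewrite mulr_ge0// expR_ge0. Qed.

Let L0' (k : R) : 0 <= k -> Lap chi' k%:C = 0.
Proof.
move=> k0; have Rk : 0 <= Re (k%:C : CR) by [].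
rewrite (Lap_parts (Sc 2) (Sc' 2) dc Rk).
move: k0; rewrite le_eqVlt => /predU1P[<-|k0]; first by rewrite mul0r.
by rewrite L0 ?mulr0.
Qed.

(** The terms of the exponential series of -u_n are themselves multiples of
    exponentials of y. *)
Let term n k : exists c : R, forall y, exp_coeff (- u n y) k =
  c * expR (- (k%:R * n.+1%:R * y)).
Proof.
exists ((-1) ^+ k * n.+1%:R ^+ k * expR (k%:R * (n.+1%:R * x)) / k`!%:R) => y.
rewrite /exp_coeff /= /u [in LHS]exprNn [in LHS]exprMn -expRM_natl.
have -> : k%:R * (n.+1%:R * (x - y)) =
    k%:R * (n.+1%:R * x) + - (k%:R * n.+1%:R * y) by ring.
by rewrite expRD; ring.
Qed.

Let partial0 n K : cint Rpos (fun y => chi' y * (series (exp_coeff (- u n y)) K)%:C) /\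
  cintegral Rpos (fun y => chi' y * (series (exp_coeff (- u n y)) K)%:C) = 0.
Proof.
have zero : cint Rpos (fun y => chi' y * (0 : R)%:C) /\
  cintegral Rpos (fun y => chi' y * (0 : R)%:C) = 0.
  have i := schwartz_cint (Sc' 1).
  split; first by apply: eq_cint (cintZ 0 mRp i) => // y _; rewrite mul0r mulr0.
  transitivity (cintegral Rpos (fun y => 0 * chi' y)).
    by apply: eq_cintegral => y _; rewrite mul0r mulr0.
  by rewrite (cintegralZ 0 mRp i) mul0r.
elim: K => [|K [IHi IH]].
  have E0 y : series (exp_coeff (- u n y)) 0 = 0 by rewrite /series /= big_geq.
  split; first by apply: (eq_cint mRp _ zero.1) => y _; rewrite E0.
  by rewrite -[RHS]zero.2; apply: eq_cintegral => y _; rewrite E0.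
have [c hc] := term n K.
have k0 : 0 <= K%:R * n.+1%:R :> R by rewrite mulr_ge0.
have Rk : 0 <= Re ((K%:R * n.+1%:R : R)%:C : CR) by [].
have iL := Lap_int (Sc' 1) Rk.
have E y : Rpos y -> chi' y * (series (exp_coeff (- u n y)) K)%:C +
   c%:C * (chi' y * cexp (- ((K%:R * n.+1%:R : R)%:C * y%:C))) =
   chi' y * (series (exp_coeff (- u n y)) K.+1)%:C.
  move=> _; rewrite -rmorphM -rmorphN cexp_real mulrCA -rmorphM -mulrDr -rmorphD -hc.
  by rewrite /series /= [in RHS]big_nat_recr.
split; first exact: eq_cint mRp E (cintD mRp IHi (cintZ _ mRp iL)).
rewrite -(eq_cintegral E) (cintegralD mRp IHi (cintZ _ mRp iL)) IH add0r.
by rewrite (cintegralZ _ mRp iL) -/(Lap chi' _) L0' ?mulr0.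
Qed.

Let whole0 n : cintegral Rpos (fun y => chi' y * (expR (- u n y))%:C) = 0.
Proof.
pose B := expR (n.+1%:R * expR (n.+1%:R * x)).
have uB y : 0 < y -> expR (u n y) <= B.
  move=> y0; rewrite ler_expR ler_wpM2l// ler_expR ler_wpM2l// lerBlDr lerDl.
  exact: ltW.
have [||_ h] := @cdom_cvg R Rpos (fun K y => chi' y * (series (exp_coeff (- u n y)) K)%:C)
  (fun y => chi' y * (expR (- u n y))%:C) (fun y => B * nrm (chi' y)) mRp
  (fun K => cint_meas (partial0 n K).1) (rintZ B mRp (schwartz_nrm_int (Sc' 1))).
- move=> K y /RposP y0; rewrite nrmM nrm_real mulrC ler_wpM2r ?nrm_ge0//.
  exact: le_trans (exp_series_bound K (u_ge0 n y)) (uB y y0).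
- move=> y _; apply: cvgM; first exact: cvg_cst.
  apply/cvg_complexP; split => /=; last exact: cvg_cst.
  exact: exp_series_cvg.
by apply: (lim_of_cst h) => K; exact: (partial0 n K).2.
Qed.

Let cut_cvg y : 0 < y ->
  (expR (- u n y) : R) @[n --> \oo] --> (if x < y then 1 else 0 : R).
Proof.
move=> y0; have [xy|yx] := ltP x y.
  have u0 : u n y @[n --> \oo] --> (0 : R).
    have d0 : 0 < y - x by rewrite subr_gt0.
    apply/cvgrPdist_lt => e e0.
    apply: filterS (near_nat_ge (2 / ((y - x) ^+ 2 * e) + 1)) => n hn.
    rewrite sub0r normrN ger0_norm// /u; set N : R := n.+1%:R in hn *.
    have N0 : 0 < N by [].
    have -> : N * (x - y) = - (N * (y - x)) by ring.
    rewrite expRN ltr_pdivrMr ?expR_gt0//.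
    have v0 : 0 <= N * (y - x) by rewrite mulr_ge0// ltW.
    (* v^2 / 2 <= exp v beats the factor N of u_n. *)
    have := expR_ge1Dxn 1 v0; rewrite (_ : (2`!)%N = 2%N)// => h.
    set E := expR _ in h *.
    have h2 : (N * (y - x)) ^+ 2 / 2 < E by lra.
    have D0 : 0 < (y - x) ^+ 2 * e by rewrite mulr_gt0// exprn_gt0.
    have h3 : 2 < N * ((y - x) ^+ 2 * e).
      by rewrite -ltr_pdivrMr//; lra.
    have h4 : N * 2 < N * (N * ((y - x) ^+ 2 * e)) by rewrite ltr_pM2l.
    have h5 : e * ((N * (y - x)) ^+ 2 / 2) < e * E by rewrite ltr_pM2l.
    have -> : N = N * 2 / 2 by field.
    apply: le_lt_trans h5.
    have -> : e * ((N * (y - x)) ^+ 2 / 2) = N * (N * ((y - x) ^+ 2 * e)) / 2 by ring.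
    by rewrite ler_pM2r ?invr_gt0// ltW.
  have c := @continuous_expR R 0.
  have Nu0 : - u n y @[n --> \oo] --> (0 : R) by rewrite -oppr0; exact: cvgN u0.
  have := @cvg_comp _ _ _ (fun n => - u n y) (@expR R) _ (nbhs (0 : R)) _ Nu0 c.
  by rewrite expR0.
apply/cvgrPdist_lt => e e0.
apply: filterS (near_nat_ge (e^-1)) => n hn.
rewrite sub0r normrN ger0_norm ?expR_ge0// expRN.
have h1 : n.+1%:R <= u n y.
  rewrite /u ler_peMr//.
  have := expR_ge1Dx (n.+1%:R * (x - y)).
  have : 0 <= n.+1%:R * (x - y) by rewrite mulr_ge0// subr_ge0.
  lra.
have h2 := expR_ge1Dx (u n y).
have e1 : 0 < e^-1 by rewrite invr_gt0.
rewrite -[ltRHS]invrK ltf_pV2 ?posrE ?expR_gt0//; lra.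
Qed.

Lemma Doetsch_zero : chi x = 0.
Proof.
have mE n : cmeas Rpos (fun y => chi' y * (expR (- u n y))%:C).
  apply: (cmeasM (schwartz_meas (Sc' 1))); apply: cmeas_real.
  apply: (rmeas_comp (@continuous_expR R)).
  apply: (@rmeas_comp R _ (fun y : TR => y) (fun y : R => - u n y)); last exact: measurable_id.
  move=> y; have d : is_derive y 1 (fun y : R => n.+1%:R * x + (- n.+1%:R) * y) (- n.+1%:R).
    exact: is_derive_affine.
  have d2 := @is_derive1_comp R (@expR R) _ y _ _ (is_derive_expR _) d.
  have [d3 _] := is_deriveZ (- n.+1%:R) d2.
  have -> : (fun y => - u n y) = (- n.+1%:R) *:
      (@expR R \o (fun y : R => n.+1%:R * x + (- n.+1%:R) * y)).
    apply/funext => t; rewrite /u /GRing.scale/= -mulNr; congr (_ * expR _); ring.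
  exact: (differentiable_continuous (iffLR (derivable1_diffP _ _) d3)).
have [||_ h] := @cdom_cvg R Rpos (fun n y => chi' y * (expR (- u n y))%:C)
  (fun y => chi' y * (if x < y then 1 else 0 : R)%:C) (fun y => nrm (chi' y)) mRp mE
  (schwartz_nrm_int (Sc' 1)).
- move=> n y /RposP y0; rewrite nrmM nrm_real ler_piMr ?nrm_ge0//.
  by rewrite ger0_norm ?expR_ge0// expR_le1 oppr_le0.
- move=> y /RposP y0; apply: cvgM; first exact: cvg_cst.
  apply/cvg_complexP; split => /=; last exact: cvg_cst.
  exact: cut_cvg.
have Z : cintegral Rpos (fun y => chi' y * (if x < y then 1 else 0 : R)%:C) = 0.
  by apply: (lim_of_cst h) => n; exact: whole0.
pose A : set TR := `]x, +oo[%classic.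
have mA : measurable A by exact: measurable_itv.
have AR : A `<=` Rpos.
  by move=> y; rewrite /A /= !in_itv/= !andbT; exact: lt_trans.
have ZA : cintegral A chi' = 0.
  rewrite -Z cintegral_mkcond [RHS]cintegral_mkcond; apply: eq_cintegral => y _.
  rewrite !patchE; have [yA|yA] := boolP (y \in A).
    rewrite mem_set; last by apply: AR; exact: set_mem.
    by move: yA; rewrite inE /A /= in_itv/= andbT => ->; rewrite mulr1.
  have nxy : (x < y) = false.
    apply/negbTE; apply: contra yA => xy; rewrite inE /A /= in_itv/= andbT.
    exact: xy.
  by rewrite nxy; case: ifP => // _; rewrite mulr0.
have i : cint A chi'.
  have [i1 i2] := schwartz_cint (Sc' 1).
  by split; [exact: integrableS mRp mA AR i1 | exact: integrableS mRp mA AR i2].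
have [_ [c'' [dc' _]]] := Sc' 1.
have dA y : A y -> is_cderive chi y (chi' y) by move=> /AR/RposP; exact: dc.
have cA y : A y -> {for y, continuous chi'}.
  by move=> /AR/RposP y0; exact: is_cderive_continuous (dc' y y0).
have H := @cintegral_exhaust R A _ _ chi' chi (0 - chi x) mA (exhausts_oy x) dA cA i.
suff : cintegral A chi' = 0 - chi x.
  by rewrite ZA sub0r => /esym/eqP; rewrite oppr_eq0 => /eqP.
apply: H.
apply: cvgB; last first.
  have c := is_cderive_continuous (dc x0).
  have a : (x + n.+2%:R^-1 : R) @[n --> \oo] --> x.
    by rewrite -[X in _ --> X]addr0; exact: cvgD (cvg_cst x) (@cvg_inv_nat R).
  exact: (@cvg_comp _ _ _ (fun n : nat => (x + n.+2%:R^-1 : R)) chi _ (nbhs x) _ a c).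
  have [M M0 hM] := flat_ge0 (-1) (schwartz_flat (Sc 0)).
  apply/cvg_nrmP => e e0; apply: filterS (near_nat_ge (M / e + 1)) => n hn.
  rewrite sub0r nrmN; set y : R := x + n.+2%:R.
  have y0 : 0 < y by rewrite addr_gt0.
  have yn : M / e < y.
    have h1 : n.+1%:R <= y.
      apply: (@le_trans _ _ n.+2%:R); first by rewrite ler_nat.
      by rewrite /y lerDr ltW.
    by apply: lt_le_trans h1; lra.
  apply: le_lt_trans (hM y y0) _; rewrite (powR_invn 1 (ltW y0)) expr1.
  by rewrite ltr_pdivrMr// mulrC -ltr_pdivrMr.
Qed.
End Doetsch.

Lemma Lap_inj phi psi : (forall n, schwartz n phi) -> (forall n, schwartz n psi) ->
  (forall z, rhp z -> Lap phi z = Lap psi z) ->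
  forall x, 0 < x -> phi x = psi x.
Proof.
move=> Sp Sq e x x0.
pose chi x := phi x + (-1) * psi x.
have Sc n : schwartz n chi by apply: schwartzD => //; exact: schwartzZ.
have [chi' [dc Sc']] := schwartz_deriv Sc.
have L0 z : rhp z -> Lap chi z = 0.
  move=> z0; have z1 := ltW z0.
  rewrite (LapD (Sp 1%N) (schwartzZ (-1) (Sq 1%N)) z1) (LapZ (-1) (Sq 1%N) z1) e//.
  by rewrite mulN1r subrr.
have := Doetsch_zero x0 Sc Sc' dc L0.
by rewrite /chi mulN1r => /eqP; rewrite subr_eq0 => /eqP.
Qed.

Lemma invLap_Lap0 phi : (forall n, schwartz n phi) ->
  forall x, 0 < x -> invLap (Lap0 phi) x = phi x.
Proof.
move=> Sp; have HK0 := spaceK_hardy (Lap0_spaceK Sp).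
apply: Lap_inj => //; first by move=> n; exact: invLap_schwartz.
by move=> z z0; rewrite Lap_invLap// /Lap0 ltW.
Qed.

End LaplaceInjective.

(** * Fractional differentiation *)
Section FractionalDerivative.
Variable R : realType.
Local Notation mu := (@lebesgue_measure R).
Local Notation TR := (measurableTypeR R).
Local Notation CR := (R[i]^o).
Local Notation Re := (@complex.Re R).
Local Notation Im := (@complex.Im R).
Local Notation Rpos := (`]0, +oo[%classic : set TR).
Local Notation mRp := (@mRpos R).
Local Notation iC := (Num.imaginary : CR).
Implicit Types (z w h s : CR) (phi psi : R -> CR) (f : CR -> CR).

(** On the imaginary axis, f and z^2 f together control (1 + t^2) f. *)
Lemma bdry_rapid f k : (forall n, hardy n f) -> exists2 M : R, 0 <= M &
  forall t, nrm (f (pt 0 t)) <= M * (1 + t ^+ 2) ^- k.+1.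
Proof.
elim: k f => [|k IH] f Hf; first exact: bdry_line (hardy_rapid (Hf 0%N)) (hardy_bcont (Hf 0%N)).
have Hz n : hardy n (fun w => w * (w * f w)) by exact/hardy_mulz/hardy_mulz.
have [M M0 h] := IH f Hf; have [M' M'0 h'] := IH _ Hz.
exists (M + M'); first exact: addr_ge0.
move=> t; have t0 : 0 < 1 + t ^+ 2 by rewrite ltr_pwDl// sqr_ge0.
rewrite exprSr invfM mulrA ler_pdivlMr//.
rewrite mulrDr mulr1 mulrDl lerD//.
have := h' t; rewrite !nrmM pt0 nrm_im -pt0 mulrA -expr2 real_normK ?num_real//.
by rewrite mulrC.
Qed.

(** |w^s| = |w|^(Re s) exp(- Im s arg w), where the argument is bounded by pi and
    |w| lies between Re z and a multiple of 1 + t^2. *)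
Lemma cpow_growth z s : rhp z -> exists K : nat, exists2 C : R, 0 <= C &
  forall t : R, nrm (cpow (z - pt 0 t) s) <= C * (1 + t ^+ 2) ^+ K.
Proof.
move=> z0; pose p := Re z; have p0 : 0 < p by [].
have [K hK] : exists K : nat, `|Re s| <= K%:R.
  by exists (Num.truncn `|Re s|).+1; rewrite ltW// truncnS_gt.
have n1 : 0 < 1 + nrm z by exact: one_nrm_gt0.
exists K; exists (expR (`|Im s| * pi) * ((1 + nrm z) ^+ K + p ^- K)).
  by rewrite mulr_ge0 ?expR_ge0// addr_ge0 ?invr_ge0 ?exprn_ge0// ltW.
move=> t; set w := z - pt 0 t.
have Rw : Re w = p by rewrite ReD ReN Re_pt subr0.
have wp : p <= nrm w by rewrite -Rw (le_trans (ler_norm _))// nrm_Re.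
have w0 : 0 < nrm w by exact: lt_le_trans wp.
have t1 : 1 <= 1 + t ^+ 2 by rewrite lerDl sqr_ge0.
have wt : nrm w <= (1 + nrm z) * (1 + t ^+ 2).
  have h1 : nrm w <= nrm z + `|t| by rewrite -nrm_im -pt0 nrmB.
  have h2 : `|t| <= 1 + t ^+ 2.
    by rewrite -[t ^+ 2]real_normK ?num_real//; have := sqr_ge0 (`|t| - 1); nra.
  by have := nrm_ge0 z; nra.
rewrite nrm_cexp ReM Re_clog.
have e1 : expR (Re s * ln (nrm w)) <= (1 + nrm z) ^+ K * (1 + t ^+ 2) ^+ K + p ^- K.
  have -> : expR (Re s * ln (nrm w)) = nrm w `^ Re s by rewrite /powR gt_eqF.
  have [s1 s2] : Re s <= K%:R /\ - K%:R <= Re s.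
    by move: hK; rewrite ler_norml => /andP[].
  have [w1|w1] := leP 1 (nrm w).
    apply: (le_trans (ler_powR w1 s1)); rewrite (powR_mulrn K (ltW w0)) -exprMn.
    rewrite ler_wpDr ?invr_ge0 ?exprn_ge0 ?(ltW p0)//.
    by apply: lerXn2r; rewrite ?nnegrE ?(ltW w0) ?mulr_ge0 ?(ltW n1)// (le_trans ler01).
  have w01 : 0 < nrm w <= 1 by rewrite w0 ltW.
  apply: (le_trans (ger_powR w01 s2)); rewrite (powR_invn K (ltW w0)).
  rewrite ler_wpDl ?mulr_ge0 ?exprn_ge0 ?(ltW n1) ?(le_trans ler01)//.
  by rewrite lef_pV2 ?posrE ?exprn_gt0// lerXn2r ?nnegrE ?(ltW w0) ?(ltW p0).
have e2 : expR (- (Im s * Im (clog w))) <= expR (`|Im s| * pi).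
  rewrite ler_expR (le_trans (ler_norm _))// normrN normrM ler_wpM2l//.
  rewrite /clog /= ler_norml; have := atan_ltpi2 (Im w / Re w).
  have := atan_gtNpi2 (Im w / Re w); have := pi_gt0 R.
  by move=> h1 h2 h3; apply/andP; split; lra.
rewrite expRD mulrC -mulrA; apply: ler_pM; rewrite ?expR_ge0//.
apply: (le_trans e1); rewrite mulrDl lerD2l ler_peMr ?invr_ge0 ?exprn_ge0 ?(ltW p0)//.
exact: exprn_ege1.
Qed.

Lemma is_cderive_cpow_line z s t : rhp z ->
  is_cderive (fun t : R => cpow (z - pt 0 t) s) t (- (s * iC) * cpow (z - pt 0 t) (s - 1)).
Proof.
move=> z0; have E y : z - pt 0 y = z + y%:C * (- iC) by rewrite /pt rmorph0; ring.
have Rw : 0 < Re (z - pt 0 t) by rewrite ReD ReN Re_pt subr0.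
have d : is_cderive (fun t : R => z - pt 0 t) t (- iC).
  have -> : (fun t : R => z - pt 0 t) = (fun t : R => z + t%:C * (- iC)).
    by apply/funext => y; rewrite E.
  exact: is_cderive_affine.
apply: is_cderive_eq (is_cderive_cpow s d Rw) _.
have E2 : cpow (z - pt 0 t) s = cpow (z - pt 0 t) (s - 1) * (z - pt 0 t).
  by rewrite -[in LHS](subrK 1 s) (cpowD _ (s - 1) 1) (cpow1 Rw).
have wn0 := nrm_Re_gt0 Rw.
by rewrite E2; field.
Qed.

Lemma line_prod f z s : (forall n, hardy n f) -> rhp z -> exists2 M : R, 0 <= M &
  forall t : R, nrm (f (pt 0 t) * cpow (z - pt 0 t) s) <= M * (1 + t ^+ 2)^-1.
Proof.
move=> Hf z0; have [K [C C0 hC]] := cpow_growth s z0.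
have [M M0 hM] := bdry_rapid K Hf.
exists (M * C); first exact: mulr_ge0.
move=> t; have t0 : 0 < 1 + t ^+ 2 by rewrite ltr_pwDl// sqr_ge0.
rewrite nrmM; apply: (le_trans (ler_pM (nrm_ge0 _) (nrm_ge0 _) (hM t) (hC t))).
rewrite le_eqVlt; apply/orP; left; apply/eqP.
by rewrite exprSr; field; rewrite expf_neq0 ?gt_eqF.
Qed.

Lemma line_prod_cint f z s : (forall n, hardy n f) -> rhp z ->
  cint setT (fun t : TR => f (pt 0 t) * cpow (z - pt 0 t) s).
Proof.
move=> Hf z0; have [M M0 h] := line_prod s Hf z0.
apply: (cint_dom measurableT _ (rintZ M measurableT (rint_cauchy R))).
  apply: cmeasM; first exact: bdry_meas (Hf 1%N).
  apply: cmeas_continuous openT _ => t _.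
  exact: is_cderive_continuous (is_cderive_cpow_line s t z0).
by move=> t _; exact: h.
Qed.

Lemma cpowN z s : cpow z (- s) = (cpow z s)^-1.
Proof. by rewrite /cpow mulNr cexpN. Qed.

Lemma fracD_formulaE h f z : fracD_formula h f z =
  cGamma (h + 1) / (2 * pi)%:C *
  cintegral setT (fun t : TR => f (pt 0 t) * cpow (z - pt 0 t) (- (h + 1))).
Proof.
by congr (_ * _); apply: eq_cintegral => t _; rewrite cpowN -pt0 addrC.
Qed.

Lemma powexp_cis h z (t x : R) :
  powexp h (z - pt 0 t) x = powexp h z x * cis (t * x).
Proof. by rewrite /powexp -mulrA cis_cexpx. Qed.

(** Write Gamma(h+1) (z - it)^-(h+1) as Euler's integral, then exchange the two
    integrals. *)
Lemma fracD_formula_right h f z : (forall n, hardy n f) -> -1 < Re h -> rhp z ->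
  fracD_formula h f z = Lap (fun x => cpow x%:C h * invLap f x) z.
Proof.
move=> Hf h1 z0; rewrite fracD_formulaE.
have i1 := line_prod_cint (- (h + 1)) Hf z0.
have ig : cint Rpos (powexp h z) by exact: cint_powexp.
have FB := fubini_cis mRp (bdry_cint (Hf 1%N)) ig (@measurable_id _ TR Rpos).
rewrite mulrAC -(cintegralZ _ measurableT i1).
have -> : cintegral setT (fun t : TR => cGamma (h + 1) * (f (pt 0 t) * cpow (z - pt 0 t) (- (h + 1)))) =
  cintegral setT (fun t : TR => f (pt 0 t) * cintegral Rpos (fun x : TR => powexp h z x * cis (t * id x))).
  apply: eq_cintegral => t _; rewrite mulrCA; congr (_ * _).
  have Rw : 0 < Re (z - pt 0 t) by rewrite ReD ReN Re_pt subr0.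
  rewrite (cpowN _ (h + 1)) (cGammaE h1) -(Euler_integralE h1 Rw) /Euler_integral.
  by apply: eq_cintegral => x _; rewrite powexp_cis.
rewrite FB /Lap {FB i1 ig}.
have iL : cint Rpos (fun x => cpow x%:C h * invLap f x * cexp (- (z * x%:C))).
  have z1 : 0 <= Re z := ltW z0.
  have Sx : schwartz 2 (fun x => cpow x%:C h * invLap f x).
    by apply: schwartz_cpow; exact: invLap_schwartz.
  exact: Lap_int Sx z1.
have pn0 := twopi_neq0 R.
apply: (mulfI pn0); rewrite [LHS]mulrC (mulfVK pn0) -(cintegralZ _ mRp iL).
apply: eq_cintegral => x _.
have alg (c e I q : CR) : q != 0 -> c * e * I = q * (c * (q^-1 * I) * e).
  by move=> q0; field.
by rewrite /invLap fmorphV; exact: alg.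
Qed.

Lemma Lap_line_deriv phi (t : R) : (forall n, schwartz n phi) ->
  is_cderive (fun t : R => Lap phi (pt 0 t)) t (- iC * Lap (mulX phi) (pt 0 t)).
Proof.
move=> Sp; have Rp y : 0 <= Re (pt 0 y : CR) by rewrite Re_pt.
rewrite /Lap -(cintegralZ _ mRp (Lap_int (schwartz_mulX (Sp 1%N)) (Rp t))).
have tI : t \in `](t - 1), (t + 1)[ by rewrite in_itv/=; apply/andP; split; lra.
apply: (@cdiff_under R Rpos (fun y x => phi x * cexp (- (pt 0 y * x%:C)))
  (fun y x => - iC * (mulX phi x * cexp (- (pt 0 y * x%:C))))
  (fun x => nrm (mulX phi x)) t _ _ mRp tI).
- by move=> y _; exact: Lap_int (Sp 1%N) (Rp y).
- move=> y x _ _.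
  have d1 : is_cderive (fun y => pt 0 y : CR) y iC.
    have := is_cderiveD (is_cderive_cst (0%:C) y) (is_cderiveM (is_cderive_id y) (is_cderive_cst iC y)).
    by move/is_cderive_eq; apply; rewrite add0r mulr0 addr0 mul1r.
  have d2 := is_cderive_cexp (is_cderiveN (is_cderiveM d1 (is_cderive_cst x%:C y))).
  apply: is_cderive_eq (is_cderiveZ (phi x) d2) _.
  by rewrite /mulX; ring.
- exact: schwartz_nrm_int (schwartz_mulX (Sp 1%N)).
- move=> y x _ /RposP x0; rewrite nrmM nrmN nrm_i mul1r nrmM ler_piMr ?nrm_ge0//.
  exact: nrm_cexpx_le1.
Qed.

(** Integration by parts along the imaginary axis, - F being a complex
    antiderivative of f; the factor h + 1 that comes out is the quotient of the
    two Gamma values. *)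
Lemma fracD_formula_shift f F h z : (forall n, hardy n f) -> (forall n, hardy n F) ->
  (forall t : R, is_cderive (fun t => F (pt 0 t)) t (- iC * f (pt 0 t))) ->
  {in setT, continuous (fun t : R => f (pt 0 t))} ->
  Re (h + 1) <= 0 -> h + 1 != 0 -> rhp z ->
  fracD_formula h f z = fracD_formula (h + 1) F z.
Proof.
move=> Hf HF dF cf h1 h0 z0; rewrite !fracD_formulaE (cGamma_rec h1 h0).
have i1 := line_prod_cint (- (h + 1)) Hf z0.
have i2 := line_prod_cint (- (h + 1 + 1)) HF z0.
suff E : cintegral setT (fun t : TR => f (pt 0 t) * cpow (z - pt 0 t) (- (h + 1))) =
  (h + 1) * cintegral setT (fun t : TR => F (pt 0 t) * cpow (z - pt 0 t) (- (h + 1 + 1))).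
  have alg (a G q I : CR) : G * q * (a * I) = a * G * q * I by ring.
  by rewrite E; exact: alg.
(* Both sides are multiplied by -i, the derivative of z - it. *)
pose k := - iC : CR.
have kn0 : k != 0 by rewrite -nrm_eq0 nrmN nrm_i oner_eq0.
apply: (mulfI kn0); apply/eqP; rewrite -subr_eq0 mulrA; apply/eqP.
rewrite -!cintegralZ// -cintegralB//; [|exact: cintZ..].
have dP t : is_cderive (fun t : R => F (pt 0 t) * cpow (z - pt 0 t) (- (h + 1))) t
  (k * (f (pt 0 t) * cpow (z - pt 0 t) (- (h + 1))) -
   k * (h + 1) * (F (pt 0 t) * cpow (z - pt 0 t) (- (h + 1 + 1)))).
  apply: is_cderive_eq (is_cderiveM (dF t) (is_cderive_cpow_line (- (h + 1)) t z0)) _.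
  have -> : - (h + 1) - 1 = - (h + 1 + 1) by ring.
  by rewrite /k; ring.
apply: (@cintegral_exhaust R setT _ _ _ (fun t : R => F (pt 0 t) * cpow (z - pt 0 t) (- (h + 1)))
  0 measurableT (exhausts_T R) (fun t _ => dP t)).
- move=> t _; apply: cvgB.
    apply: cvgM; first exact: cvg_cst.
    apply: cvgM; first by apply: cf; rewrite inE.
    exact: is_cderive_continuous (is_cderive_cpow_line (- (h + 1)) t z0).
  apply: cvgM; first exact: cvg_cst.
  apply: cvgM; first exact: is_cderive_continuous (dF t).
  exact: is_cderive_continuous (is_cderive_cpow_line (- (h + 1 + 1)) t z0).
- by apply: cintB => //; exact: cintZ.
- have [M M0 hM] := line_prod (- (h + 1)) HF z0.
  exact: (@cauchy_cvg0 R M (fun t : R => F (pt 0 t) * cpow (z - pt 0 t) (- (h + 1)))).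
Qed.

(** Induction on n lowers Re h by one at each step: f is replaced by the transform
    F of phi / x, for which the weight x^(h+1) gives back x^h phi. *)
Lemma fracD_formula_Lap n h f z : spaceK f -> - n.+1%:R < Re h ->
  (forall m : nat, h <> - m.+1%:R) -> rhp z ->
  fracD_formula h f z = Lap (fun x => cpow x%:C h * invLap f x) z.
Proof.
elim: n h f => [|n IH] h f Kf hn hm z0; have Hf := spaceK_hardy Kf.
  exact: fracD_formula_right.
have [h1|h1] := ltP (-1) (Re h); first exact: fracD_formula_right.
have Sf n' : schwartz n' (invLap f) by exact: invLap_schwartz.
pose chi x := cpow x%:C (-1 : CR) * invLap f x.
have Sc n' : schwartz n' chi by exact: schwartz_cpow.
have KF := Lap0_spaceK Sc; have HF := spaceK_hardy KF.
have Xc x : 0 < x -> mulX chi x = invLap f x.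
  move=> x0; have x1 : 0 < Re (x%:C : CR) by [].
  have := cpowD (x%:C : CR) 1 (-1); rewrite subrr cpow0 (cpow1 x1) => e.
  by rewrite /mulX /chi mulrA -e mul1r.
have Lpt phi t : Lap0 phi (pt 0 t) = Lap phi (pt 0 t) by rewrite /Lap0 Re_pt lexx.
have fE t : f (pt 0 t) = Lap (invLap f) (pt 0 t) by rewrite {1}(spaceK_Lap0 Kf) Lpt.
have dF (t : R) : is_cderive (fun t => Lap0 chi (pt 0 t)) t (- iC * f (pt 0 t)).
  have -> : (fun t => Lap0 chi (pt 0 t)) = (fun t => Lap chi (pt 0 t)).
    by apply/funext => y; exact: Lpt.
  rewrite fE -(eq_Lap _ Xc); exact: Lap_line_deriv.
have cf : {in setT, continuous (fun t : R => f (pt 0 t))}.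
  move=> t _; have -> : (fun t : R => f (pt 0 t)) = (fun t : R => Lap (invLap f) (pt 0 t)).
    by apply/funext => y; exact: fE.
  exact: is_cderive_continuous (Lap_line_deriv t Sf).
have h2 : Re (h + 1) <= 0 by rewrite ReD /=; lra.
have h3 : h + 1 != 0.
  by apply/eqP => e; apply: (hm 0%N); apply/eqP; rewrite -subr_eq0 opprK; apply/eqP.
rewrite (fracD_formula_shift Hf HF dF cf h2 h3 z0).
have hn' : - n.+1%:R < Re (h + 1) by rewrite ReD /=; move: hn; rewrite -!natr1; lra.
have hm' m : h + 1 <> - m.+1%:R.
  by move=> e; apply: (hm m.+1); apply: (addIr 1); rewrite e -[in RHS]natr1; ring.
rewrite (IH _ _ KF hn' hm' z0).
apply: eq_Lap => x x0; rewrite (invLap_Lap0 Sc x0) /chi mulrA -cpowD.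
by congr (cpow _ _ * _); ring.
Qed.

(** The sum on the right dominates exp(2 |l|): one |l| in the
    exponent bounds exp(k l), the other absorbs the factor |l| of the mean value
    inequality.  With l = ln x it becomes x^2 + x^-2. *)
Lemma expline_bound (k : CR) (l : R) : nrm k <= 1 ->
  nrm (cexp (k * l%:C) - 1) <= 2 * nrm k * (expR (2 * l) + expR (- (2 * l))).
Proof.
move=> k1.
have := @cMVT_bound R (fun y => cexp (y%:C * (k * l%:C))) (fun y => k * l%:C * cexp (y%:C * (k * l%:C)))
  0 1 (nrm k * (expR (2 * l) + expR (- (2 * l)))) ler01.
rewrite rmorph1 rmorph0 mul1r mul0r cexp0 subr0 mulr1 => H.
rewrite -[X in _ <= X]mulrA; apply: H.
  move=> y _; have d := is_cderiveM (is_cderive_id y) (is_cderive_cst (k * l%:C) y).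
  by apply: is_cderive_eq (is_cderive_cexp d) _; rewrite mulr0 addr0 mul1r.
move=> y; rewrite in_itv/= => /andP[y0 y1].
rewrite nrmM nrmM nrm_real nrm_cexp -mulrA ler_wpM2l ?nrm_ge0//.
have a0 := normr_ge0 l.
have e1 : expR (Re (y%:C * (k * l%:C))) <= expR `|l|.
  rewrite ler_expR (le_trans (ler_norm _))// (le_trans (nrm_Re _))//.
  rewrite !nrmM !nrm_real ger0_norm//; have := nrm_ge0 k.
  move=> k0; have : y * nrm k <= 1 by nra.
  by rewrite mulrA => ?; rewrite ler_piMl.
have e2 : `|l| <= expR `|l| by have := expR_ge1Dx `|l|; lra.
apply: (le_trans (ler_pM a0 (expR_ge0 _) e2 e1)); rewrite -expRD.
have [l0|l0] := leP 0 l.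
  rewrite ger0_norm//; have -> : l + l = 2 * l by ring.
  by rewrite lerDl expR_ge0.
rewrite ltr0_norm//; have -> : - l + - l = - (2 * l) by ring.
by rewrite lerDr expR_ge0.
Qed.

(** Near h0, x^h - x^h0 is bounded by |h - h0| times x^(h0+2) + x^(h0-2), and phi
    times each of these powers is still flat. *)
Lemma Lap_cpow_cont phi (h0 z : CR) : (forall n, schwartz n phi) -> rhp z ->
  Lap (fun x => cpow x%:C h * phi x) z @[h --> (h0 : CR)] --> Lap (fun x => cpow x%:C h0 * phi x) z.
Proof.
move=> Sp z0; have z1 := ltW z0.
set psi1 := fun x : R => cpow x%:C (h0 + 2) * phi x.
set psi2 := fun x : R => cpow x%:C (h0 - 2) * phi x.
have S1 n : schwartz n psi1 by exact: schwartz_cpow.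
have S2 n : schwartz n psi2 by exact: schwartz_cpow.
set C := 4 * (L1nrm psi1 + L1nrm psi2).
have C0 : 0 <= C by rewrite mulr_ge0// addr_ge0 ?L1nrm_ge0.
have bnd h : nrm (h - h0) <= 1 ->
  nrm (Lap (fun x => cpow x%:C h * phi x) z - Lap (fun x => cpow x%:C h0 * phi x) z)
   <= C * nrm (h - h0).
  move=> k1; have i1 := Lap_int (schwartz_cpow h (Sp 1%N)) z1; have i2 := Lap_int (schwartz_cpow h0 (Sp 1%N)) z1.
  have m1 := schwartz_nrm_int (S1 1%N); have m2 := schwartz_nrm_int (S2 1%N).
  rewrite /Lap -(cintegralB mRp i1 i2).
  have -> : C * nrm (h - h0) = 2 * \int[mu]_(x in Rpos) ((2 * nrm (h - h0)) * (nrm (psi1 x) + nrm (psi2 x))).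
    rewrite (RintegralZl _ mRp (rintD mRp m1 m2)) (RintegralD mRp m1 m2) -/(L1nrm psi1) -/(L1nrm psi2).
    by rewrite /C; ring.
  apply: nrm_cintegral.
  - exact: mRp.
  - exact: cintB mRp i1 i2.
  - exact: rintZ mRp (rintD mRp m1 m2).
  move=> x /RposP x0; rewrite -mulrBl nrmM -mulrBl nrmM.
  apply: (@le_trans _ _ (nrm (cpow x%:C h - cpow x%:C h0) * nrm (phi x))).
    by rewrite ler_piMr ?mulr_ge0 ?nrm_ge0//; exact: nrm_cexpx_le1.
  have -> : cpow x%:C h = cpow x%:C h0 * cexp ((h - h0) * (ln x)%:C).
    by rewrite /cpow clog_real// -cexpD -mulrDl addrC subrK.
  rewrite -[X in nrm (_ - X)]mulr1 -mulrBr nrmM.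
  have := expline_bound (ln x) k1.
  have xE r : expR (r * ln x) = x `^ r by rewrite /powR gt_eqF.
  have -> : - (2 * ln x) = (- 2) * ln x by rewrite mulNr.
  rewrite !xE => e.
  rewrite /psi1 /psi2 (nrmM (cpow x%:C (h0 + 2)) (phi x)) (nrmM (cpow x%:C (h0 - 2)) (phi x)).
  rewrite !nrm_cpow_real//.
  have -> : Re (h0 + 2) = Re h0 + 2 by rewrite ReD.
  have -> : Re (h0 - 2) = Re h0 - 2 by rewrite ReD.
  have pD r : x `^ (Re h0 + r) = x `^ Re h0 * x `^ r.
    by rewrite powRD// (gt_eqF x0) implybT.
  rewrite !pD; have a0 := powR_ge0 x (Re h0); have b0 := nrm_ge0 (phi x).
  have := ler_wpM2l (mulr_ge0 a0 b0) e.
  lra.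
apply/(cvg_nrmP (FF := nbhs_filter (h0 : CR))) => e e0.
have d0 : 0 < Num.min 1 (e / (C + 1)) by rewrite lt_min ltr01 divr_gt0// ltr_wpDl.
have n0 := @near_nrm R h0 _ d0.
apply: (@filterS _ _ (nbhs_filter (h0 : CR)) _ _ _ n0) => h; rewrite lt_min => /andP[h1 h2].
rewrite nrmC; apply: le_lt_trans (bnd h _) _; first by rewrite nrmC ltW.
rewrite ltr_pdivlMr ?ltr_wpDl// nrmC in h2.
by have := nrm_ge0 (h - h0); lra.
Qed.

Lemma Re_gt_negnat h : exists n : nat, - n.+1%:R < Re h.
Proof.
exists (Num.truncn `|Re h|); rewrite ltrNl (le_lt_trans (ler_norm _))//.
by rewrite normrN truncnS_gt.
Qed.

Lemma near_negint m : \forall h \near (- m.+1%:R : CR)^', forall k : nat, h <> - k.+1%:R.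
Proof.
rewrite near_withinE; apply: filterS (@near_nrm R (- m.+1%:R) _ ltr01) => h h1 hm k hk.
move: h1 hm; rewrite hk => h1 hm; apply/negP: h1; rewrite -leNgt.
have E (j : nat) : - j.+1%:R = (- j.+1%:R : R)%:C :> CR by rewrite rmorphN rmorph_nat.
rewrite !E -rmorphB nrm_real opprK addrC.
have km : k != m by apply: contraNneq hm => ->.
have near1 (i j : nat) : (i < j)%N -> i%:R + 1 <= j%:R :> R.
  by rewrite natr1 ler_nat.
rewrite -!natr1; have [mk|mk] := ltnP m k.
  by rewrite ler_normr; apply/orP; left; have := near1 _ _ mk; lra.
have {}mk : (k < m)%N by rewrite ltn_neqAle km.
by rewrite ler_normr; apply/orP; right; have := near1 _ _ mk; lra.
Qed.

Lemma fracD_formula_cvg m f z : spaceK f -> rhp z ->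
  fracD_formula h f z @[h --> (- m.+1%:R : CR)^'] -->
  Lap (fun x => cpow x%:C (- m.+1%:R) * invLap f x) z.
Proof.
move=> Kf z0; have Sf n : schwartz n (invLap f) by exact: invLap_schwartz (spaceK_hardy Kf).
have c : Lap (fun x => cpow x%:C h * invLap f x) z @[h --> (- m.+1%:R : CR)^'] -->
    Lap (fun x => cpow x%:C (- m.+1%:R) * invLap f x) z.
  by apply: cvg_within_filter; exact: (Lap_cpow_cont (h0 := - m.+1%:R) Sf z0).
apply: cvg_trans c; apply: near_eq_cvg.
apply: filterS (near_negint m) => h hn.
have [n hN] := Re_gt_negnat h.
by rewrite (fracD_formula_Lap Kf hN hn z0).
Qed.

(** Negative integers h are reached by continuity, all others directly. *)
Lemma fracD_invLap h f : spaceK f -> fracD h f = Lap0 (fun x => cpow x%:C h * invLap f x).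
Proof.
move=> Kf; have Hf := spaceK_hardy Kf.
apply: bdext_Lap; first exact/schwartz_cpow/invLap_schwartz.
move=> z z0; rewrite /fracD_open; case: asboolP => [[m ->]|hn].
  by apply: cvg_lim => //; exact: fracD_formula_cvg.
have [n hN] := Re_gt_negnat h.
by apply: (fracD_formula_Lap Kf hN) => // m e; apply: hn; exists m.
Qed.

End FractionalDerivative.

(** * The operators on the Laplace side *)
Section Operators.
Variable R : realType.
Local Notation Re := (@complex.Re R).
Local Notation TR := (measurableTypeR R).
Local Notation CR := (R[i]^o).
Local Notation Rpos := (`]0, +oo[%classic : set TR).
Implicit Types (f g : CR -> CR) (h c z : CR) (phi psi : R -> CR) (r a : R).

Lemma spaceK_schwartz f : spaceK f -> forall n, schwartz n (invLap f).
Proof. by move=> Kf n; exact: invLap_schwartz (spaceK_hardy Kf). Qed.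

(** The kernel is the integral of exp(-zx) against exp(i t x^alpha). *)
Lemma opA_formula r f z : spaceK f -> r != 0 -> rhp z ->
  (2 * pi)^-1%:C * cintegral setT (fun t : R => kernelA r (- t *i) z * f (t *i)) =
  Lap (fun x => invLap f (x `^ r)) z.
Proof.
move=> Kf r0 z0; have Hf := spaceK_hardy Kf.
have mr : rmeas Rpos (fun x : TR => x `^ r).
  by apply: (measurable_funS (E := setT)) => //; exact: measurable_powR.
rewrite -[RHS](mulKf (twopi_neq0 R)).
rewrite -(Lap_invLap_comp Hf z0 mr (schwartz_powR r0 (spaceK_schwartz Kf 1%N))) fmorphV; congr (_ * _).
apply: eq_cintegral => t _; rewrite mulrC -pt0; congr (_ * _).
apply: eq_cintegral => x _; rewrite cis_pt0 -cexpD pt0; congr cexp.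
ring.
Qed.

Lemma opA_invLap r f : spaceK f -> r != 0 ->
  opA r f = Lap0 (fun x => invLap f (x `^ r)).
Proof.
move=> Kf r0; apply: bdext_Lap; first exact: schwartz_powR (spaceK_schwartz Kf _).
by move=> z; exact: opA_formula.
Qed.

Section Representation.
Variables (phi : R -> CR).
Hypothesis Sp : forall n, schwartz n phi.

Lemma opA_Lap r : r != 0 -> opA r (Lap0 phi) = Lap0 (fun x => phi (x `^ r)).
Proof.
move=> r0; rewrite (opA_invLap (Lap0_spaceK Sp) r0).
by apply: eq_Lap0 => x x0; rewrite invLap_Lap0// powR_gt0.
Qed.

Lemma fracD_Lap h : fracD h (Lap0 phi) = Lap0 (fun x => cpow x%:C h * phi x).
Proof.
rewrite (fracD_invLap h (Lap0_spaceK Sp)).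
by apply: eq_Lap0 => x x0; rewrite invLap_Lap0.
Qed.

Lemma mulz_Lap phi' : (forall n, schwartz n phi') ->
  (forall x, 0 < x -> is_cderive phi x (phi' x)) ->
  mulz (Lap0 phi) = Lap0 phi'.
Proof.
move=> Sp' d; apply/funext => z; rewrite /mulz /Lap0; case: ifP => z0.
  by rewrite (Lap_parts (Sp 2%N) (Sp' 2%N) d z0).
by rewrite mulr0.
Qed.

(** Instead of a change of variables: the inner integral in [Lap_invLap_comp] is
    1 / (z - iat), which is 1/a times the Cauchy kernel at z/a. *)
Lemma dilR_rhp a z : 0 < a -> rhp z ->
  a%:C^-1 * Lap phi (z / a%:C) = Lap (fun x => phi (a * x)) z.
Proof.
move=> a0 z0; have Hf := spaceK_hardy (Lap0_spaceK Sp).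
have aC0 : a%:C != 0 :> CR by rewrite -nrm_eq0 nrm_real normr_eq0 gt_eqF.
have za0 : 0 < Re (z / a%:C).
  by rewrite -fmorphV mulrC ReM /= mul0r subr0 mulr_gt0 ?invr_gt0.
have mm : rmeas Rpos (fun x : TR => a * x).
  by apply: measurable_funM => //; exact: measurable_id.
have Sm : schwartz 1 (fun x => invLap (Lap0 phi) (a * x)).
  exact: schwartz_dil (spaceK_schwartz (Lap0_spaceK Sp) 1%N).
have -> : Lap (fun x => phi (a * x)) z = Lap (fun x => invLap (Lap0 phi) (a * x)) z.
  by apply: eq_Lap => x x0; rewrite invLap_Lap0// mulr_gt0.
have -> : Lap phi (z / a%:C) = Lap0 phi (z / a%:C) by rewrite /Lap0 (ltW za0).
apply: (mulfI (twopi_neq0 R)).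
rewrite -(Lap_invLap_comp Hf z0 mm Sm) mulrCA -(cauchy_hardy Hf za0).
have ic : cint setT (fun t : TR => Lap0 phi (pt 0 t) / (z / a%:C - pt 0 t)).
  have iL := line_prod_cint (-1) Hf za0.
  apply: (eq_cint measurableT) iL => t _; congr (_ * _).
  by rewrite cpowN cpow1// ReD ReN Re_pt subr0.
rewrite -(cintegralZ _ measurableT ic); apply: eq_cintegral => t _; rewrite mulrCA; congr (_ * _).
under (eq_cintegral (A := Rpos)) => x _ do rewrite mulrA [t * a]mulrC cis_cexpx.
rewrite (int_exp _).2; last by rewrite ReD ReN Re_pt subr0.
rewrite -invfM; congr (_^-1); rewrite mulrBr mulrCA mulfV// mulr1; congr (_ - _).
by apply: complex_ext; rewrite ?Re_pt ?Im_pt ?ReM ?ImM /= ?Re_pt ?Im_pt; ring.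
Qed.

(** Both sides are Lipschitz on the closed half-plane, so that equality in the
    open one suffices. *)
Lemma dilR_Lap a : 0 < a -> dilR a (Lap0 phi) = Lap0 (fun x => phi (a * x)).
Proof.
move=> a0; apply/funext => z; rewrite /dilR /Lap0.
have Rz w : Re (w / a%:C) = Re w / a.
  by rewrite -fmorphV mulrC ReM /= mul0r subr0 mulrC.
rewrite Rz pmulr_lge0 ?invr_gt0//; case: ifP => z0; last by rewrite mulr0.
have Sa : schwartz 1 (fun x => phi (a * x)) by exact: schwartz_dil (Sp 1%N).
set C := 4 * L1nrm (mulX (fun x => phi (a * x))) + nrm a%:C^-1 * (4 * L1nrm (mulX phi) * nrm a%:C^-1).
have C0 : 0 <= C by rewrite addr_ge0 ?mulr_ge0 ?L1nrm_ge0 ?nrm_ge0.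
have bnd (e : R) : 0 < e -> nrm (a%:C^-1 * Lap phi (z / a%:C) - Lap (fun x => phi (a * x)) z) <= C * e.
  move=> e0; pose w : CR := z + e%:C.
  have w0 : 0 < Re w by rewrite ReD ltr_wpDl.
  have za0 : 0 <= Re (z / a%:C) by rewrite Rz divr_ge0 ?(ltW a0).
  have wa0 : 0 <= Re (w / a%:C) by rewrite Rz divr_ge0 ?(ltW a0) ?(ltW w0).
  have l1 := Lap_lip Sa (ltW w0) z0.
  have l2 := Lap_lip (Sp 1%N) za0 wa0.
  have d1 : nrm (w - z) = e by rewrite /w addrC addKr nrm_real gtr0_norm.
  have d2 : nrm (z / a%:C - w / a%:C) = e * nrm a%:C^-1.
    by rewrite -mulrBl nrmM -opprB nrmN d1.
  have -> : a%:C^-1 * Lap phi (z / a%:C) - Lap (fun x => phi (a * x)) z =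
    a%:C^-1 * (Lap phi (z / a%:C) - Lap phi (w / a%:C)) +
    (Lap (fun x => phi (a * x)) w - Lap (fun x => phi (a * x)) z).
    by rewrite -(dilR_rhp a0 w0); ring.
  apply: (le_trans (nrmD _ _)); rewrite nrmM.
  rewrite d2 in l2; rewrite d1 in l1.
  have := ler_wpM2l (nrm_ge0 a%:C^-1) l2; rewrite /C; lra.
apply/eqP; rewrite -subr_eq0 -nrm_eq0 eq_le nrm_ge0 andbT leNgt; apply/negP => n0.
(* At this distance the Lipschitz bound is half the supposed difference. *)
have := bnd (nrm (a%:C^-1 * Lap phi (z / a%:C) - Lap (fun x => phi (a * x)) z) / (2 * (C + 1))).
have c1 : 0 < 2 * (C + 1) by lra.
rewrite divr_gt0// => /(_ isT); rewrite mulrA ler_pdivlMr// => h.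
by nra.
Qed.

End Representation.

Lemma Lap0_lin c phi psi : (forall n, schwartz n phi) -> (forall n, schwartz n psi) ->
  Lap0 (fun x => c * phi x + psi x) = (fun z => c * Lap0 phi z + Lap0 psi z).
Proof.
move=> Sp Sq; apply/funext => z; rewrite /Lap0; case: ifP => z0; last by rewrite mulr0 addr0.
by rewrite (LapD (schwartzZ c (Sp 1%N)) (Sq 1%N) z0) (LapZ c (Sp 1%N) z0).
Qed.

(** P is the operator that T becomes on the Laplace side. *)
Lemma operator_in_K_Lap (T : (CR -> CR) -> (CR -> CR)) (P : (R -> CR) -> (R -> CR)) :
  (forall phi, (forall n, schwartz n phi) -> T (Lap0 phi) = Lap0 (P phi)) ->
  (forall phi, (forall n, schwartz n phi) -> forall n, schwartz n (P phi)) ->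
  (forall c phi psi x, P (fun x => c * phi x + psi x) x = c * P phi x + P psi x) ->
  operator_in_K T.
Proof.
move=> TP SP lin; split.
  move=> f /= Kf; rewrite (spaceK_Lap0 Kf) TP; last exact: spaceK_schwartz.
  exact/Lap0_spaceK/SP/spaceK_schwartz.
move=> c f g Kf Kg; have Sf := spaceK_schwartz Kf; have Sg := spaceK_schwartz Kg.
have -> : (fun z => c * f z + g z) = Lap0 (fun x => c * invLap f x + invLap g x).
  by rewrite (Lap0_lin c Sf Sg) -!spaceK_Lap0.
rewrite TP; last by move=> n; exact: schwartzD (schwartzZ c (Sf n)) (Sg n).
have -> : T f = Lap0 (P (invLap f)) by rewrite {1}(spaceK_Lap0 Kf) TP.
have -> : T g = Lap0 (P (invLap g)) by rewrite {1}(spaceK_Lap0 Kg) TP.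
by rewrite -(Lap0_lin c (SP _ Sf) (SP _ Sg)); apply: eq_Lap0 => x _.
Qed.

Lemma opA_operator r : r != 0 -> operator_in_K (opA r).
Proof.
move=> r0; apply: (operator_in_K_Lap (T := opA r) (P := fun phi x => phi (x `^ r))).
- by move=> phi Sp; exact: opA_Lap.
- by move=> phi Sp n; exact: schwartz_powR.
- by move=> c phi psi x.
Qed.

Lemma fracD_operator h : operator_in_K (fracD h).
Proof.
apply: (operator_in_K_Lap (T := fracD h) (P := fun phi x => cpow x%:C h * phi x)).
- by move=> phi Sp; exact: fracD_Lap.
- by move=> phi Sp n; exact: schwartz_cpow.
- by move=> c phi psi x; ring.
Qed.

Lemma opA_comp r s f : r != 0 -> s != 0 -> spaceK f ->
  opA r (opA s f) = opA (r * s) f.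
Proof.
move=> r0 s0 Kf; have Sf := spaceK_schwartz Kf; rewrite (spaceK_Lap0 Kf).
have rs0 : r * s != 0 by rewrite mulf_neq0.
have Ss n : schwartz n (fun x => invLap f (x `^ s)) by exact: schwartz_powR.
rewrite (opA_Lap Sf s0) (opA_Lap Ss r0) (opA_Lap Sf rs0).
by apply: eq_Lap0 => x x0; rewrite powRrM.
Qed.

Lemma opA1 f : spaceK f -> opA 1 f = f.
Proof.
move=> Kf; rewrite [RHS](spaceK_Lap0 Kf) (opA_invLap Kf (oner_neq0 R)).
by apply: eq_Lap0 => x x0; rewrite powRr1// ltW.
Qed.

Lemma opAK r f : r != 0 -> spaceK f -> opA r (opA r^-1 f) = f.
Proof. by move=> r0 Kf; rewrite opA_comp ?invr_eq0// mulfV// opA1. Qed.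

Lemma opAVK r f : r != 0 -> spaceK f -> opA r^-1 (opA r f) = f.
Proof. by move=> r0 Kf; rewrite opA_comp ?invr_eq0// mulVf// opA1. Qed.

Lemma opA_invertible r : r != 0 -> invertible_in_K (opA r).
Proof.
move=> r0; have O := opA_operator r0; split; first exact: O.
split; first exact: O.1.
  move=> f g; rewrite !inE => Kf Kg e.
  by rewrite -(opAVK r0 Kf) e (opAVK r0 Kg).
move=> f /= Kf; exists (opA r^-1 f); last exact: (opAK r0 Kf).
have r1 : r^-1 != 0 by rewrite invr_eq0.
exact: (opA_operator r1).1.
Qed.

Lemma opAinvE r f : r != 0 -> spaceK f -> opAinv r f = opA r^-1 f.
Proof.
move=> r0 Kf; have [_ [_ inj _]] := opA_invertible r0.
have r1 : r^-1 != 0 by rewrite invr_eq0.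
have KV : spaceK (opA r^-1 f) by exact: (opA_operator r1).1.
rewrite -{1}(opAK r0 Kf); exact: (@pinvKV _ _ id spaceK (opA r) inj _ (mem_set KV)).
Qed.

Lemma cpow_powR x r h : 0 < x -> cpow (x `^ r)%:C h = cpow x%:C (r%:C * h).
Proof.
move=> x0; rewrite /cpow !clog_real ?powR_gt0// ln_powR rmorphM.
by congr cexp; ring.
Qed.

Lemma powR_invK x r : r != 0 -> 0 < x -> (x `^ r) `^ r^-1 = x.
Proof. by move=> r0 x0; rewrite -powRrM mulfV// powRr1// ltW. Qed.

Lemma opA_fracD r h f : r != 0 -> spaceK f ->
  opA r (fracD h (opAinv r f)) = fracD (r%:C * h) f.
Proof.
move=> r0 Kf; have Sf := spaceK_schwartz Kf; have r1 : r^-1 != 0 by rewrite invr_eq0.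
have S1 n : schwartz n (fun x => invLap f (x `^ r^-1)) by exact: schwartz_powR.
have S2 n : schwartz n (fun x => cpow x%:C h * invLap f (x `^ r^-1)) by exact: schwartz_cpow.
rewrite (opAinvE r0 Kf) (opA_invLap Kf r1) (fracD_Lap S1) (opA_Lap S2 r0).
rewrite (fracD_invLap _ Kf); apply: eq_Lap0 => x x0.
by rewrite (powR_invK r0 x0) (cpow_powR r h x0).
Qed.

Lemma opA_mulz r f : 0 < r -> spaceK f ->
  opA r (mulz (opAinv r f)) =
  (fun z => r%:C^-1 * fracD (1 - r%:C) (mulz f) z).
Proof.
move=> r_gt0 Kf; have r0 : r != 0 by rewrite gt_eqF.
have Sf := spaceK_schwartz Kf; have r1 : r^-1 != 0 by rewrite invr_eq0.
have [phi' [d S']] := schwartz_deriv Sf.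
have S1 n : schwartz n (fun x => invLap f (x `^ r^-1)) by exact: schwartz_powR.
pose psi' x := (r^-1)%:C * (cpow x%:C (r^-1 - 1)%:C * phi' (x `^ r^-1)).
have S2 n : schwartz n psi' by apply/schwartzZ/schwartz_cpow/schwartz_powR.
have d1 x : 0 < x -> is_cderive (fun x => invLap f (x `^ r^-1)) x (psi' x).
  move=> x0; have p0 : 0 < x `^ r^-1 by rewrite powR_gt0.
  apply: is_cderive_eq (is_cderive_comp (is_derive_powR r^-1 x0) (d _ p0)) _.
  rewrite /psi' cpow_real// rmorphM; ring.
rewrite (opAinvE r0 Kf) (opA_invLap Kf r1) (mulz_Lap S1 S2 d1) (opA_Lap S2 r0).
have -> : mulz f = Lap0 phi' by rewrite {1}(spaceK_Lap0 Kf) (mulz_Lap Sf S' d).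
rewrite (fracD_Lap S').
have S3 n : schwartz n (fun x => cpow x%:C (1 - r%:C) * phi' x) by exact: schwartz_cpow.
apply/funext => z; rewrite /Lap0; case: ifP => z0; last by rewrite mulr0.
rewrite -(LapZ r%:C^-1 (S3 1%N) z0); apply: eq_Lap => x x0.
rewrite /psi' (powR_invK r0 x0) (cpow_powR r _ x0) -rmorphM mulrBr mulfV// mulr1.
by rewrite fmorphV rmorphB rmorph1.
Qed.

Lemma opA_dilR r a f : 0 < r -> 0 < a -> spaceK f ->
  opAinv r (dilR a (opA r f)) = dilR (a `^ r) f.
Proof.
move=> r_gt0 a0 Kf; have r0 : r != 0 by rewrite gt_eqF.
have Sf := spaceK_schwartz Kf; have r1 : r^-1 != 0 by rewrite invr_eq0.
have S1 n : schwartz n (fun x => invLap f (x `^ r)) by exact: schwartz_powR.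
have S2 n : schwartz n (fun x => invLap f ((a * x) `^ r)) by exact: (schwartz_dil a0 (S1 n)).
rewrite (opA_invLap Kf r0) (dilR_Lap S1 a0) (opAinvE r0 (Lap0_spaceK S2)) (opA_Lap S2 r1).
rewrite [in RHS](spaceK_Lap0 Kf) (dilR_Lap Sf (powR_gt0 r a0)).
apply: eq_Lap0 => x x0; congr (invLap f _).
by rewrite powRM ?(ltW a0) ?powR_ge0// -powRrM mulVf// powRr1 ?(ltW x0).
Qed.

End Operators.

Theorem mainTheorem1 (R : realType) :
  (* the operators D_h are well defined in K *)
  (forall h : C R, operator_in_K (fracD h)) /\
  (forall (m : nat) (f : C R -> C R) (z : C R), spaceK f -> rhp z ->
    cvg (fracD_formula h f z @[h --> (- m.+1%:R : C R)^'])) /\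
  (forall alpha : R, alpha != 0 ->
    invertible_in_K (opA alpha) /\
    forall (h : C R) (f : C R -> C R), spaceK f ->
      opA alpha (fracD h (opAinv alpha f)) = fracD (alpha%:C * h) f) /\
  (forall alpha beta a : R, 0 < alpha -> 0 < beta -> 0 < a ->
    [/\ forall f : C R -> C R, spaceK f ->
          opA alpha (opA beta f) = opA (alpha * beta) f,
        forall f : C R -> C R, spaceK f ->
          opA alpha (mulz (opAinv alpha f)) =
          (fun z => alpha%:C^-1 * fracD (1 - alpha%:C) (mulz f) z)
      & forall f : C R -> C R, spaceK f ->
          opAinv alpha (dilR a (opA alpha f)) = dilR (a `^ alpha) f]).
Proof.
split; first exact: fracD_operator.
split.
  by move=> m f z Kf z0; apply: cvgP; exact: (fracD_formula_cvg Kf z0).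
split.
  move=> r r0; split; first exact: opA_invertible.
  by move=> h f; exact: opA_fracD.
move=> r s a r0 s0 a0; split.
- by move=> f; apply: opA_comp; rewrite gt_eqF.
- by move=> f; exact: opA_mulz.
- by move=> f; exact: opA_dilR.
Qed.
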